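(* Let $K$ be a commutative Hausdorff topological ring that is a product of finitely many fields, let $F$ be a subring of $K$ that is a field, let $(A,\sigma,u,\Lambda)$ be a unitary $F$-algebra and let $(P,[f])$ be a unimodular quadratic space over $(A,\sigma,u,\Lambda)$. Assume that: (0) $\mathbb{F}_2$ is not an epimorphic image of $K$; (1) $K^\times$ is open in $K$ and the map $a\mapsto a^{-1}:K^\times\to K^\times$ is continuous; (2) $F$ is dense in $K$ and $F\cap K^\times=F^\times$; (3) $A$ is a finitely generated projective $F$-module and $\Lambda$ is an $F$-summand of $A$. Let $\mathbf{O}=\mathbf{O}([f])$ be the affine group scheme over $F$ representing the functor $L\mapsto O([f_L])$ on commutative $F$-algebras, and let $\mathbf{O}^+$ be its connected component (of the identity). Give $\mathbf{O}^+(K)$ the topology induced from that of $K$ (see context). Then $\mathbf{O}^+(F)$ is dense in $\mathbf{O}^+(K)$.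
   Context: Quadratic spaces. Rings are associative and unital. Let $(A,\sigma)$ be a ring with involution and $u\in\mathrm{Cent}(A)$ with $u^\sigma u=1$. For a finitely generated projective right $A$-module $P$, $P^*=\mathrm{Hom}_A(P,A)$ is a right $A$-module via $(\psi a)x=a^\sigma(\psi x)$; for $f\in \mathrm{Hom}_A(P,Q)$, $f^*:Q^*\to P^*$ is $f^*\psi=\psi\circ f$; $\omega_P:P\to P^{**}$ is $(\omega_Px)\phi=(\phi x)^\sigma u$. For $f\in\mathrm{Hom}_A(P,P^* )$ write $\tilde f(x,y)=(fx)y$. A form parameter is an additive group $\Lambda$ with $\Lambda^{\min}(u)=\{a-a^\sigma u: a\in A\}\subseteq\Lambda\subseteq\Lambda^{\max}(u)=\{a\in A: a^\sigma u=-a\}$ and $a^\sigma\Lambda a\subseteq\Lambda$ for all $a\in A$; then $(A,\sigma,u,\Lambda)$ is called a unitary ring. Set $\Lambda_P=\{f\in\mathrm{Hom}_A(P,P^* ): f=-f^*\omega_P,\ \tilde f(x,x)\in\Lambda\ \forall x\in P\}$. A quadratic space over $(A,\sigma,u,\Lambda)$ is a pair $(P,[f])$ with $P$ finitely generated projective over $A$ and $[f]$ the class of $f\in\mathrm{Hom}_A(P,P^* )$ modulo $\Lambda_P$; it is unimodular if $h_f=f+f^*\omega_P:P\to P^*$ is bijective. An isometry $(P,[f])\to(P',[f'])$ is an isomorphism $\phi:P\to P'$ with $[\phi^*f'\phi]=[f]$; $O([f])$ is the group of self-isometries. A unitary $F$-algebra is a unitary ring $(A,\sigma,u,\Lambda)$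 with $A$ an $F$-algebra, $\sigma$ $F$-linear and $\Lambda$ an $F$-submodule. For a commutative $F$-algebra $L$, its scalar extension to $L$ is $(A_L,\sigma_L,u_L,\Lambda_L)$ with $A_L=A\otimes_FL$, $\sigma_L=\sigma\otimes\mathrm{id}$, $u_L=u\otimes 1$, $\Lambda_L$ the image of $\Lambda\otimes_F L$ in $A_L$; $P_L=P\otimes_FL$, and $f_L$ is determined by $\tilde f_L(x\otimes k,x'\otimes k')=\tilde f(x,x')\otimes kk'$. Under assumption (3), the functor $L\mapsto O([f_L])$ is representable by an affine group scheme of finite type over $F$. Topology. For an affine $K$-scheme $X$ of finite type and any closed immersion $X\to\mathbb{A}^n_K$, $X(K)$ is given the subspace topology from $\mathbb{A}^n_K(K)=K^n$ (product topology); this is independent of the immersion. For $X$ over $F$, $X(K)$ is topologized via the base change to $K$. *)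

(* Defs.v *)
From HB Require Import structures.
From mathcomp Require Import all_boot generic_quotient all_algebra.
From mathcomp Require Import -(notations) mpoly.
From mathcomp Require Import boolp classical_sets topology.

Set Implicit Arguments.
Unset Strict Implicit.
Unset Printing Implicit Defensive.

Import GRing.Theory.
Local Open Scope classical_set_scope.
Local Open Scope ring_scope.
Local Open Scope quotient_scope.

(* Right A-modules are left modules over the converse ring A^c: x a is written
   (a : A^c) *: x.  In particular A itself, as a right A-module, is A^c^o. *)

(* Direct summand of a free module of finite rank. *)
Definition fg_projective (R : pzRingType) (M : lmodType R) : Prop :=
  exists n (i : {linear M -> 'rV[R]_n}) (p : {linear 'rV[R]_n -> M}),
    cancel i p.

Lemma linear_ext (R : pzRingType) (M N : lmodType R) (f g : {linear M -> N}) :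
  f =1 g -> f = g.
Proof.
case: f g => f [[fD] [fZ]] [g [[gD] [gZ]]] /= /funext fg; subst g.
by rewrite (Prop_irrelevance fD gD) (Prop_irrelevance fZ gZ).
Qed.

Section TensorProduct.
Variables (F : comPzRingType) (M N : lmodType F).

Definition balanced (Z : zmodType) (b : M -> N -> Z) : Prop :=
  [/\ forall x x' y, b (x + x') y = b x y + b x' y,
      forall x y y', b x (y + y') = b x y + b x y' &
      forall c x y, b (c *: x) y = b x (c *: y)].

Definition formal_eval (Z : zmodType) (b : M -> N -> Z) (s : seq (M * N)) : Z :=
  \sum_(p <- s) b p.1 p.2.

(* Two formal sums of pure tensors are identified iff no balanced map tells
   them apart: this is the quotient having the universal property of the
   tensor product. *)
Definition tensor_rel (s t : seq (M * N)) : bool :=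
  `[< forall (Z : zmodType) (b : M -> N -> Z), balanced b ->
        formal_eval b s = formal_eval b t >].

Lemma tensor_rel_equiv : equiv_class_of tensor_rel.
Proof.
split=> [s|s t|t s r].
- by apply/asboolP.
- by apply/asboolP/asboolP => h Z b /h.
- by move=> /asboolP h1 /asboolP h2; apply/asboolP => Z b bb; rewrite h1 ?h2.
Qed.

Canonical tensor_equiv := EquivRelPack tensor_rel_equiv.

Definition tensor : Type := {eq_quot tensor_equiv}.

HB.instance Definition _ := Choice.on tensor.
HB.instance Definition _ := EqQuotient.on tensor.

Definition tens (x : M) (y : N) : tensor := \pi_tensor [:: (x, y)].

Definition tlift (Z : zmodType) (b : M -> N -> Z) (t : tensor) : Z :=
  formal_eval b (repr t).

Lemma tpiP (s t : seq (M * N)) :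
  reflect (forall (Z : zmodType) (b : M -> N -> Z), balanced b ->
             formal_eval b s = formal_eval b t)
          (\pi_tensor s == \pi_tensor t).
Proof. by rewrite eqmodE; apply: asboolP. Qed.

Lemma tlift_pi (Z : zmodType) (b : M -> N -> Z) s :
  balanced b -> tlift b (\pi_tensor s) = formal_eval b s.
Proof. by move=> bb; rewrite /tlift; apply/tpiP => //; rewrite reprK. Qed.

Lemma formal_eval_cat (Z : zmodType) (b : M -> N -> Z) s t :
  formal_eval b (s ++ t) = formal_eval b s + formal_eval b t.
Proof. exact: big_cat. Qed.

Lemma balanced0l (Z : zmodType) (b : M -> N -> Z) y : balanced b -> b 0 y = 0.
Proof. by case=> h _ _; apply: (addrI (b 0 y)); rewrite -h !addr0. Qed.

Lemma balanced0r (Z : zmodType) (b : M -> N -> Z) x : balanced b -> b x 0 = 0.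
Proof. by case=> _ h _; apply: (addrI (b x 0)); rewrite -h !addr0. Qed.

Lemma balancedNl (Z : zmodType) (b : M -> N -> Z) x y :
  balanced b -> b (- x) y = - b x y.
Proof.
move=> bb; apply: (addrI (b x y)); case: (bb) => h _ _.
by rewrite -h !subrr balanced0l.
Qed.

Definition formal_opp (s : seq (M * N)) := [seq (- p.1, p.2) | p <- s].

Lemma formal_eval_opp (Z : zmodType) (b : M -> N -> Z) s :
  balanced b -> formal_eval b (formal_opp s) = - formal_eval b s.
Proof.
move=> bb; rewrite /formal_eval big_map -sumrN.
by apply: eq_bigr => p _; rewrite balancedNl.
Qed.

Definition tensor_zero : tensor := \pi_tensor [::].
Definition tensor_add (t u : tensor) : tensor := \pi_tensor (repr t ++ repr u).
Definition tensor_opp (t : tensor) : tensor := \pi_tensor (formal_opp (repr t)).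

Lemma tensor_eq (t u : tensor) :
  (forall (Z : zmodType) (b : M -> N -> Z), balanced b -> tlift b t = tlift b u) ->
  t = u.
Proof. by move=> h; rewrite -[t]reprK -[u]reprK; apply/eqP/tpiP. Qed.

Lemma tlift_add (Z : zmodType) (b : M -> N -> Z) t u : balanced b ->
  tlift b (tensor_add t u) = tlift b t + tlift b u.
Proof. by move=> bb; rewrite tlift_pi // formal_eval_cat. Qed.

Lemma tlift_opp (Z : zmodType) (b : M -> N -> Z) t : balanced b ->
  tlift b (tensor_opp t) = - tlift b t.
Proof. by move=> bb; rewrite tlift_pi // formal_eval_opp. Qed.

Lemma tlift_zero (Z : zmodType) (b : M -> N -> Z) : balanced b ->
  tlift b tensor_zero = 0.
Proof. by move=> bb; rewrite tlift_pi // /formal_eval big_nil. Qed.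

Lemma tensor_addA : associative tensor_add.
Proof. by move=> t u v; apply: tensor_eq => Z b bb; rewrite !tlift_add // addrA. Qed.
Lemma tensor_addC : commutative tensor_add.
Proof. by move=> t u; apply: tensor_eq => Z b bb; rewrite !tlift_add // addrC. Qed.
Lemma tensor_add0 : left_id tensor_zero tensor_add.
Proof.
by move=> t; apply: tensor_eq => Z b bb; rewrite tlift_add // tlift_zero // add0r.
Qed.
Lemma tensor_addN : left_inverse tensor_zero tensor_opp tensor_add.
Proof.
move=> t; apply: tensor_eq => Z b bb.
by rewrite tlift_add // tlift_opp // tlift_zero // addNr.
Qed.

HB.instance Definition _ :=
  GRing.isZmodule.Build tensor tensor_addA tensor_addC tensor_add0 tensor_addN.

Lemma tliftD (Z : zmodType) (b : M -> N -> Z) t u : balanced b ->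
  tlift b (t + u) = tlift b t + tlift b u.
Proof. exact: tlift_add. Qed.

Lemma tlift_tens (Z : zmodType) (b : M -> N -> Z) x y : balanced b ->
  tlift b (tens x y) = b x y.
Proof. by move=> bb; rewrite tlift_pi // /formal_eval big_seq1. Qed.

Lemma tens_balanced : balanced tens.
Proof.
split=> [x x' y|x y y'|c x y]; apply: tensor_eq => Z b bb;
  rewrite ?tliftD // !tlift_tens //; by case: bb.
Qed.

Lemma tensDl x x' y : tens (x + x') y = tens x y + tens x' y.
Proof. by case: tens_balanced. Qed.
Lemma tensDr x y y' : tens x (y + y') = tens x y + tens x y'.
Proof. by case: tens_balanced. Qed.
Lemma tensZ c x y : tens (c *: x) y = tens x (c *: y).
Proof. by case: tens_balanced. Qed.

Lemma tensor_sum (t : tensor) : exists s, t = \sum_(p <- s) tens p.1 p.2.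
Proof.
exists (repr t); rewrite -[LHS]reprK; apply: tensor_eq => Z b bb.
rewrite tlift_pi //; elim: (repr t) => [|p s IH].
  by rewrite big_nil tlift_zero // /formal_eval big_nil.
rewrite big_cons tliftD // -IH tlift_tens // /formal_eval big_cons //.
Qed.

Lemma tensor_ind (P : tensor -> Prop) :
  P 0 -> (forall t u, P t -> P u -> P (t + u)) -> (forall x y, P (tens x y)) ->
  forall t, P t.
Proof.
move=> P0 PD Pt t; have [s ->] := tensor_sum t.
by elim: s => [|p s IH]; rewrite ?big_nil ?big_cons //; apply: PD.
Qed.

Lemma tliftDb (Z : zmodType) (b b' : M -> N -> Z) t :
  tlift (fun x y => b x y + b' x y) t = tlift b t + tlift b' t.
Proof. exact: big_split. Qed.

Lemma eq_tlift (Z : zmodType) (b b' : M -> N -> Z) t :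
  (forall x y, b x y = b' x y) -> tlift b t = tlift b' t.
Proof. by move=> h; apply: eq_bigr. Qed.

Lemma tlift0 (Z : zmodType) (b : M -> N -> Z) : balanced b -> tlift b 0 = 0.
Proof. exact: tlift_zero. Qed.

End TensorProduct.

(* MathComp's algType only has nontrivial algebras; A = 0 is allowed here. *)
Record algebra (F : comPzRingType) := Algebra {
  alg_sort :> pzRingType;
  alg_map : {rmorphism F -> alg_sort};
  alg_mapC : forall c a, alg_map c * a = a * alg_map c }.

Definition algebra_of (F : comNzRingType) (R : comAlgType F) : algebra F :=
  @Algebra F R (in_alg R) (fun c a => mulrC (in_alg R c) a).

(* A, resp. a right A-module P, as an F-module. *)
Definition algmod (F : comPzRingType) (A : algebra F) : Type := A.
Definition resmod (F : comPzRingType) (A : algebra F) (P : lmodType A^c) : Type :=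
  P.

Section RestrictionOfScalars.
Variables (F : comPzRingType) (A : algebra F) (P : lmodType A^c).

Let ascale (c : F) (a : A) : A := alg_map A c * a.
Let ascaleA c d a : ascale c (ascale d a) = ascale (c * d) a.
Proof. by rewrite /ascale rmorphM mulrA. Qed.
Let ascale1 a : ascale 1 a = a.
Proof. by rewrite /ascale rmorph1 mul1r. Qed.
Let ascaleDr c a b : ascale c (a + b) = ascale c a + ascale c b.
Proof. exact: mulrDr. Qed.
Let ascaleDl a c d : ascale (c + d) a = ascale c a + ascale d a.
Proof. by rewrite /ascale rmorphD mulrDl. Qed.

HB.instance Definition _ := GRing.Zmodule.on (algmod A).
HB.instance Definition _ := GRing.Zmodule_isLmodule.Build F (algmod A)
  ascaleA ascale1 ascaleDr ascaleDl.

Let pscale (c : F) (x : P) : P := (alg_map A c : A^c) *: x.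
Let pscaleA c d x : pscale c (pscale d x) = pscale (c * d) x.
Proof. by rewrite /pscale rmorphM alg_mapC scalerA. Qed.
Let pscale1 x : pscale 1 x = x.
Proof. by rewrite /pscale rmorph1 scale1r. Qed.
Let pscaleDr c x y : pscale c (x + y) = pscale c x + pscale c y.
Proof. exact: scalerDr. Qed.
Let pscaleDl x c d : pscale (c + d) x = pscale c x + pscale d x.
Proof. by rewrite /pscale rmorphD scalerDl. Qed.

HB.instance Definition _ := GRing.Zmodule.on (resmod P).
HB.instance Definition _ := GRing.Zmodule_isLmodule.Build F (resmod P)
  pscaleA pscale1 pscaleDr pscaleDl.

End RestrictionOfScalars.

Section ExtendAlgebra.
Variables (F : comNzRingType) (A : algebra F) (L : comAlgType F).

Definition extalg : Type := tensor (algmod A) L.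

HB.instance Definition _ := GRing.Zmodule.on extalg.

Definition atens (a : A) (k : L) : extalg := @tens F (algmod A) L a k.

Lemma algmodZ (c : F) (a : algmod A) : c *: a = alg_map A c * (a : A) :> A.
Proof. by []. Qed.

Lemma atensZ c a k : atens (alg_map A c * a) k = atens a (c *: k).
Proof. exact: (@tensZ F (algmod A) L c a k). Qed.

Let inner (a : A) (k : L) (w : extalg) : extalg :=
  tlift (fun (a' : algmod A) k' => atens (a * a') (k * k')) w.

Let inner_bal a k :
  balanced (fun (a' : algmod A) k' => atens (a * a') (k * k')).
Proof.
split=> [x x' y|x y y'|c x y] /=.
- by rewrite mulrDr /atens tensDl.
- by rewrite mulrDr /atens tensDr.
- by rewrite algmodZ mulrA -alg_mapC -mulrA -algmodZ /atens tensZ scalerAr.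
Qed.

Let inner_bal2 w : balanced (fun (a : algmod A) k => inner a k w).
Proof.
split=> [x x' y|x y y'|c x y] /=.
- by rewrite -tliftDb; apply: eq_tlift => a k; rewrite mulrDl /atens tensDl.
- by rewrite -tliftDb; apply: eq_tlift => a k; rewrite mulrDl /atens tensDr.
- apply: eq_tlift => a k.
  by rewrite algmodZ -mulrA -algmodZ /atens tensZ scalerAl.
Qed.

Definition extmul (z w : extalg) : extalg :=
  tlift (fun (a : algmod A) k => inner a k w) z.

Lemma extmul_tens a k a' k' :
  extmul (atens a k) (atens a' k') = atens (a * a') (k * k').
Proof. by rewrite /extmul tlift_tens // /inner tlift_tens. Qed.

Lemma extmulDl : left_distributive extmul +%R.
Proof. by move=> x y z; rewrite /extmul tliftD. Qed.

Lemma extmulDr : right_distributive extmul +%R.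
Proof.
move=> x y z; rewrite /extmul -tliftDb; apply: eq_tlift => a k.
by rewrite /inner tliftD.
Qed.

Lemma extalg_ind (Q : extalg -> Prop) :
  Q 0 -> (forall t u, Q t -> Q u -> Q (t + u)) -> (forall a k, Q (atens a k)) ->
  forall t, Q t.
Proof. exact: tensor_ind. Qed.

Lemma extmul0l z : extmul 0 z = 0.
Proof. by apply: (addrI (extmul 0 z)); rewrite -extmulDl !addr0. Qed.
Lemma extmul0r z : extmul z 0 = 0.
Proof. by apply: (addrI (extmul z 0)); rewrite -extmulDr !addr0. Qed.

Lemma extmulA : associative extmul.
Proof.
move=> x y z; elim/extalg_ind: x => [|t u ht hu|a k]; rewrite ?extmul0l //.
  by rewrite !extmulDl ht hu.
elim/extalg_ind: y => [|t u ht hu|b l]; rewrite ?(extmul0l, extmul0r) //.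
  by rewrite !(extmulDl, extmulDr) ht hu.
elim/extalg_ind: z => [|t u ht hu|c m]; rewrite ?extmul0r //.
  by rewrite !extmulDr ht hu.
by rewrite !extmul_tens !mulrA.
Qed.

Lemma extmul1l : left_id (atens 1 1) extmul.
Proof.
move=> z; elim/extalg_ind: z => [|t u ht hu|a k]; rewrite ?extmul0r //.
  by rewrite extmulDr ht hu.
by rewrite extmul_tens !mul1r.
Qed.

Lemma extmul1r : right_id (atens 1 1) extmul.
Proof.
move=> z; elim/extalg_ind: z => [|t u ht hu|a k]; rewrite ?extmul0l //.
  by rewrite extmulDl ht hu.
by rewrite extmul_tens !mulr1.
Qed.

HB.instance Definition _ := GRing.Zmodule_isPzRing.Build extalg
  extmulA extmul1l extmul1r extmulDl extmulDr.

Lemma atensM a k a' k' : atens a k * atens a' k' = atens (a * a') (k * k').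
Proof. exact: extmul_tens. Qed.

End ExtendAlgebra.

Record unitary_ring (A : pzRingType) := UnitaryRing {
  sigma : A -> A;
  uelt : A;
  Lambda : set A;
  sigmaD : {morph sigma : a b / a + b};
  sigmaM : forall a b, sigma (a * b) = sigma b * sigma a;
  sigmaK : involutive sigma;
  ueltC : forall a, uelt * a = a * uelt;
  ueltU : sigma uelt * uelt = 1;
  Lambda0 : Lambda 0;
  LambdaB : forall a b, Lambda a -> Lambda b -> Lambda (a - b);
  Lambda_min : forall a, Lambda (a - sigma a * uelt);
  Lambda_max : forall a, Lambda a -> sigma a * uelt = - a;
  Lambda_conj : forall a l, Lambda l -> Lambda (sigma a * l * a) }.

Definition mklinear (R : pzRingType) (M N : lmodType R) (g : M -> N)
    (gL : linear g) : {linear M -> N} :=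
  HB.pack g (GRing.isLinear.Build R M N *:%R g gL).

Section Dual.
Variables (A : pzRingType) (U : unitary_ring A) (P : lmodType A^c).

Local Notation "a ^σ" := (sigma U a) (at level 2, format "a ^σ").

Lemma sigma0 : 0^σ = 0.
Proof. by apply: (addrI 0^σ); rewrite -sigmaD !addr0. Qed.
Lemma sigma1 : 1^σ = 1.
Proof. by rewrite -[LHS]mulr1 -{2}(sigmaK U 1) -sigmaM mulr1 sigmaK. Qed.

(* P^* = Hom_A(P, A).  U is recorded because the A-module structure below
   depends on sigma. *)
Definition dual : Type := let _ := U in {linear P -> A^c^o}.
Definition dapp (psi : dual) (x : P) : A := (psi : {linear P -> A^c^o}) x.

HB.instance Definition _ := gen_eqMixin dual.
HB.instance Definition _ := gen_choiceMixin dual.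

Lemma dual_ext (f g : dual) : (forall x, dapp f x = dapp g x) -> f = g.
Proof. by move=> fg; apply: (@linear_ext _ P A^c^o f g) => x; exact: fg. Qed.

Lemma dappD f x y : dapp f (x + y) = dapp f x + dapp f y.
Proof. exact: (linearD (f : {linear P -> A^c^o})). Qed.

Lemma dappZ f (a : A) x : dapp f ((a : A^c) *: x) = dapp f x * a.
Proof. exact: (linearZZ (f : {linear P -> A^c^o})). Qed.

Lemma dapp_lin (g : P -> A) : (forall x y, g (x + y) = g x + g y) ->
  (forall (a : A) x, g ((a : A^c) *: x) = g x * a) -> linear (g : P -> A^c^o).
Proof. by move=> gD gZ a x y; rewrite gD gZ. Qed.

Definition mkdual (g : P -> A) (gD : forall x y, g (x + y) = g x + g y)
    (gZ : forall (a : A) x, g ((a : A^c) *: x) = g x * a) : dual :=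
  mklinear (dapp_lin gD gZ).

Fact dual_zeroD (x y : P) : 0 = 0 + 0 :> A. Proof. by rewrite addr0. Qed.
Fact dual_zeroZ (a : A) (x : P) : 0 = 0 * a :> A. Proof. by rewrite mul0r. Qed.
Definition dual_zero : dual := mkdual dual_zeroD dual_zeroZ.

Fact dual_addD (f g : dual) x y :
  dapp f (x + y) + dapp g (x + y) = dapp f x + dapp g x + (dapp f y + dapp g y).
Proof. by rewrite !dappD addrACA. Qed.
Fact dual_addZ (f g : dual) (a : A) x :
  dapp f ((a : A^c) *: x) + dapp g ((a : A^c) *: x) = (dapp f x + dapp g x) * a.
Proof. by rewrite !dappZ mulrDl. Qed.
Definition dual_add (f g : dual) : dual :=
  mkdual (dual_addD f g) (dual_addZ f g).

Fact dual_oppD (f : dual) x y : - dapp f (x + y) = - dapp f x + - dapp f y.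
Proof. by rewrite dappD opprD. Qed.
Fact dual_oppZ (f : dual) (a : A) x : - dapp f ((a : A^c) *: x) = - dapp f x * a.
Proof. by rewrite dappZ mulNr. Qed.
Definition dual_opp (f : dual) : dual := mkdual (dual_oppD f) (dual_oppZ f).

Fact dual_addA : associative dual_add.
Proof. by move=> f g h; apply: dual_ext => x; apply: addrA. Qed.
Fact dual_addC : commutative dual_add.
Proof. by move=> f g; apply: dual_ext => x; apply: addrC. Qed.
Fact dual_add0 : left_id dual_zero dual_add.
Proof. by move=> f; apply: dual_ext => x; apply: add0r. Qed.
Fact dual_addN : left_inverse dual_zero dual_opp dual_add.
Proof. by move=> f; apply: dual_ext => x; apply: addNr. Qed.

HB.instance Definition _ :=
  GRing.isZmodule.Build dual dual_addA dual_addC dual_add0 dual_addN.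

Fact dual_scaleD (a : A) (f : dual) x y :
  a^σ * dapp f (x + y) = a^σ * dapp f x + a^σ * dapp f y.
Proof. by rewrite dappD mulrDr. Qed.
Fact dual_scaleZ (a : A) (f : dual) (b : A) x :
  a^σ * dapp f ((b : A^c) *: x) = a^σ * dapp f x * b.
Proof. by rewrite dappZ mulrA. Qed.
(* The right A-module structure (psi a) x = a^σ (psi x). *)
Definition dual_scale (a : A^c) (f : dual) : dual :=
  mkdual (dual_scaleD a f) (dual_scaleZ a f).

Fact dual_scaleA a b f : dual_scale a (dual_scale b f) = dual_scale (a * b) f.
Proof.
apply: dual_ext => x; rewrite /dapp /=.
by rewrite mulrA -sigmaM.
Qed.
Fact dual_scale1 f : dual_scale 1 f = f.
Proof. by apply: dual_ext => x; rewrite /dapp /= sigma1 mul1r. Qed.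
Fact dual_scaleDr : right_distributive dual_scale +%R.
Proof. by move=> a f g; apply: dual_ext => x; rewrite /dapp /= -mulrDr. Qed.
Fact dual_scaleDl f : {morph dual_scale^~ f : a b / a + b}.
Proof. by move=> a b; apply: dual_ext => x; rewrite /dapp /= sigmaD mulrDl. Qed.

HB.instance Definition _ := GRing.Zmodule_isLmodule.Build A^c dual
  dual_scaleA dual_scale1 dual_scaleDr dual_scaleDl.

End Dual.

Notation "a ^σ[ U ]" := (sigma U a) (at level 2, format "a ^σ[ U ]").

Section QuadraticSpaces.
Variables (A : pzRingType) (U : unitary_ring A).

Section DualMap.
Variables (P Q : lmodType A^c) (f : {linear P -> Q}).

Fact dual_mapD (psi : dual U Q) x y :
  dapp psi (f (x + y)) = dapp psi (f x) + dapp psi (f y).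
Proof. by rewrite linearD dappD. Qed.
Fact dual_mapZ (psi : dual U Q) (a : A) x :
  dapp psi (f ((a : A^c) *: x)) = dapp psi (f x) * a.
Proof. by rewrite linearZZ dappZ. Qed.

Definition dual_map_fun (psi : dual U Q) : dual U P :=
  mkdual U (dual_mapD psi) (dual_mapZ psi).

Fact dual_map_linear : linear dual_map_fun.
Proof. by move=> a p q; apply: dual_ext => x. Qed.

Definition dual_map : {linear dual U Q -> dual U P} := mklinear dual_map_linear.
End DualMap.

Section QuadraticForms.
Variable P : lmodType A^c.

Fact omegaD (x : P) (phi psi : dual U P) :
  (dapp (phi + psi) x)^σ[U] * uelt U =
  (dapp phi x)^σ[U] * uelt U + (dapp psi x)^σ[U] * uelt U.
Proof. by rewrite -mulrDl -sigmaD. Qed.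
Fact omegaZ (x : P) (a : A) (phi : dual U P) :
  (dapp ((a : A^c) *: phi) x)^σ[U] * uelt U =
  (dapp phi x)^σ[U] * uelt U * a.
Proof. by rewrite -mulrA ueltC mulrA -[a in RHS](sigmaK U) -sigmaM. Qed.

Definition omega_fun (x : P) : dual U (dual U P) :=
  mkdual U (omegaD x) (omegaZ x).

Fact omega_linear : linear omega_fun.
Proof.
move=> a x y; apply: dual_ext => phi; rewrite /dapp /= -/(dapp phi _).
by rewrite dappD dappZ sigmaD sigmaM mulrDl mulrA.
Qed.

(* (omega x) phi = (phi x)^σ u *)
Definition omega : {linear P -> dual U (dual U P)} := mklinear omega_linear.

Definition ftilde (f : {linear P -> dual U P}) (x y : P) : A := dapp (f x) y.

Definition hform (f : {linear P -> dual U P}) (x : P) : dual U P :=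
  f x + dual_map f (omega x).

Definition unimodular (f : {linear P -> dual U P}) : Prop :=
  bijective (hform f).

Definition LambdaP : set {linear P -> dual U P} :=
  [set f : {linear P -> dual U P} | (forall x, f x = - dual_map f (omega x)) /\
           (forall x, Lambda U (ftilde f x x))].

(* [f] = f + Lambda_P *)
Definition qclass (f : {linear P -> dual U P}) : set {linear P -> dual U P} :=
  [set g : {linear P -> dual U P} | exists2 l, LambdaP l & forall x, g x = f x + l x].

End QuadraticForms.

Definition pullback (P P' : lmodType A^c) (phi : {linear P -> P'})
    (f' : {linear P' -> dual U P'}) : {linear P -> dual U P} :=
  dual_map phi \o f' \o phi.

End QuadraticSpaces.

Record isometry (A : pzRingType) (U : unitary_ring A) (P P' : lmodType A^c)
    (f : {linear P -> dual U P}) (f' : {linear P' -> dual U P'}) := Isometry {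
  iso_map :> {linear P -> P'};
  iso_bij : bijective iso_map;
  iso_qclass : qclass (pullback iso_map f') = qclass f }.

Record unitary_algebra (F : comPzRingType) (A : algebra F) := UnitaryAlgebra {
  unitary_of :> unitary_ring A;
  sigma_lin : forall c (a : A),
    sigma unitary_of (alg_map A c * a) = alg_map A c * sigma unitary_of a;
  Lambda_lin : forall c (a : A),
    Lambda unitary_of a -> Lambda unitary_of (alg_map A c * a) }.

Definition F_summand (F : comPzRingType) (A : algebra F) (U : unitary_algebra A) :
    Prop :=
  exists N : set A,
    [/\ N 0, forall a b, N a -> N b -> N (a + b),
        forall c a, N a -> N (alg_map A c * a) &
        forall a, exists! ln : A * A,
          [/\ Lambda U ln.1, N ln.2 & a = ln.1 + ln.2]].

Section ExtendUnitary.
Variables (F : comNzRingType) (A : algebra F) (U : unitary_algebra A).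
Variable L : comAlgType F.
Local Notation AL := (extalg A L).

Let sig_bal : balanced (fun (a : algmod A) k => atens (a^σ[U]) k : AL).
Proof.
split=> [x x' y|x y y'|c x y]; rewrite /atens.
- by rewrite sigmaD tensDl.
- by rewrite tensDr.
- by rewrite algmodZ sigma_lin -algmodZ tensZ.
Qed.

Definition ext_sigma (z : AL) : AL :=
  tlift (fun (a : algmod A) k => atens (a^σ[U]) k) z.

Lemma ext_sigma_tens a k : ext_sigma (atens a k) = atens (a^σ[U]) k.
Proof. exact: tlift_tens. Qed.

Fact ext_sigmaD : {morph ext_sigma : x y / x + y}.
Proof. by move=> x y; exact: tliftD. Qed.

Fact ext_sigma0 : ext_sigma 0 = 0.
Proof. exact: tlift0. Qed.

Fact ext_sigmaM x y : ext_sigma (x * y) = ext_sigma y * ext_sigma x.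
Proof.
elim/extalg_ind: x => [|t u ht hu|a k].
- by rewrite mul0r ext_sigma0 mulr0.
- by rewrite mulrDl !ext_sigmaD ht hu mulrDr.
elim/extalg_ind: y => [|t u ht hu|b l].
- by rewrite mulr0 ext_sigma0 mul0r.
- by rewrite mulrDr !ext_sigmaD ht hu mulrDl.
by rewrite atensM !ext_sigma_tens sigmaM mulrC atensM.
Qed.

Fact ext_sigmaK : involutive ext_sigma.
Proof.
elim/extalg_ind => [|t v ht hv|a k]; first by rewrite !ext_sigma0.
  by rewrite !ext_sigmaD ht hv.
by rewrite !ext_sigma_tens sigmaK.
Qed.

Definition ext_u : AL := atens (uelt U) 1.

Fact ext_uC (z : AL) : ext_u * z = z * ext_u.
Proof.
elim/extalg_ind: z => [|t v ht hv|a k]; first by rewrite mulr0 mul0r.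
  by rewrite mulrDr mulrDl ht hv.
by rewrite !atensM ueltC mul1r mulr1.
Qed.

Fact ext_uU : ext_sigma ext_u * ext_u = 1.
Proof.
by rewrite ext_sigma_tens atensM ueltU mulr1.
Qed.

(* The image of Lambda ⊗ L in A ⊗ L. *)
Definition ext_Lambda : set AL :=
  [set z | exists2 s : seq (A * L), (forall p, p \in s -> Lambda U p.1) &
     z = \sum_(p <- s) @atens F A L p.1 p.2].

Fact ext_LambdaD x y : ext_Lambda x -> ext_Lambda y -> ext_Lambda (x + y).
Proof.
move=> [s hs ->] [t ht ->]; exists (s ++ t); last by rewrite big_cat.
by move=> p; rewrite mem_cat => /orP[/hs|/ht].
Qed.

Fact ext_Lambda0 : ext_Lambda 0.
Proof. by exists [::]; rewrite ?big_nil. Qed.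

Fact ext_Lambda_tens (a : A) (k : L) : Lambda U a -> ext_Lambda (atens a k).
Proof. by move=> ha; exists [:: (a, k)] => [p /[!inE] /eqP->|]; rewrite ?big_seq1. Qed.

Lemma LambdaN a : Lambda U a -> Lambda U (- a).
Proof. by move=> ha; rewrite -sub0r; apply: LambdaB => //; exact: Lambda0. Qed.

Lemma atensDl (a b : A) (k : L) : atens (a + b) k = atens a k + atens b k.
Proof. exact: tensDl. Qed.
Lemma atensDr (a : A) (k l : L) : atens a (k + l) = atens a k + atens a l :> AL.
Proof. exact: tensDr. Qed.
Lemma atensN (a : A) (k : L) : atens (- a) k = - atens a k.
Proof. exact: (balancedNl _ _ (tens_balanced _ _)). Qed.

Fact ext_LambdaB x y : ext_Lambda x -> ext_Lambda y -> ext_Lambda (x - y).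
Proof.
move=> hx [s hs ->]; apply: ext_LambdaD => //.
exists [seq (- p.1, p.2) | p <- s].
  by move=> p /mapP[q /hs hq ->]; exact: LambdaN.
by rewrite big_map -sumrN; apply: eq_bigr => p _; rewrite atensN.
Qed.

Fact ext_Lambda_min (z : AL) : ext_Lambda (z - ext_sigma z * ext_u).
Proof.
elim/extalg_ind: z => [|t v ht hv|a k].
- by rewrite ext_sigma0 mul0r subr0; exact: ext_Lambda0.
- rewrite ext_sigmaD mulrDl opprD addrACA.
  exact: ext_LambdaD.
- rewrite ext_sigma_tens atensM mulr1 -atensN -atensDl.
  by apply: ext_Lambda_tens; exact: Lambda_min.
Qed.

Fact ext_Lambda_max (z : AL) :
  ext_Lambda z -> ext_sigma z * ext_u = - z.
Proof.
move=> [s hs ->]; elim: s hs => [|p s IH] hs.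
  by rewrite big_nil ext_sigma0 mul0r oppr0.
rewrite big_cons ext_sigmaD mulrDl opprD; congr (_ + _).
  rewrite ext_sigma_tens atensM mulr1 -atensN.
  by congr atens; apply: Lambda_max; apply: hs; rewrite inE eqxx.
by apply: IH => q qs; apply: hs; rewrite inE qs orbT.
Qed.

Fact ext_Lambda_conj (z w : AL) :
  ext_Lambda w -> ext_Lambda (ext_sigma z * w * z).
Proof.
move=> hw; elim/extalg_ind: z => [|t v ht hv|a k].
- by rewrite mulr0; exact: ext_Lambda0.
- have cross : ext_Lambda (ext_sigma t * w * v + ext_sigma v * w * t).
    have -> : ext_sigma v * w * t = - (ext_sigma (ext_sigma t * w * v) * ext_u).
      rewrite !ext_sigmaM ext_sigmaK -!mulrA -ext_uC (mulrA _ ext_u).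
      by rewrite (ext_Lambda_max hw) mulNr mulrN opprK.
    exact: ext_Lambda_min.
  rewrite ext_sigmaD !mulrDl !mulrDr.
  rewrite -addrA [X in _ + X]addrA [X in _ + X]addrC addrA.
  by apply: ext_LambdaD => //; apply: ext_LambdaD.
- case: hw => s hs ->; rewrite mulr_sumr mulr_suml.
  elim: s hs => [|p s IH] hs; first by rewrite big_nil; exact: ext_Lambda0.
  rewrite big_cons; apply: ext_LambdaD; last first.
    by apply: IH => q qs; apply: hs; rewrite inE qs orbT.
  rewrite ext_sigma_tens atensM atensM.
  by apply/ext_Lambda_tens/Lambda_conj/hs; rewrite inE eqxx.
Qed.

Definition ext_unitary : unitary_ring AL :=
  UnitaryRing ext_sigmaD ext_sigmaM ext_sigmaK ext_uC ext_uU ext_Lambda0 ext_LambdaB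
    ext_Lambda_min ext_Lambda_max ext_Lambda_conj.

End ExtendUnitary.

Section ExtendModule.
Variables (F : comNzRingType) (A : algebra F) (P : lmodType A^c).
Variable L : comAlgType F.
Local Notation AL := (extalg A L).

Definition extmod : Type := tensor (resmod P) L.

HB.instance Definition _ := GRing.Zmodule.on extmod.

Definition ptens (x : P) (k : L) : extmod := @tens F (resmod P) L x k.

Lemma resmodZ (c : F) (x : resmod P) :
  c *: x = (alg_map A c : A^c) *: (x : P) :> P.
Proof. by []. Qed.

Lemma extmod_ind (Q : extmod -> Prop) :
  Q 0 -> (forall t u, Q t -> Q u -> Q (t + u)) -> (forall x k, Q (ptens x k)) ->
  forall t, Q t.
Proof. exact: tensor_ind. Qed.

Lemma ptensDl x y k : ptens (x + y) k = ptens x k + ptens y k.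
Proof. exact: tensDl. Qed.
Lemma ptensDr x k l : ptens x (k + l) = ptens x k + ptens x l.
Proof. exact: tensDr. Qed.
Lemma ptensZ (c : F) x k : ptens ((alg_map A c : A^c) *: x) k = ptens x (c *: k).
Proof. exact: (@tensZ F (resmod P) L c x k). Qed.

Let inner (x : P) (k : L) (w : AL) : extmod :=
  tlift (fun (a : algmod A) l => ptens ((a : A^c) *: x) (k * l)) w.

Let inner_bal x k :
  balanced (fun (a : algmod A) l => ptens ((a : A^c) *: x) (k * l)).
Proof.
split=> [a b l|a l m|c a l] /=.
- by rewrite -ptensDl -scalerDl.
- by rewrite mulrDr ptensDr.
- rewrite algmodZ -scalerAr -ptensZ scalerA; congr (ptens (_ *: _) _).
  exact: alg_mapC.
Qed.

Let inner_bal2 w : balanced (fun (x : resmod P) k => inner x k w).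
Proof.
split=> [x y k|x k l|c x k] /=.
- by rewrite -tliftDb; apply: eq_tlift => a l; rewrite scalerDr ptensDl.
- by rewrite -tliftDb; apply: eq_tlift => a m; rewrite mulrDl ptensDr.
- apply: eq_tlift => a l; rewrite resmodZ -scalerAl -ptensZ !scalerA.
  by congr (ptens (_ *: _) _); exact: alg_mapC.
Qed.

Definition ext_scale (w : AL^c) (z : extmod) : extmod :=
  tlift (fun (x : resmod P) k => inner x k w) z.

Lemma ext_scale_tens (a : A) l x k :
  ext_scale (atens a l) (ptens x k) = ptens ((a : A^c) *: x) (k * l).
Proof. by rewrite /ext_scale tlift_tens // /inner tlift_tens. Qed.

Fact ext_scaleDr : right_distributive ext_scale +%R.
Proof. by move=> w x y; exact: tliftD. Qed.

Fact ext_scaleDl x : {morph ext_scale^~ x : v w / v + w}.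
Proof.
move=> v w; rewrite /ext_scale -tliftDb; apply: eq_tlift => y k.
exact: tliftD.
Qed.

Lemma ext_scale0r w : ext_scale w 0 = 0.
Proof. exact: tlift0. Qed.
Lemma ext_scale0l x : ext_scale 0 x = 0.
Proof. by apply: (addrI (ext_scale 0 x)); rewrite -ext_scaleDl !addr0. Qed.

Fact ext_scaleA v w x : ext_scale v (ext_scale w x) = ext_scale (v * w) x.
Proof.
elim/extmod_ind: x => [|t u ht hu|x k]; first by rewrite !ext_scale0r.
  by rewrite !ext_scaleDr ht hu.
elim/extalg_ind: v => [|t u ht hu|a l]; first by rewrite mul0r !ext_scale0l.
  by rewrite mulrDl !ext_scaleDl ht hu.
elim/extalg_ind: w => [|t u ht hu|b m].
- by rewrite mulr0 !ext_scale0l ext_scale0r.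
- by rewrite mulrDr !ext_scaleDl ext_scaleDr ht hu.
have -> : (atens a l : AL^c) * atens b m = atens (b * a) (m * l).
  exact: atensM.
by rewrite !ext_scale_tens scalerA mulrA.
Qed.

Fact ext_scale1 x : ext_scale 1 x = x.
Proof.
elim/extmod_ind: x => [|t u ht hu|x k]; first by rewrite ext_scale0r.
  by rewrite ext_scaleDr ht hu.
by rewrite ext_scale_tens scale1r mulr1.
Qed.

HB.instance Definition _ := GRing.Zmodule_isLmodule.Build AL^c extmod
  ext_scaleA ext_scale1 ext_scaleDr ext_scaleDl.

Lemma ptensM (a : A) l x k :
  (atens a l : AL^c) *: ptens x k = ptens ((a : A^c) *: x) (k * l).
Proof. exact: ext_scale_tens. Qed.

End ExtendModule.

Section ExtendForm.
Variables (F : comNzRingType) (A : algebra F) (U : unitary_algebra A).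
Variables (P : lmodType A^c) (L : comAlgType F).
Variable f : {linear P -> dual U P}.
Local Notation AL := (extalg A L).
Local Notation PL := (extmod P L).
Local Notation UL := (ext_unitary U L).

Lemma ftildeDl x x' y : ftilde f (x + x') y = ftilde f x y + ftilde f x' y.
Proof. by rewrite /ftilde linearD. Qed.
Lemma ftildeDr x y y' : ftilde f x (y + y') = ftilde f x y + ftilde f x y'.
Proof. exact: dappD. Qed.
Lemma ftildeZl (a : A) x y :
  ftilde f ((a : A^c) *: x) y = a^σ[U] * ftilde f x y.
Proof. by rewrite /ftilde linearZZ. Qed.
Lemma ftildeZr (a : A) x y : ftilde f x ((a : A^c) *: y) = ftilde f x y * a.
Proof. exact: dappZ. Qed.

Lemma sigma_alg_map c : (alg_map A c)^σ[U] = alg_map A c.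
Proof. by rewrite -[alg_map A c]mulr1 sigma_lin sigma1. Qed.

Let inner (x : P) (k : L) (w : PL) : AL :=
  tlift (fun (y : resmod P) l => atens (ftilde f x y) (k * l)) w.

Let inner_bal x k :
  balanced (fun (y : resmod P) l => atens (ftilde f x y) (k * l) : AL).
Proof.
split=> [y y' l|y l m|c y l] /=.
- by rewrite ftildeDr atensDl.
- by rewrite mulrDr atensDr.
- by rewrite resmodZ ftildeZr -alg_mapC -scalerAr -atensZ.
Qed.

Let inner_bal2 w : balanced (fun (x : resmod P) k => inner x k w).
Proof.
split=> [x y k|x k l|c x k] /=.
- by rewrite -tliftDb; apply: eq_tlift => y' l; rewrite ftildeDl atensDl.
- by rewrite -tliftDb; apply: eq_tlift => y' m; rewrite mulrDl atensDr.
- apply: eq_tlift => y l.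
  by rewrite resmodZ ftildeZl sigma_alg_map -scalerAl -atensZ.
Qed.

Definition ext_ftilde (z w : PL) : AL :=
  tlift (fun (x : resmod P) k => inner x k w) z.

Lemma ext_ftilde_tens x k x' k' :
  ext_ftilde (ptens x k) (ptens x' k') = atens (ftilde f x x') (k * k').
Proof. by rewrite /ext_ftilde tlift_tens // /inner tlift_tens. Qed.

Lemma ext_ftildeDl z z' w :
  ext_ftilde (z + z') w = ext_ftilde z w + ext_ftilde z' w.
Proof. exact: tliftD. Qed.
Fact ext_ftildeDr z w w' :
  ext_ftilde z (w + w') = ext_ftilde z w + ext_ftilde z w'.
Proof. by rewrite -tliftDb; apply: eq_tlift => x k; exact: tliftD. Qed.
Lemma ext_ftilde0l w : ext_ftilde 0 w = 0.
Proof. exact: tlift0. Qed.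
Lemma ext_ftilde0r z : ext_ftilde z 0 = 0.
Proof. by apply: (addrI (ext_ftilde z 0)); rewrite -ext_ftildeDr !addr0. Qed.

Let ext_scalerDl (a b : AL) (z : PL) :
  ((a + b : AL) : AL^c) *: z = (a : AL^c) *: z + (b : AL^c) *: z.
Proof. exact: scalerDl. Qed.

Fact ext_ftildeZr z (a : AL) w :
  ext_ftilde z ((a : AL^c) *: w) = ext_ftilde z w * a.
Proof.
elim/extmod_ind: z => [|t u ht hu|x k]; first by rewrite !ext_ftilde0l mul0r.
  by rewrite !ext_ftildeDl ht hu mulrDl.
elim/extmod_ind: w => [|t u ht hu|y l].
- by rewrite scaler0 ext_ftilde0r mul0r.
- by rewrite scalerDr !ext_ftildeDr ht hu mulrDl.
elim/extalg_ind: a => [|t u ht hu|a m].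
- by rewrite [0 *: _]scale0r ext_ftilde0r mulr0.
- by rewrite ext_scalerDl ext_ftildeDr ht hu mulrDr.
by rewrite ptensM !ext_ftilde_tens atensM ftildeZr mulrA.
Qed.

Fact ext_ftildeZl z (a : AL) w :
  ext_ftilde ((a : AL^c) *: z) w = ext_sigma U a * ext_ftilde z w.
Proof.
elim/extmod_ind: z => [|t u ht hu|x k].
- by rewrite scaler0 !ext_ftilde0l mulr0.
- by rewrite scalerDr !ext_ftildeDl ht hu mulrDr.
elim/extmod_ind: w => [|t u ht hu|y l].
- by rewrite !ext_ftilde0r mulr0.
- by rewrite !ext_ftildeDr ht hu mulrDr.
elim/extalg_ind: a => [|t u ht hu|a m].
- by rewrite [0 *: _]scale0r ext_ftilde0l ext_sigma0 mul0r.
- by rewrite ext_scalerDl ext_ftildeDl ht hu ext_sigmaD mulrDl.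
by rewrite ptensM ext_sigma_tens !ext_ftilde_tens atensM ftildeZl mulrCA mulrA.
Qed.

Definition ext_form_fun (z : PL) : dual UL PL :=
  @mkdual _ UL PL (ext_ftilde z) (ext_ftildeDr z) (ext_ftildeZr z).

Fact ext_form_linear : linear ext_form_fun.
Proof.
move=> a z z'; apply: dual_ext => w; rewrite /dapp /=.
by rewrite ext_ftildeDl ext_ftildeZl.
Qed.

Definition ext_form : {linear PL -> dual UL PL} := mklinear ext_form_linear.

Lemma ext_formE x k x' k' :
  ftilde ext_form (ptens x k) (ptens x' k') = atens (ftilde f x x') (k * k').
Proof. exact: ext_ftilde_tens. Qed.

End ExtendForm.

Section OrthogonalGroupScheme.
Variables (F : comNzRingType) (A : algebra F) (U : unitary_algebra A).
Variables (P : lmodType A^c) (f : {linear P -> dual U P}).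

(* id_P ⊗ h *)
Definition extmod_map (L L' : comAlgType F) (h : {lrmorphism L -> L'})
    (z : extmod P L) : extmod P L' :=
  tlift (fun (x : resmod P) k => ptens x (h k)) z.

(* O([f_L]) *)
Definition Oisom (L : comAlgType F) : Type :=
  isometry (ext_form L f) (ext_form L f).

(* Spec R represents L |-> O([f_L]).  By rep_nat, an L-point phi followed by
   h : L -> L' corresponds to the base change of the isometry of phi, which is
   determined by its values on the elements extmod_map h z.  The group law of
   Spec R is the one transported along rep.  MathComp's comAlgType excludes the
   zero algebra, over which both functors have exactly one point. *)
Record represents (R : comAlgType F) := Represents {
  rep : forall L : comAlgType F, {lrmorphism R -> L} -> Oisom L;
  rep_bij : forall L, bijective (@rep L);
  rep_nat : forall (L L' : comAlgType F) (h : {lrmorphism L -> L'})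
    (phi : {lrmorphism R -> L}) (z : extmod P L),
    rep (h \o phi : {lrmorphism R -> L'}) (extmod_map h z) =
    extmod_map h (rep phi z) }.

Definition is_identity_point (R : comAlgType F) (O : represents R)
    (eps : {lrmorphism R -> F^o}) : Prop :=
  forall z, rep O eps z = z.

End OrthogonalGroupScheme.

Section Spectrum.
Variable R : comPzRingType.

Definition prime_ideal (p : set R) : Prop :=
  [/\ p 0, forall x y, p x -> p y -> p (x + y), forall a x, p x -> p (a * x),
      ~ p 1 & forall x y, p (x * y) -> p x \/ p y].

Definition Spec : Type := {p : set R | prime_ideal p}.

HB.instance Definition _ := gen_eqMixin Spec.
HB.instance Definition _ := gen_choiceMixin Spec.

(* The complement of V(E). *)
Definition zariski_basic (E : set R) : set Spec :=
  [set p | exists2 r, E r & ~ sval p r].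

Definition zariski_open : set_system Spec :=
  [set V | exists E, V = zariski_basic E].

Fact zariski_openT : zariski_open setT.
Proof.
exists [set 1]; apply/seteqP; split=> // -[p pp] _.
by exists 1 => //=; case: pp.
Qed.

Fact zariski_openI : setI_closed zariski_open.
Proof.
move=> _ _ [E ->] [E' ->].
exists [set r | exists x y, [/\ E x, E' y & r = x * y]].
apply/seteqP; split=> p /=; have [_ _ pM _ pp] := svalP p.
  move=> [[x Ex px] [y Ey py]]; exists (x * y); first by exists x, y.
  by move=> /pp[].
move=> [_ [x [y [Ex Ey ->]]] pxy].
split; [exists x|exists y] => //= h; apply: pxy; last exact: pM.
by rewrite mulrC; exact: pM.
Qed.

Fact zariski_open_bigU (I : Type) (V : I -> set Spec) :
  (forall i, zariski_open (V i)) -> zariski_open (\bigcup_i V i).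
Proof.
move=> hV; exists [set r | exists i E, V i = zariski_basic E /\ E r].
apply/seteqP; split=> p.
  move=> [i _]; have [E VE] := hV i; rewrite VE => -[r Er pr].
  by exists r => //; exists i, E.
by move=> [r [i [E [VE Er]]] pr]; exists i => //; rewrite VE; exists r.
Qed.

HB.instance Definition _ :=
  isOpenTopological.Build Spec zariski_openT zariski_openI zariski_open_bigU.

End Spectrum.

Section SpectrumMaps.

Fact comap_prime (R S : comPzRingType) (phi : {rmorphism R -> S}) (q : Spec S) :
  prime_ideal (phi @^-1` sval q).
Proof.
case: q => q [q0 qD qM q1 qp] /=; split=> /=.
- by rewrite rmorph0.
- by move=> x y; rewrite rmorphD; exact: qD.
- by move=> a x; rewrite rmorphM; exact: qM.
- by rewrite rmorph1.
- by move=> x y; rewrite rmorphM; exact: qp.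
Qed.

Definition Spec_map (R S : comPzRingType) (phi : {rmorphism R -> S})
    (q : Spec S) : Spec R := exist _ _ (comap_prime phi q).

Fact zero_prime (F : fieldType) : prime_ideal [set 0 : F].
Proof.
split=> //=.
- by move=> x y -> ->; rewrite addr0.
- by move=> a x ->; rewrite mulr0.
- by apply/eqP; rewrite oner_eq0.
- by move=> x y /eqP; rewrite mulf_eq0 => /orP[]/eqP; tauto.
Qed.

Definition Spec_pt (F : fieldType) : Spec F := exist _ _ (zero_prime F).

End SpectrumMaps.

Section IdentityComponent.
Variables (F : fieldType) (R : comAlgType F) (eps : {lrmorphism R -> F^o}).

Definition component : set (Spec R) :=
  connected_component setT (Spec_map eps (Spec_pt F)).

Definition in_component (L : comAlgType F) (phi : {lrmorphism R -> L}) : Prop :=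
  forall q : Spec L, component (Spec_map phi q).

(* Spec R0, mapped to Spec R by incl, is the open subscheme of Spec R supported
   on the component: its L-points are the L-points of Spec R whose image lies
   in the component. *)
Record identity_component (R0 : comAlgType F) := IdentityComponent {
  incl : {lrmorphism R -> R0};
  incl_in : forall (L : comAlgType F) (psi : {lrmorphism R0 -> L}),
    in_component (psi \o incl : {lrmorphism R -> L});
  incl_lift : forall (L : comAlgType F) (phi : {lrmorphism R -> L}),
    in_component phi -> exists! psi : {lrmorphism R0 -> L}, psi \o incl =1 phi }.

End IdentityComponent.

HB.mixin Record isTopologicalRing K of Topological K & GRing.PzRing K := {
  topring_add_continuous : continuous (fun x : K * K => x.1 + x.2);
  topring_opp_continuous : continuous (-%R : K -> K);
  topring_mul_continuous : continuous (fun x : K * K => x.1 * x.2) }.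

#[short(type="topComUnitAlgType")]
HB.structure Definition TopComUnitAlgebra (F : pzRingType) :=
  { K of GRing.ComUnitAlgebra F K & Topological K & isTopologicalRing K }.

(* Ring isomorphism with a product of finitely many fields, given by its
   components. *)
Definition finite_product_of_fields (K : pzRingType) : Prop :=
  exists (n : nat) (k : 'I_n -> fieldType) (pr : forall i, {rmorphism K -> k i}),
    forall x : forall i, k i, exists! a : K, forall i, pr i a = x i.

Section PointTopology.
Variables (F : fieldType) (K : topComUnitAlgType F) (R : comAlgType F).

Definition points : Type := {lrmorphism R -> K}.

HB.instance Definition _ := gen_eqMixin points.
HB.instance Definition _ := gen_choiceMixin points.

Local Notation RK := (extalg (algebra_of R) K).

(* The K-algebra map R ⊗ K -> K induced by a point. *)
Definition point_ext (phi : points) (z : RK) : K :=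
  tlift (fun (r : algmod (algebra_of R)) k =>
           (phi : {lrmorphism R -> K}) r * k) z.

(* A closed immersion X_K -> A^n_K, i.e. a surjective K-algebra morphism
   K[X_1, ..., X_n] -> R ⊗ K. *)
Record closed_immersion (n : nat) := ClosedImmersion {
  coord_map : {rmorphism mpoly n K -> RK};
  coord_mapC : forall k, coord_map (mpolyC n k) = @atens F (algebra_of R) K 1 k;
  coord_map_surj : forall z, exists p, coord_map p = z }.

Definition coords (n : nat) (i : closed_immersion n) (phi : points) : 'rV[K]_n :=
  \row_j point_ext phi (coord_map i (mpolyX K (mnm1 j))).

(* The image of X(F) in X(K). *)
Definition rational_points : set points :=
  [set phi | exists psi : {lrmorphism R -> F^o},
     forall r, (phi : {lrmorphism R -> K}) r = (psi r : F)%:A].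

End PointTopology.

Arguments rational_points {F} K R.
Arguments points {F} K R.

(* Main.v *)
(* Let U be the set of isometries g with 1 - g invertible.  The map
   k |-> s_k = 1 - k^-1 identifies U with the invertible elements of the affine
   space of all endomorphisms k such that (x, y) |-> h_f(k x, y) lies in the
   class [f]; this affine space is defined over F, and U has a rational point
   as soon as F is infinite.  (If F is finite it is closed in K, so F -> K is
   onto and every K-point is rational.)  Let V be the union of the translates
   o U, for o a product of an odd number of rational s_k.  It is open in O, and
   it is also the Zariski closure of the group of products of an even number of
   rational s_k: a function vanishing on the rational points of o U vanishes on
   o U, and conversely if g lies in that closure then o - g cannot be singular
   for all odd o, since y s_k - g is invertible at y = g.  Hence O^+ lies in V.
   So a K-point g of O^+ is in some o U over each field factor of K;
   interpolating between words along rational curves, one o serves for all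
   factors and g = o s_k with k defined over K.  Rational approximations k' of k
   give the rational points o s_k', which belong to O^+ because they lie on
   chains of rational curves through the identity. *)

Require Import Defs.
From HB Require Import structures.
From mathcomp Require Import all_boot generic_quotient all_algebra.
From mathcomp Require Import -(notations) mpoly.
From mathcomp Require Import boolp classical_sets cardinality topology.
From mathcomp Require Import ring.

Set Implicit Arguments.
Unset Strict Implicit.
Unset Printing Implicit Defensive.

Import GRing.Theory.
Local Open Scope classical_set_scope.
Local Open Scope ring_scope.

(** * Localization *)

(** Parity is forced by the components of the group. Take [A = F], trivial involution, [u = 1]:
    points of the affine space satisfy [k + k^* = 1], with [k^*] the adjoint for [h_f], so
    [s_k = - k^-1 k^*] has determinant (-1)^n. For odd n and characteristic other than 2 a single
    [s_k] thus lies outside the identity component; an even product can be joined to 1, and [o] is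
    odd in order that [o s_k] be even. The second obstacle is that the component is a set of prime
    ideals, whose residue fields may exceed [F], whereas words are rational. Setting [y = g] is
    therefore not the choice of a rational [y]: the entries of [y] are replaced by those of the
    universal matrix inside a determinant. This is legitimate because the determinant is a sum of
    terms [c_j y(b_j)], and lying in a given prime is an [F]-linear condition on the vector of
    values [y(b_j)]. Hence linear algebra is done once over [F], and only matrix identities are
    transported to [L]. *)

Record mulset (R : comNzRingType) := MulSet {
  mset :> R -> Prop;
  mset1 : mset 1;
  msetM : forall x y, mset x -> mset y -> mset (x * y);
  mset0 : ~ mset 0 }.

Section Localization.
Local Open Scope quotient_scope.
Variables (F : comNzRingType) (R : comAlgType F) (M : mulset R).
Implicit Types (x y z : R * R) (a b s t : R).

(* Fractions are pairs; a second component outside M is read as 1. *)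
Let den x : R := if `[< M x.2 >] then x.2 else 1.

Let denP x : M (den x).
Proof. by rewrite /den; case: asboolP => // _; exact: mset1. Qed.

Let denE a s : M s -> den (a, s) = s.
Proof. by rewrite /den => Ms; case: asboolP. Qed.

Definition loc_rel x y : bool :=
  `[< exists2 m, M m & m * (x.1 * den y) = m * (y.1 * den x) >].

Lemma loc_rel_equiv : equiv_class_of loc_rel.
Proof.
split=> [x|x y|y x z].
- by apply/asboolP; exists 1; first exact: mset1.
- by apply/asboolP/asboolP => -[m Mm e]; exists m.
- move=> /asboolP[m Mm e] /asboolP[n Mn e']; apply/asboolP.
  exists (m * n * den y); first by do 2! [apply: msetM => //].
  have -> : m * n * den y * (x.1 * den z) = n * den z * (m * (x.1 * den y)).
    by ring.
  have -> : m * n * den y * (z.1 * den x) = m * den x * (n * (z.1 * den y)).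
    by ring.
  rewrite e -e'; ring.
Qed.

Canonical loc_equiv := EquivRelPack loc_rel_equiv.

Definition loc : Type := {eq_quot loc_equiv}.

HB.instance Definition _ := Choice.on loc.
HB.instance Definition _ := EqQuotient.on loc.

Lemma loc_piP x y : reflect (exists2 m, M m & m * (x.1 * den y) = m * (y.1 * den x))
  (\pi_loc x == \pi_loc y).
Proof. by rewrite eqmodE; apply: asboolP. Qed.

Definition mkfrac a s : loc := \pi_loc (a, s).

Lemma mkfrac_eq a s b t : M s -> M t ->
  mkfrac a s = mkfrac b t <-> exists2 m, M m & m * (a * t) = m * (b * s).
Proof.
move=> Ms Mt; have := loc_piP (a, s) (b, t); rewrite /= !denE // => h.
by split=> [/eqP/h|/h/eqP].
Qed.

Lemma mkfrac_eqW a s b t : M s -> M t -> a * t = b * s -> mkfrac a s = mkfrac b t.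
Proof.
by move=> Ms Mt e; apply/mkfrac_eq => //; exists 1; rewrite ?e //; exact: mset1.
Qed.

Lemma locP (u : loc) : exists a, exists2 s, M s & u = mkfrac a s.
Proof.
exists (repr u).1, (den (repr u)) => //; rewrite -[LHS]reprK.
apply/eqP/loc_piP; exists 1; first exact: mset1.
by rewrite denE.
Qed.

Definition numer (u : loc) := (repr u).1.
Definition denom (u : loc) := den (repr u).

Lemma denomP u : M (denom u). Proof. exact: denP. Qed.

Lemma fracK u : mkfrac (numer u) (denom u) = u.
Proof.
rewrite -[RHS]reprK; apply/eqP/loc_piP; exists 1; first exact: mset1.
by rewrite denE //; exact: denP.
Qed.

(** The chosen representative of a fraction need not be the pair it was built from; the operations,
    defined on representatives, are computed on arbitrary fractions through this relation. *)
Lemma fracE a s : M s ->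
  exists2 m, M m & m * (numer (mkfrac a s) * s) = m * (a * denom (mkfrac a s)).
Proof. by move=> Ms; apply/mkfrac_eq; rewrite ?fracK //; exact: denomP. Qed.

Definition loc_add u v :=
  mkfrac (numer u * denom v + numer v * denom u) (denom u * denom v).
Definition loc_mul u v := mkfrac (numer u * numer v) (denom u * denom v).
Definition loc_opp u := mkfrac (- numer u) (denom u).
Definition loc_scale (c : F) u := mkfrac (c *: numer u) (denom u).

Let MM := @msetM R M.

Lemma loc_addE a s b t : M s -> M t ->
  loc_add (mkfrac a s) (mkfrac b t) = mkfrac (a * t + b * s) (s * t).
Proof.
move=> Ms Mt; have [m Mm e] := fracE a Ms; have [n Mn e'] := fracE b Mt.
rewrite /loc_add; set a' := numer _ in e *; set s' := denom _ in e *.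
set b' := numer _ in e' *; set t' := denom _ in e' *.
have Ms' : M s' by exact: denomP.
have Mt' : M t' by exact: denomP.
apply/mkfrac_eq; [exact: MM|exact: MM|exists (m * n); first exact: MM].
have -> : m * n * ((a' * t' + b' * s') * (s * t)) =
  n * t' * t * (m * (a' * s)) + m * s' * s * (n * (b' * t)) by ring.
by rewrite e e'; ring.
Qed.

Lemma loc_mulE a s b t : M s -> M t ->
  loc_mul (mkfrac a s) (mkfrac b t) = mkfrac (a * b) (s * t).
Proof.
move=> Ms Mt; have [m Mm e] := fracE a Ms; have [n Mn e'] := fracE b Mt.
rewrite /loc_mul; set a' := numer _ in e *; set s' := denom _ in e *.
set b' := numer _ in e' *; set t' := denom _ in e' *.
have Ms' : M s' by exact: denomP.
have Mt' : M t' by exact: denomP.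
apply/mkfrac_eq; [exact: MM|exact: MM|exists (m * n); first exact: MM].
have -> : m * n * (a' * b' * (s * t)) = m * (a' * s) * (n * (b' * t)) by ring.
by rewrite e e'; ring.
Qed.

Lemma loc_scaleE c a s : M s -> loc_scale c (mkfrac a s) = mkfrac (c *: a) s.
Proof.
move=> Ms; have [m Mm e] := fracE a Ms; apply/mkfrac_eq => //; first exact: denomP.
by exists m => //; rewrite -!scalerAl -!scalerAr e.
Qed.

Lemma loc_oppE a s : M s -> loc_opp (mkfrac a s) = mkfrac (- a) s.
Proof.
move=> Ms; have [m Mm e] := fracE a Ms; apply/mkfrac_eq => //; first exact: denomP.
by exists m => //; rewrite !mulNr !mulrN e.
Qed.

Let M1 := mset1 M.

Ltac locring := rewrite ?(loc_addE, loc_mulE, loc_oppE, loc_scaleE);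
  try by [|do ?[apply: MM => //]];
  apply: mkfrac_eqW; [by do ?[apply: MM => //]..|].

Fact loc_addA : associative loc_add.
Proof.
move=> u v w; have [a [s Ms ->]] := locP u; have [b [t Mt ->]] := locP v.
by have [c [r Mr ->]] := locP w; locring; ring.
Qed.
Fact loc_addC : commutative loc_add.
Proof.
move=> u v; have [a [s Ms ->]] := locP u; have [b [t Mt ->]] := locP v.
by locring; ring.
Qed.
Fact loc_add0 : left_id (mkfrac 0 1) loc_add.
Proof. by move=> u; have [a [s Ms ->]] := locP u; locring; ring. Qed.
Fact loc_addN : left_inverse (mkfrac 0 1) loc_opp loc_add.
Proof. by move=> u; have [a [s Ms ->]] := locP u; locring; ring. Qed.

HB.instance Definition _ :=
  GRing.isZmodule.Build loc loc_addA loc_addC loc_add0 loc_addN.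

Fact loc_mulA : associative loc_mul.
Proof.
move=> u v w; have [a [s Ms ->]] := locP u; have [b [t Mt ->]] := locP v.
by have [c [r Mr ->]] := locP w; locring; ring.
Qed.
Fact loc_mulC : commutative loc_mul.
Proof.
move=> u v; have [a [s Ms ->]] := locP u; have [b [t Mt ->]] := locP v.
by locring; ring.
Qed.
Fact loc_mul1 : left_id (mkfrac 1 1) loc_mul.
Proof. by move=> u; have [a [s Ms ->]] := locP u; locring; ring. Qed.
Fact loc_mulD : left_distributive loc_mul loc_add.
Proof.
move=> u v w; have [a [s Ms ->]] := locP u; have [b [t Mt ->]] := locP v.
by have [c [r Mr ->]] := locP w; locring; ring.
Qed.
(** This is the purpose of the field [mset0]: a [comAlgType] is nontrivial by definition. *)
Fact loc_nz1 : mkfrac 1 1 != mkfrac 0 1.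
Proof.
apply/eqP => /mkfrac_eq[//|//|m Mm]; rewrite !mulr1 mulr0 => m0.
by apply: (@mset0 _ M); rewrite -m0.
Qed.

HB.instance Definition _ :=
  GRing.Zmodule_isComNzRing.Build loc loc_mulA loc_mulC loc_mul1 loc_mulD loc_nz1.

Fact loc_scaleA c d u : loc_scale c (loc_scale d u) = loc_scale (c * d) u.
Proof.
by have [a [s Ms ->]] := locP u; locring; rewrite scalerA.
Qed.
Fact loc_scale1 u : loc_scale 1 u = u.
Proof. by have [a [s Ms ->]] := locP u; locring; rewrite scale1r. Qed.
Fact loc_scaleDr : right_distributive loc_scale +%R.
Proof.
move=> k u v; have [a [s Ms ->]] := locP u; have [b [t Mt ->]] := locP v.
rewrite -[_ + _]/(loc_add _ _) -[RHS]/(loc_add _ _); locring.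
by rewrite scalerDr !scalerAl.
Qed.
Fact loc_scaleDl u : {morph loc_scale^~ u : c d / c + d}.
Proof.
move=> c d; have [a [s Ms ->]] := locP u; rewrite -[RHS]/(loc_add _ _).
by locring; rewrite -mulrDl -scalerDl -!mulrA.
Qed.

HB.instance Definition _ := GRing.Zmodule_isLmodule.Build F loc
  loc_scaleA loc_scale1 loc_scaleDr loc_scaleDl.

Fact loc_scaleAl (c : F) (u v : loc) : c *: (u * v) = (c *: u) * v.
Proof.
have [a [s Ms ->]] := locP u; have [b [t Mt ->]] := locP v.
rewrite -[_ * _ in LHS]/(loc_mul _ _) -[RHS]/(loc_mul (loc_scale _ _) _).
rewrite -[LHS]/(loc_scale _ _).
by locring; rewrite scalerAl.
Qed.

HB.instance Definition _ := GRing.Lmodule_isLalgebra.Build F loc loc_scaleAl.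
HB.instance Definition _ := GRing.Lalgebra_isComAlgebra.Build F loc.

Lemma mkfracD a s b t : M s -> M t ->
  mkfrac a s + mkfrac b t = mkfrac (a * t + b * s) (s * t).
Proof. exact: loc_addE. Qed.
Lemma mkfracM a s b t : M s -> M t ->
  mkfrac a s * mkfrac b t = mkfrac (a * b) (s * t).
Proof. exact: loc_mulE. Qed.
Lemma mkfracZ (c : F) a s : M s -> c *: mkfrac a s = mkfrac (c *: a) s.
Proof. exact: loc_scaleE. Qed.
Lemma mkfrac0 s : M s -> mkfrac 0 s = 0.
Proof. by move=> Ms; apply: mkfrac_eqW => //; rewrite !mul0r. Qed.

Lemma mkfrac_eq0 a s : M s -> mkfrac a s = 0 -> exists2 m, M m & m * a = 0.
Proof.
move=> Ms /mkfrac_eq[//|//|m Mm]; rewrite mulr1 mul0r mulr0 => e.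
by exists m.
Qed.

Definition to_loc a : loc := mkfrac a 1.

Fact to_loc_zmod : zmod_morphism to_loc.
Proof.
move=> a b; rewrite -[LHS](addrK (to_loc b)); congr (_ - _).
by rewrite mkfracD // !mulr1 subrK.
Qed.
Fact to_loc_monoid : monoid_morphism to_loc.
Proof. by split=> // a b; rewrite mkfracM // mulr1. Qed.
Fact to_loc_scalable : scalable to_loc.
Proof. by move=> c a; rewrite mkfracZ. Qed.

HB.instance Definition _ := GRing.isZmodMorphism.Build R loc to_loc to_loc_zmod.
HB.instance Definition _ :=
  GRing.isMonoidMorphism.Build R loc to_loc to_loc_monoid.
HB.instance Definition _ := GRing.isScalable.Build F R loc *:%R to_loc to_loc_scalable.

Lemma to_locV s : M s -> to_loc s * mkfrac 1 s = 1.
Proof.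
by move=> Ms; rewrite mkfracM // mulr1 mul1r; apply: mkfrac_eqW; rewrite // mulrC.
Qed.

Lemma mkfracE a s : M s -> mkfrac a s = to_loc a * mkfrac 1 s.
Proof. by move=> Ms; rewrite mkfracM // mulr1 mul1r. Qed.

Section Lift.
Variables (L : comAlgType F) (h : {lrmorphism R -> L}) (inv : R -> L).
Hypothesis hV : forall s, M s -> h s * inv s = 1.

(** [L] carries no inverse operation, so inverses of the images of [M] are supplied by a function
    [inv], constrained on [M] only. *)
Definition loc_lift (u : loc) : L := h (numer u) * inv (denom u).

Lemma loc_liftE a s : M s -> loc_lift (mkfrac a s) = h a * inv s.
Proof.
move=> Ms; have [m Mm] := fracE a Ms; rewrite /loc_lift.
set b := numer _; set t := denom _; have Mt : M t by exact: denomP.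
move=> /(congr1 (fun x : R => inv m * inv s * inv t * h x)); rewrite !rmorphM.
have -> : inv m * inv s * inv t * (h m * (h b * h s)) =
  h b * inv t * (h m * inv m) * (h s * inv s) by ring.
have -> : inv m * inv s * inv t * (h m * (h a * h t)) =
  h a * inv s * (h m * inv m) * (h t * inv t) by ring.
by rewrite !hV // !mulr1.
Qed.

Let invM s t : M s -> M t -> inv (s * t) = inv s * inv t.
Proof.
move=> Ms Mt; rewrite -[LHS]mul1r -(mulr1 1) -{1}(hV Ms) -(hV Mt).
have -> : h s * inv s * (h t * inv t) * inv (s * t) =
  inv s * inv t * (h (s * t) * inv (s * t)) by rewrite rmorphM; ring.
by rewrite hV ?mulr1 //; exact: msetM.
Qed.

Fact loc_lift_zmod : zmod_morphism loc_lift.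
Proof.
move=> u v; rewrite -[LHS](addrK (loc_lift v)); congr (_ - _).
have {2}-> : u = (u - v) + v by rewrite subrK.
have [a [s Ms ->]] := locP (u - v); have [b [t Mt ->]] := locP v.
rewrite mkfracD // !loc_liftE ?invM //; last exact: msetM.
rewrite rmorphD !rmorphM.
have -> : (h a * h t + h b * h s) * (inv s * inv t) =
   h a * inv s * (h t * inv t) + h b * inv t * (h s * inv s) by ring.
by rewrite !hV // !mulr1.
Qed.
Fact loc_lift_monoid : monoid_morphism loc_lift.
Proof.
split=> [|u v]; first by rewrite loc_liftE // rmorph1 -[RHS](hV M1) rmorph1.
have [a [s Ms ->]] := locP u; have [b [t Mt ->]] := locP v.
rewrite mkfracM // !loc_liftE ?invM //; last exact: msetM.
by rewrite rmorphM; ring.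
Qed.
Fact loc_lift_scalable : scalable loc_lift.
Proof.
move=> c u; have [a [s Ms ->]] := locP u; rewrite mkfracZ // !loc_liftE //.
by rewrite linearZ -scalerAl.
Qed.

HB.instance Definition _ :=
  GRing.isZmodMorphism.Build loc L loc_lift loc_lift_zmod.
HB.instance Definition _ :=
  GRing.isMonoidMorphism.Build loc L loc_lift loc_lift_monoid.
HB.instance Definition _ :=
  GRing.isScalable.Build F loc L *:%R loc_lift loc_lift_scalable.

Definition loc_liftr : {lrmorphism loc -> L} := loc_lift.

End Lift.

End Localization.

(** * Polynomials over infinite fields *)

Definition inexhaustible (T : eqType) : Prop := forall s : seq T, exists x, x \notin s.

(** The polynomials live over different extensions of [F], but each has finitely many roots coming
    from [F], so a single [t] avoids them all. *)
Lemma avoid_roots (F : fieldType) (n : nat) (k : 'I_n -> fieldType)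
    (h : forall i, {rmorphism F -> k i}) (Q : forall i, {poly k i}) (s : seq F) :
  inexhaustible F -> (forall i, Q i != 0) ->
  exists2 t, t \notin s & forall i, (Q i).[h i t] != 0.
Proof.
move=> inf Q0.
suff [r hr]: exists r : seq F, forall i t, root (Q i) (h i t) -> t \in r.
  have [t] := inf (s ++ r); rewrite mem_cat negb_or => /andP[ts tr].
  by exists t => // i; apply: contraNneq tr => /rootP/hr.
have roots i : exists r : seq F, forall t, root (Q i) (h i t) -> t \in r.
  apply: contrapT => hn.
  (* If no finite list held these roots, distinct ones could be collected beyond the degree
     bound. *)
  have all m : exists2 r : seq F, uniq r & all (fun t => root (Q i) (h i t)) r /\ size r = m.
    elim: m => [|m [r ur [ar sr]]]; first by exists [::].
    have [t /not_implyP[rt /negP tr]] : exists t, ~ (root (Q i) (h i t) -> t \in r).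
      by apply/existsNP => hr; apply: hn; exists r.
    by exists (t :: r); rewrite /= ?tr ?rt ?ar ?sr.
  have [r ur [ar sr]] := all (size (Q i)).
  have := @max_poly_roots _ (Q i) (map (h i) r) (Q0 i).
  rewrite size_map sr ltnn map_inj_uniq ?ur; last exact: fmorph_inj.
  by rewrite all_map => /(_ ar isT).
have /choice [r hr] := roots.
exists (flatten [seq r i | i <- enum 'I_n]) => i t /hr tr.
by apply/flattenP; exists (r i) => //; apply: map_f; rewrite mem_enum.
Qed.

Lemma poly_eq0_horner (F : fieldType) (Q : {poly F}) :
  inexhaustible F -> (forall t, Q.[t] = 0) -> Q = 0.
Proof.
move=> inf Qt; apply/eqP/negP => /negP Q0.
have [t _ /(_ ord0)] := @avoid_roots F 1 (fun=> F) (fun=> idfun) (fun=> Q) [::] inf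
  (fun=> Q0).
by rewrite Qt eqxx.
Qed.

(** Induction on the number of variables: [p] is read as a polynomial in the first n variables, with
    coefficients [Q m0] that are polynomials in the last one. *)
Lemma mpoly_eq0_meval (F : fieldType) n (p : mpoly n F) : inexhaustible F ->
  (forall v : 'I_n -> F, meval v p = 0) -> p = 0.
Proof.
move=> inf; elim: n p => [|n IH] p pv.
  apply/mpolyP => m; rewrite mcoeff0; have := pv (fun=> 0); rewrite mevalE.
  under eq_bigr => m' _ do rewrite big_ord0 mulr1.
  have sing (m' : multinom 0) : m' = m by apply/mnmP => -[].
  apply: contraPeq; rewrite -mcoeff_msupp => mp; apply/eqP.
  rewrite (bigD1_seq m) ?msupp_uniq //= big1 ?addr0 -?mcoeff_msupp // => m'.
  by rewrite (sing m') eqxx.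
pose low (m : multinom n.+1) : multinom n :=
  Multinom [tuple m (widen_ord (leqnSn n) i) | i < n].
have lowE m i : low m i = m (widen_ord (leqnSn n) i) by rewrite mnmE.
pose Q m0 : {poly F} :=
  \sum_(m <- msupp p | low m == m0) mcoeff m p *: 'X^(m ord_max).
have Q0 m0 : Q m0 = 0.
  apply: poly_eq0_horner => // t; rewrite /Q horner_sum.
  (* [Pt] is [p] with the last variable set to [t]; its coefficient at [m0] is the value of [Q m0]
     at [t]. *)
  pose Pt : mpoly n F :=
    \sum_(m <- msupp p) (mcoeff m p * t ^+ m ord_max) *: mpolyX F (low m).
  have : Pt = 0.
    apply: IH => v; rewrite /Pt (big_morph (meval v) (mevalD v) (meval0 v)).
    (* [insub] fails only at the last index, where the default [t] is taken. *)
    pose w (i : 'I_n.+1) := oapp v t (insub (i : nat)).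
    rewrite -[RHS](pv w) [in RHS]mevalE; apply: eq_bigr => m _.
    rewrite mevalZ mevalX big_ord_recr /= -mulrA; congr (_ * _).
    rewrite mulrC; congr (_ * _ ^+ _); last by rewrite /w insubN //= ltnn.
    apply: eq_bigr => i _; rewrite lowE; congr (_ ^+ _).
    rewrite /w (insubT (fun j => (j < n)%N) (ltn_ord i)) /=.
    by congr v; apply: val_inj.
  move/(congr1 (mcoeff m0)); rewrite mcoeff0 raddf_sum /= => e; rewrite -[RHS]e.
  rewrite big_mkcond /=; apply: eq_bigr => m _.
  rewrite mcoeffZ mcoeffX; case: eqP => _; last by rewrite mulr0.
  by rewrite mulr1 hornerZ hornerXn.
apply/mpolyP => m; rewrite mcoeff0; apply/eqP; apply: contraT => pm.
have /(congr1 (fun q : {poly F} => q`_(m ord_max))) := Q0 (low m).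
rewrite coef0 coef_sum big_mkcond (bigD1_seq m) ?msupp_uniq ?mcoeff_msupp //=.
rewrite eqxx coefZ coefXn eqxx mulr1 big1 ?addr0 => [pm0|m' m'm].
  by rewrite pm0 eqxx in pm.
case: eqP => // e; rewrite coefZ coefXn; case: eqP => [e'|]; last by rewrite mulr0.
case/eqP: m'm; apply/mnmP => i; case: (unliftP ord_max i) => [j ->|->] //.
have -> : lift ord_max j = widen_ord (leqnSn n) j.
  by apply: val_inj; rewrite /= /bump leqNgt ltn_ord.
by rewrite -!lowE e.
Qed.
(** * The Cayley transform for quadratic spaces *)

(* Decides identities in an abelian group: every atom is moved to the right end
   of the sum and cancelled against its opposite. *)
Ltac zmod_cancel :=
  apply/eqP; rewrite -subr_eq0 ?opprD ?opprK ?oppr0; apply/eqP;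
  rewrite -[LHS]add0r !addrA ?addr0;
  repeat match goal with
  | |- _ + (- ?t) = 0 => do 12 try (rewrite [_ + t + _]addrAC); rewrite subrK
  | |- _ + ?t = 0 => do 12 try (rewrite [_ + (- t) + _]addrAC);
      rewrite ?addrK ?subrK
  end; try reflexivity.

Section QuadraticCayley.
Variables (A : pzRingType) (U : unitary_ring A) (P : lmodType A^c).
Variable f : {linear P -> dual U P}.
Implicit Types (x y z : P) (g k : P -> P).

Lemma ftilde_Dl x x' y : ftilde f (x + x') y = ftilde f x y + ftilde f x' y.
Proof. by rewrite /ftilde linearD. Qed.
Lemma ftilde_Dr x y y' : ftilde f x (y + y') = ftilde f x y + ftilde f x y'.
Proof. exact: dappD. Qed.
Lemma ftilde_Zl (a : A) x y :
  ftilde f ((a : A^c) *: x) y = a^σ[U] * ftilde f x y.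
Proof. by rewrite /ftilde linearZZ. Qed.
Lemma ftilde_Zr (a : A) x y : ftilde f x ((a : A^c) *: y) = ftilde f x y * a.
Proof. exact: dappZ. Qed.
Lemma ftilde_Nl x y : ftilde f (- x) y = - ftilde f x y.
Proof. by rewrite /ftilde linearN. Qed.
Lemma ftilde_Nr x y : ftilde f x (- y) = - ftilde f x y.
Proof. exact: (linearN (f x : {linear P -> A^c^o})). Qed.

Lemma sigmaN (a : A) : (- a)^σ[U] = - a^σ[U].
Proof. by apply: (addrI (a^σ[U])); rewrite -sigmaD !subrr sigma0. Qed.

Definition hherm x y : A := ftilde f x y + (ftilde f y x)^σ[U] * uelt U.

Lemma hhermE x y : hherm x y = dapp (hform f x) y.
Proof. by []. Qed.

Lemma hherm_Dl x x' y : hherm (x + x') y = hherm x y + hherm x' y.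
Proof. by rewrite /hherm ftilde_Dl ftilde_Dr sigmaD mulrDl addrACA. Qed.
Lemma hherm_Dr x y y' : hherm x (y + y') = hherm x y + hherm x y'.
Proof. by rewrite /hherm ftilde_Dl ftilde_Dr sigmaD mulrDl addrACA. Qed.
Lemma hherm_Nl x y : hherm (- x) y = - hherm x y.
Proof. by rewrite /hherm ftilde_Nl ftilde_Nr sigmaN mulNr opprD. Qed.
Lemma hherm_Nr x y : hherm x (- y) = - hherm x y.
Proof. by rewrite /hherm ftilde_Nl ftilde_Nr sigmaN mulNr opprD. Qed.
Lemma hherm_Zl (a : A) x y : hherm ((a : A^c) *: x) y = a^σ[U] * hherm x y.
Proof.
by rewrite /hherm ftilde_Zl ftilde_Zr sigmaM mulrDr mulrA.
Qed.
Lemma hherm_Zr (a : A) x y : hherm x ((a : A^c) *: y) = hherm x y * a.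
Proof.
rewrite /hherm ftilde_Zl ftilde_Zr sigmaM sigmaK mulrDl.
by rewrite -!mulrA (ueltC U a).
Qed.

Lemma sigma_ueltK (a : A) : (a^σ[U] * uelt U)^σ[U] * uelt U = a.
Proof. by rewrite sigmaM sigmaK -mulrA -ueltC mulrA ueltU mul1r. Qed.

Lemma hherm_sym x y : (hherm y x)^σ[U] * uelt U = hherm x y.
Proof. by rewrite /hherm sigmaD mulrDl sigma_ueltK addrC. Qed.

Lemma Lambda_add a b : Lambda U a -> Lambda U b -> Lambda U (a + b).
Proof.
by move=> la lb; rewrite -[b]opprK -[- b]sub0r; do 2!apply: LambdaB => //;
  exact: Lambda0.
Qed.

(** Preservation of the class [f], split as in [qclassP] into the hermitian form and the values
    modulo Lambda; [g] is a bare function, so linearity and bijectivity can be treated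
    separately. *)
Definition is_isom g : Prop :=
  (forall x y, hherm (g x) (g y) = hherm x y) /\
  (forall x, Lambda U (ftilde f (g x) (g x) - ftilde f x x)).

(* The form (x, y) |-> h_f(k x, y) belongs to the class [f]. *)
Definition in_class k : Prop :=
  (forall x y, hherm (k x) y + hherm x (k y) = hherm x y) /\
  (forall x, Lambda U (hherm (k x) x - ftilde f x x)).

Lemma is_isom_comp g g' : is_isom g -> is_isom g' -> is_isom (g \o g').
Proof.
move=> [h l] [h' l']; split=> [x y|x] /=; first by rewrite h h'.
by rewrite -[X in X - _](subrK (ftilde f (g' x) (g' x))) -addrA; exact: Lambda_add.
Qed.

Lemma is_isom_inv g g' : cancel g' g -> is_isom g -> is_isom g'.
Proof.
move=> gK [h l]; split=> [x y|x]; first by rewrite -h !gK.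
rewrite -opprB -sub0r; apply: LambdaB; first exact: Lambda0.
by have := l (g' x); rewrite gK.
Qed.

(** Expanding, h(kx - x, ky - y) = h(kx, ky) - (h(kx, y) + h(x, ky) - h(x, y)), and the bracket
    vanishes for [k] in the class. *)
Lemma Cayley_isom (k g : P -> P) (kV : P -> P) :
  cancel kV k -> (forall x, g (k x) = k x - x) -> in_class k -> is_isom g.
Proof.
move=> kK gk [h l]; split=> [x y|x].
  rewrite -(kK x) -(kK y); set z := kV x; set w := kV y; rewrite !gk.
  rewrite !(hherm_Dl, hherm_Dr, hherm_Nl, hherm_Nr) -[hherm z w]h.
  by zmod_cancel.
rewrite -(kK x); set z := kV x; rewrite gk.
rewrite !(ftilde_Dl, ftilde_Dr, ftilde_Nl, ftilde_Nr).
set a := ftilde f (k z) (k z); set b := ftilde f (k z) z.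
set c := ftilde f z (k z); set d := ftilde f z z.
have := l z; rewrite /hherm -/b -/c -/d => lz.
(* The difference to be placed in Lambda is [d - b - c], which is minus the element of [lz] minus
   [c - c^σ u]. *)
have := LambdaB (LambdaB (Lambda0 U) lz) (Lambda_min U c).
by congr (Lambda U _); zmod_cancel.
Qed.

Lemma isom_Cayley (k g : P -> P) :
  (forall x, k x - g (k x) = x) -> is_isom g -> in_class k.
Proof.
move=> gk [h l]; split=> [x y|x].
  rewrite -{2 3}(gk x) -{1 3}(gk y); set z := k x; set w := k y.
  rewrite !(hherm_Dl, hherm_Dr, hherm_Nl, hherm_Nr) h.
  by zmod_cancel.
rewrite -{2 3 4}(gk x); set z := k x.
rewrite !(ftilde_Dl, ftilde_Dr, ftilde_Nl, ftilde_Nr) hherm_Dr hherm_Nr /hherm.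
have := LambdaB (LambdaB (Lambda_min U (ftilde f (g z) z)) (Lambda_min U (ftilde f z z)))
   (l z).
by congr (Lambda U _); zmod_cancel.
Qed.

(** The diagonal condition is quadratic in its argument, but the hermitian condition puts the cross
    terms in the minimal form parameter. With [in_class_scale], this reduces the condition to
    generators. *)
Lemma in_class_add k z w : (forall x y, k (x + y) = k x + k y) ->
  (forall x y, hherm (k x) y + hherm x (k y) = hherm x y) ->
  Lambda U (hherm (k z) z - ftilde f z z) ->
  Lambda U (hherm (k w) w - ftilde f w w) ->
  Lambda U (hherm (k (z + w)) (z + w) - ftilde f (z + w) (z + w)).
Proof.
move=> kD h lz lw; rewrite kD !(hherm_Dl, hherm_Dr, ftilde_Dl, ftilde_Dr).
have -> : hherm (k w) z = hherm w z - (hherm (k z) w)^σ[U] * uelt U.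
  by rewrite hherm_sym -(h w z) addrK.
have := Lambda_add (Lambda_add lz lw)
  (LambdaB (Lambda_min U (hherm (k z) w)) (Lambda_min U (ftilde f z w))).
by rewrite {7}/hherm; congr (Lambda U _); zmod_cancel.
Qed.

Lemma in_class_scale (k : P -> P) (a : A) z :
  (forall x, k ((a : A^c) *: x) = (a : A^c) *: k x) ->
  Lambda U (hherm (k z) z - ftilde f z z) ->
  Lambda U (hherm (k ((a : A^c) *: z)) ((a : A^c) *: z) -
            ftilde f ((a : A^c) *: z) ((a : A^c) *: z)).
Proof.
move=> kZ /(Lambda_conj a); rewrite kZ !(hherm_Zl, hherm_Zr, ftilde_Zl, ftilde_Zr).
by rewrite mulrBr mulrBl !mulrA.
Qed.

Lemma LambdaPE (l : {linear P -> dual U P}) : LambdaP l <->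
  (forall x y, ftilde l x y + (ftilde l y x)^σ[U] * uelt U = 0) /\
  (forall x, Lambda U (ftilde l x x)).
Proof.
split=> -[h h']; split=> //.
  move=> x y;  rewrite {1}/ftilde h; exact: addNr.
move=> x; apply: dual_ext => y; apply/eqP; rewrite -addr_eq0; apply/eqP; exact: h.
Qed.

Lemma qclassP (l l' : {linear P -> dual U P}) : qclass l = qclass l' <->
  (forall x y, ftilde l x y + (ftilde l y x)^σ[U] * uelt U =
               ftilde l' x y + (ftilde l' y x)^σ[U] * uelt U) /\
  (forall x, Lambda U (ftilde l x x - ftilde l' x x)).
Proof.
have ftE (a b : {linear P -> dual U P}) x y (c := a \- b : {linear P -> dual U P}) :
    ftilde c x y = ftilde a x y - ftilde b x y by [].
have ftE' (a b : {linear P -> dual U P}) x y (c := a \+ b : {linear P -> dual U P}) :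
    ftilde c x y = ftilde a x y + ftilde b x y by [].
split=> [e|[h h']].
  have : qclass l' l.
    rewrite -e; exists (\0 : {linear P -> dual U P}) => [|x]; last by rewrite addr0.
    apply/LambdaPE; split=> [x y|x]; last exact: Lambda0.
    by rewrite {2}/ftilde /dapp /= sigma0 mul0r addr0.
  move=> [m /LambdaPE[h h'] lE].
  have mE x y : ftilde l x y = ftilde l' x y + ftilde m x y.
    by rewrite /ftilde lE.
  split=> [x y|x]; rewrite !mE; last by rewrite addrC addKr.
  by rewrite sigmaD mulrDl addrACA h addr0.
have main (a b : {linear P -> dual U P}) :
  (forall x y, ftilde a x y + (ftilde a y x)^σ[U] * uelt U =
               ftilde b x y + (ftilde b y x)^σ[U] * uelt U) ->
  (forall x, Lambda U (ftilde a x x - ftilde b x x)) -> qclass a `<=` qclass b.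
  move=> ha ha' c [m /LambdaPE[hm hm'] cE].
  exists ((a \- b) \+ m : {linear P -> dual U P}); last first.
    by move=> x; rewrite cE /=; zmod_cancel.
  apply/LambdaPE; split=> [x y|x]; rewrite !ftE' !ftE; last exact: Lambda_add.
  rewrite !sigmaD sigmaN !mulrDl mulNr addrACA hm addr0.
  by rewrite addrACA ha -opprD subrr.
apply/seteqP; split; apply: main => // x.
by rewrite -opprB -sub0r; apply: LambdaB => //; exact: Lambda0.
Qed.

Lemma qclass_is_isom (g : {linear P -> P}) :
  qclass (pullback g f) = qclass f <-> is_isom g.
Proof. exact: qclassP. Qed.

End QuadraticCayley.
(** * Coordinates and scalar extension *)

Section Coordinates.
Variable F : fieldType.

Record coordinates (M : lmodType F) := Coordinates {
  rk : nat;
  crd : {linear M -> 'rV[F]_rk};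
  uncrd : {linear 'rV[F]_rk -> M};
  crdK : cancel crd uncrd;
  uncrdK : cancel uncrd crd }.

(** Over a field [M] is the row space of the idempotent matrix [B] of [i \o p]; a row basis [rb] of
    [B] gives coordinates, computed with [pinvmx rb]. *)
Lemma fg_projective_coordinates (M : lmodType F) :
  fg_projective M -> inhabited (coordinates M).
Proof.
move=> [n [i [p ip]]]; pose B := lin1_mx (i \o p); pose rb := row_base B.
have BE v : v *m B = i (p v) by rewrite mul_rV_lin1.
have iB x : i x *m B = i x by rewrite BE ip.
have rbB : rb *m B = rb.
  have /submxP[D ->] : (rb <= B)%MS by rewrite eq_row_base.
  by rewrite -mulmxA; congr (_ *m _); apply/row_matrixP => j; rewrite row_mul rowE !BE ip.
have ix x : (i x <= rb)%MS by rewrite eq_row_base; apply/submxP; exists (i x).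
pose c (x : M) : 'rV_(\rank B) := i x *m pinvmx rb.
pose u (v : 'rV_(\rank B)) : M := p (v *m rb).
have cl : linear c by move=> a x y; rewrite /c linearP mulmxDl scalemxAl.
have ul : linear u by move=> a x y; rewrite /u mulmxDl -scalemxAl linearP.
apply: inhabits; apply: (@Coordinates M _ (mklinear cl) (mklinear ul)) => x /=.
  by rewrite /u /c mulmxKpV.
apply: (row_free_inj (row_base_free B)); rewrite /u /c mulmxKpV //.
by rewrite -BE -mulmxA rbB.
Qed.

End Coordinates.

Section TensorCoordinates.
Variables (F : fieldType) (M : lmodType F) (c : coordinates M) (L : comAlgType F).
Local Notation d := (rk c).

Definition bas (j : 'I_d) : M := uncrd c (delta_mx 0 j).

Lemma crd_sum x : x = \sum_j crd c x 0 j *: bas j.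
Proof.
rewrite -[LHS](crdK c) {1}(row_sum_delta (crd c x)) linear_sum.
by apply: eq_bigr => j _; rewrite linearZ.
Qed.

Let tb (x : M) (k : L) : 'rV[L]_d := k *: map_mx (in_alg L) (crd c x).

Let tb_bal : balanced tb.
Proof.
split=> [x x' k|x k k'|a x k]; rewrite /tb.
- by rewrite linearD map_mxD scalerDr.
- by rewrite scalerDl.
- by rewrite linearZ; apply/rowP => j; rewrite !mxE -!scalerAr !mulr1 scalerA mulrC.
Qed.

(** [M ⊗ L] is free on the [bas j ⊗ 1]: for every [L], linear maps become matrices of one and the
    same size. *)
Definition tcrd (z : tensor M L) : 'rV[L]_d := tlift tb z.
Definition tuncrd (v : 'rV[L]_d) : tensor M L := \sum_j tens (bas j) (v 0 j).

Lemma tcrd_tens x k : tcrd (tens x k) = k *: map_mx (in_alg L) (crd c x).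
Proof. exact: tlift_tens. Qed.
Lemma tcrdD : {morph tcrd : z w / z + w}.
Proof. by move=> z w; exact: tliftD. Qed.
Lemma tcrd0 : tcrd 0 = 0.
Proof. exact: tlift0. Qed.
Lemma tcrdN : {morph tcrd : z / - z}.
Proof. by move=> z; apply: (addrI (tcrd z)); rewrite -tcrdD !subrr tcrd0. Qed.
Lemma tcrd_sum (I : Type) (r : seq I) (G : I -> tensor M L) :
  tcrd (\sum_(i <- r) G i) = \sum_(i <- r) tcrd (G i).
Proof. exact: (big_morph tcrd tcrdD tcrd0). Qed.

Lemma tcrdK : cancel tcrd tuncrd.
Proof.
have tens0l y : @tens F M L 0 y = 0 by exact: (balanced0l _ (tens_balanced M L)).
have tens0r x : @tens F M L x 0 = 0 by exact: (balanced0r _ (tens_balanced M L)).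
elim/tensor_ind=> [|t u ht hu|x k].
- by rewrite tcrd0 /tuncrd big1 // => j _; rewrite mxE tens0r.
- rewrite tcrdD -[in RHS]ht -[in RHS]hu /tuncrd -big_split; apply: eq_bigr => j _.
  by rewrite mxE tensDr.
rewrite tcrd_tens {2}(crd_sum x) /tuncrd.
rewrite (big_morph (fun y => tens y k) (fun y y' => tensDl y y' k) (tens0l k)).
by apply: eq_bigr => j _; rewrite tensZ !mxE -scalerAr mulr1.
Qed.

Lemma tuncrdK : cancel tuncrd tcrd.
Proof.
move=> v; rewrite /tuncrd tcrd_sum; apply/rowP => j; rewrite summxE (bigD1 j) //=.
rewrite big1 ?addr0 => [|i ij]; rewrite tcrd_tens /bas uncrdK !mxE.
  by rewrite !eqxx /= scale1r mulr1.
by rewrite [j == i]eq_sym (negPf ij) andbF /= scale0r mulr0.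
Qed.

Lemma tcrd_inj : injective tcrd. Proof. exact: can_inj tcrdK. Qed.

End TensorCoordinates.
Arguments bas {F M} c j.

Arguments tuncrd {F M} c {L} v.

Arguments uncrdK {F M} c _.

(** [P] is a summand of [A^n] and [A] a summand of [F^m], so [P] is a summand of [F^(n m)]. *)
Lemma resmod_fg_projective (F : comNzRingType) (A : algebra F) (P : lmodType A^c) :
  fg_projective (algmod A) -> fg_projective P -> fg_projective (resmod P).
Proof.
move=> [m [i [p ip]]] [n [j [q jq]]].
pose c (x : resmod P) : 'rV[F]_(n * m) := mxvec (\matrix_(a, b) i (j x 0 a) 0 b).
pose u (v : 'rV[F]_(n * m)) : resmod P := q (\row_a (p (row a (vec_mx v)) : A^c)).
have jZ (e : F) (x : resmod P) a : j (e *: x) 0 a = e *: (j x 0 a : algmod A).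
  have -> : j (e *: x) = (alg_map A e : A^c) *: j x by rewrite -linearZ.
  by rewrite mxE; exact: esym (alg_mapC _ _).
have cl : linear c.
  move=> e x y; rewrite /c -linearP; congr mxvec; apply/matrixP => a b.
  by rewrite !mxE linearD mxE jZ linearP !mxE.
have ul : linear u.
  move=> e v w; rewrite /u resmodZ -linearP.
  congr (q _); apply/rowP => a; rewrite !mxE !linearP /=; congr (_ + _).
  exact: alg_mapC.
exists (n * m)%N, (mklinear cl), (mklinear ul) => x /=.
rewrite /u /c mxvecK -[RHS]jq; congr (q _); apply/rowP => a; rewrite mxE -[RHS]ip.
by congr (p _); apply/rowP => b; rewrite !mxE.
Qed.

Section CoordinatesMap.
Variables (F : fieldType) (M N : lmodType F) (c : coordinates M) (c' : coordinates N).

Lemma crd_map (g : {linear M -> N}) x :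
  crd c' (g x) = crd c x *m (\matrix_i crd c' (g (bas c i))).
Proof.
rewrite {1}(crd_sum c x) !linear_sum mulmx_sum_row; apply: eq_bigr => i _.
by rewrite !linearZ rowK.
Qed.

End CoordinatesMap.

Section FormModel.
Variables (F : fieldType) (A : algebra F) (U : unitary_algebra A).
Variables (P : lmodType A^c) (f : {linear P -> dual U P}).
Variables (cP : coordinates (resmod P)) (cA : coordinates (algmod A)).
Local Notation d := (rk cP).
Local Notation e := (bas cP).

(** Vectors are rows, so the right action of [a] on [P] is right multiplication by [rho a]. *)
Definition rho (a : A) : 'M[F]_d := \matrix_i crd cP ((a : A^c) *: (e i : P)).

Fact act_linear (a : A) :
  linear (fun x : resmod P => ((a : A^c) *: (x : P)) : resmod P).
Proof.
move=> c x y; rewrite resmodZ scalerDr resmodZ !scalerA.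
by rewrite (_ : (a : A^c) * alg_map A c = (alg_map A c : A^c) * a) //; exact: alg_mapC.
Qed.

Lemma crdZ (a : A) (x : P) : crd cP ((a : A^c) *: x) = crd cP x *m rho a.
Proof. exact: (crd_map cP cP (mklinear (act_linear a)) x). Qed.

Fact rho_linear : linear (rho : algmod A -> 'M[F]_d).
Proof.
move=> c a b; apply/row_matrixP => i; rewrite linearP /= !rowK -linearP.
congr (crd cP _); rewrite resmodZ scalerA -[RHS]scalerDl.
by congr ((_ + b : A^c) *: (e i : P)); exact: alg_mapC.
Qed.

Section Points.
Variable L : comAlgType F.
Local Notation AL := (extalg A L).
Local Notation PL := (extmod P L).
Local Notation fL := (ext_form L f).
Local Notation "M %:L" := (map_mx (in_alg L) M) (at level 2, format "M %:L").

Definition pcrd (z : PL) : 'rV[L]_d := tcrd cP z.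
Definition puncrd (v : 'rV[L]_d) : PL := tuncrd cP v.
Definition acrd (z : AL) : 'rV[L]_(rk cA) := tcrd cA z.

Lemma pcrd_tens x k : pcrd (ptens x k) = k *: (crd cP x)%:L.
Proof. exact: tcrd_tens. Qed.
Lemma pcrdD : {morph pcrd : z w / z + w}. Proof. exact: tcrdD. Qed.
Lemma pcrd0 : pcrd 0 = 0. Proof. exact: tcrd0. Qed.
Lemma pcrdK : cancel pcrd puncrd. Proof. exact: tcrdK. Qed.
Lemma puncrdK : cancel puncrd pcrd. Proof. exact: tuncrdK. Qed.

Lemma acrd_tens a k : acrd (atens a k) = k *: (crd cA a)%:L.
Proof. exact: tcrd_tens. Qed.
Lemma acrdD : {morph acrd : z w / z + w}. Proof. exact: tcrdD. Qed.
Lemma acrd0 : acrd 0 = 0. Proof. exact: tcrd0. Qed.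
Lemma acrd_inj : injective acrd. Proof. exact: tcrd_inj. Qed.

Lemma pcrdZ a l (z : PL) :
  pcrd ((atens a l : AL^c) *: z) = l *: (pcrd z *m (rho a)%:L).
Proof.
elim/extmod_ind: z => [|t v ht hv|x k].
- by rewrite scaler0 pcrd0 mul0mx scaler0.
- by rewrite scalerDr !pcrdD ht hv mulmxDl scalerDr.
by rewrite ptensM !pcrd_tens crdZ map_mxM -scalemxAl scalerA mulrC.
Qed.

Lemma rho1 : rho 1 = 1%:M.
Proof.
apply/row_matrixP => i; rewrite rowK scale1r /e uncrdK row1 //.
Qed.

Lemma pcrdZ1 l (z : PL) : pcrd ((atens 1 l : AL^c) *: z) = l *: pcrd z.
Proof. by rewrite pcrdZ rho1 map_mx1 mulmx1. Qed.

Definition gen i : PL := ptens (e i) 1.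

Lemma pcrd_gen i : pcrd (gen i) = delta_mx 0 i.
Proof. by rewrite pcrd_tens scale1r uncrdK map_delta_mx. Qed.

Lemma gen_sum (z : PL) : z = \sum_i (atens 1 (pcrd z 0 i) : AL^c) *: gen i.
Proof.
rewrite -[LHS]pcrdK; apply: eq_bigr => i _.
by rewrite /gen ptensM scale1r mul1r.
Qed.

Definition mxmap (k : 'M[L]_d) (z : PL) : PL := puncrd (pcrd z *m k).

Lemma pcrd_mxmap k z : pcrd (mxmap k z) = pcrd z *m k.
Proof. exact: puncrdK. Qed.

Lemma mxmap_comp k k' z : mxmap k (mxmap k' z) = mxmap (k' *m k) z.
Proof. by rewrite /mxmap puncrdK mulmxA. Qed.

Lemma mxmap1 z : mxmap 1%:M z = z.
Proof. by rewrite /mxmap mulmx1 pcrdK. Qed.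

Definition mxof (g : PL -> PL) : 'M[L]_d := \matrix_i pcrd (g (gen i)).

Lemma mxofE (g : {linear PL -> PL}) z : pcrd (g z) = pcrd z *m mxof g.
Proof.
rewrite {1}(gen_sum z) linear_sum (big_morph pcrd pcrdD pcrd0) mulmx_sum_row.
by apply: eq_bigr => i _; rewrite linearZ pcrdZ1 rowK.
Qed.

Lemma mxofK (g : {linear PL -> PL}) z : mxmap (mxof g) z = g z.
Proof. by rewrite /mxmap -mxofE pcrdK. Qed.

(** Only basis elements of [A] are tested, to obtain finitely many linear equations over [F];
    [A_linearP] recovers all of [A]. *)
Definition A_linear (k : 'M[L]_d) : Prop :=
  forall b, k *m (rho (bas cA b))%:L = (rho (bas cA b))%:L *m k.

Lemma A_linearP (k : 'M[L]_d) (a : A) : A_linear k ->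
  k *m (rho a)%:L = (rho a)%:L *m k.
Proof.
move=> h.
have -> : rho a = \sum_b crd cA a 0 b *: rho (bas cA b).
  rewrite -[LHS]/(mklinear rho_linear a) {1}(crd_sum cA a) linear_sum.
  by apply: eq_bigr => b _; rewrite linearZ.
rewrite map_mx_sum mulmx_sumr mulmx_suml; apply: eq_bigr => b _.
by rewrite map_mxZ -scalemxAl -scalemxAr h.
Qed.

Lemma A_linear_mxof (g : {linear PL -> PL}) : A_linear (mxof g).
Proof.
move=> b; apply/row_matrixP => i; rewrite !row_mul rowK.
rewrite -[LHS]scale1r -pcrdZ -linearZ mxofE pcrdZ pcrd_gen -rowE scale1r.
by [].
Qed.

Fact mxmap_linear (k : 'M[L]_d) : A_linear k -> linear (mxmap k : PL -> PL).
Proof.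
move=> h a z w; apply: (can_inj pcrdK); rewrite pcrdD !pcrd_mxmap pcrdD mulmxDl.
congr (_ + _); elim/extalg_ind: a => [|t v ht hv|a l].
- by rewrite !scale0r pcrd0 mul0mx.
- have scD (y : PL) : ((t + v : AL) : AL^c) *: y = (t : AL^c) *: y + (v : AL^c) *: y.
    exact: scalerDl.
  by rewrite !scD !pcrdD mulmxDl ht hv.
by rewrite !pcrdZ pcrd_mxmap -scalemxAl -!mulmxA A_linearP.
Qed.

Section Conditions.
Variable k : 'M[L]_d.

Definition cond_herm : Prop := forall i j s,
  \sum_l k i l * (crd cA (hherm f (e l) (e j)) 0 s)%:A +
  \sum_l k j l * (crd cA (hherm f (e i) (e l)) 0 s)%:A =
  (crd cA (hherm f (e i) (e j)) 0 s)%:A.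

Variable nu : {linear algmod A -> algmod A}.

(** [nu] is to be a projection of [A] onto a complement of Lambda, with kernel Lambda. Membership in
    Lambda then is the linear equation [nu a = 0], which survives scalar extension. *)
Definition cond_diag : Prop := forall i s,
  \sum_l k i l * (crd cA (nu (hherm f (e l) (e i))) 0 s)%:A =
  (crd cA (nu (ftilde f (e i) (e i))) 0 s)%:A.

Lemma hherm_ext x a y b :
  hherm fL (ptens x a) (ptens y b) = atens (hherm f x y) (a * b).
Proof.
rewrite /hherm !ext_formE /= ext_sigma_tens atensM mulr1 atensDl.
by rewrite [b * a]mulrC.
Qed.

Lemma mxmap_gen i : mxmap k (gen i) = \sum_l ptens (e l) (k i l).
Proof.
rewrite /mxmap pcrd_gen -rowE /puncrd /tuncrd.
by apply: eq_bigr => l _; rewrite mxE.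
Qed.

Let sum_left (y : PL) (G : 'I_d -> PL) :
  hherm fL (\sum_l G l) y = \sum_l hherm fL (G l) y.
Proof.
apply: (big_morph (hherm fL ^~ y)) => [z w|]; first exact: hherm_Dl.
by apply: (addrI (hherm fL 0 y)); rewrite -hherm_Dl !addr0.
Qed.
Let sum_right (y : PL) (G : 'I_d -> PL) :
  hherm fL y (\sum_l G l) = \sum_l hherm fL y (G l).
Proof.
apply: (big_morph (hherm fL y)) => [z w|]; first exact: hherm_Dr.
by apply: (addrI (hherm fL y 0)); rewrite -hherm_Dr !addr0.
Qed.

Lemma cond_hermP : cond_herm <-> forall i j,
  hherm fL (mxmap k (gen i)) (gen j) + hherm fL (gen i) (mxmap k (gen j)) =
  hherm fL (gen i) (gen j).
Proof.
have E i j s : acrd (hherm fL (mxmap k (gen i)) (gen j) +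
     hherm fL (gen i) (mxmap k (gen j))) 0 s =
    \sum_l k i l * (crd cA (hherm f (e l) (e j)) 0 s)%:A +
    \sum_l k j l * (crd cA (hherm f (e i) (e l)) 0 s)%:A.
  rewrite !mxmap_gen sum_left sum_right acrdD !(big_morph acrd acrdD acrd0).
  rewrite mxE !summxE; congr (_ + _); apply: eq_bigr => l _.
    by rewrite hherm_ext acrd_tens !mxE mulr1.
  by rewrite hherm_ext acrd_tens !mxE mul1r.
have E' i j s : acrd (hherm fL (gen i) (gen j)) 0 s =
    (crd cA (hherm f (e i) (e j)) 0 s)%:A.
  by rewrite hherm_ext acrd_tens !mxE mul1r mul1r.
split=> [h i j|h i j s]; last by rewrite -E h E'.
by apply: acrd_inj; apply/rowP => s; rewrite E E' h.
Qed.

Hypothesis nuP : forall a, Lambda U a <-> nu a = 0.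
Hypothesis nuB : forall a, Lambda U (a - nu a).

Definition nuL (z : AL) : AL := tlift (fun (a : algmod A) l => atens (nu a) l) z.

Fact nu_bal : balanced (fun (a : algmod A) l => atens (nu a) l : AL).
Proof.
split=> [x y l|x l l'|c x l]; rewrite ?linearD ?atensDl ?atensDr //.
by rewrite linearZ /=; exact: (@tensZ F (algmod A) L c (nu x) l).
Qed.

Lemma nuL_tens a l : nuL (atens a l) = atens (nu a) l.
Proof. exact: (tlift_tens _ _ nu_bal). Qed.
Lemma nuLD : {morph nuL : x y / x + y}.
Proof. by move=> x y; exact: (tliftD _ _ nu_bal). Qed.
Lemma nuL0 : nuL 0 = 0.
Proof. exact: (tlift0 nu_bal). Qed.

Lemma ext_LambdaP z : ext_Lambda U z <-> nuL z = 0.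
Proof.
split=> [[s hs ->]|z0].
  rewrite (big_morph nuL nuLD nuL0) big_seq big1 // => p /hs /nuP p0.
  by rewrite nuL_tens p0 /atens; exact: (balanced0l _ (tens_balanced _ _)).
(* Unlike the vanishing of [nuL z], this is additive in [z] and can be checked on pure tensors. *)
suff: ext_Lambda U (z - nuL z) by rewrite z0 subr0.
elim/extalg_ind: z {z0} => [|t v ht hv|a l].
- by rewrite nuL0 subr0; exact: ext_Lambda0.
- by rewrite nuLD opprD addrACA; exact: ext_LambdaD.
by rewrite nuL_tens -atensN -atensDl; exact: ext_Lambda_tens.
Qed.

Lemma cond_diagP : cond_diag <-> forall i,
  Lambda (ext_unitary U L)
    (hherm fL (mxmap k (gen i)) (gen i) - ftilde fL (gen i) (gen i)).
Proof.
have E i s : acrd (nuL (hherm fL (mxmap k (gen i)) (gen i) -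
      ftilde fL (gen i) (gen i))) 0 s =
    \sum_l k i l * (crd cA (nu (hherm f (e l) (e i))) 0 s)%:A -
    (crd cA (nu (ftilde f (e i) (e i))) 0 s)%:A.
  rewrite mxmap_gen sum_left nuLD (big_morph nuL nuLD nuL0) acrdD.
  rewrite (big_morph acrd acrdD acrd0) mxE summxE; congr (_ + _).
    by apply: eq_bigr => l _; rewrite hherm_ext nuL_tens acrd_tens !mxE mulr1.
  rewrite ext_formE mul1r -atensN nuL_tens linearN acrd_tens linearN.
  by rewrite !mxE mul1r rmorphN.
split=> [h i|h i s].
  apply/ext_LambdaP/acrd_inj/rowP => s.
  by rewrite E h subrr acrd0 mxE.
have := E i s; rewrite ((ext_LambdaP _).1 (h i)) acrd0 mxE => /esym/eqP.
by rewrite subr_eq0 => /eqP.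
Qed.

Lemma in_classP : A_linear k ->
  cond_herm /\ cond_diag <-> in_class fL (mxmap k).
Proof.
move=> kA; rewrite cond_hermP cond_diagP.
split=> [[h l]|[h l]]; last by split=> *; [exact: h|exact: l].
have [kD kZ] : (forall z w, mxmap k (z + w) = mxmap k z + mxmap k w) /\
    (forall (a : AL) z, mxmap k ((a : AL^c) *: z) = (a : AL^c) *: mxmap k z).
  pose g := mklinear (mxmap_linear kA).
  by split=> [z w|a z]; [exact: (linearD g)|exact: (linearZZ g)].
have k0 : mxmap k 0 = 0 by rewrite /mxmap pcrd0 mul0mx -pcrd0 pcrdK.
have H0l y : hherm fL 0 y = 0.
  by apply: (addrI (hherm fL 0 y)); rewrite -hherm_Dl !addr0.
have H0r y : hherm fL y 0 = 0.
  by apply: (addrI (hherm fL y 0)); rewrite -hherm_Dr !addr0.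
have gind (Q : PL -> Prop) : Q 0 -> (forall z w, Q z -> Q w -> Q (z + w)) ->
    (forall (a : AL) i, Q ((a : AL^c) *: gen i)) -> forall z, Q z.
  move=> Q0 QD Qg z; rewrite (gen_sum z).
  by elim/big_ind: _ => // i _; exact: Qg.
have hh x y : hherm fL (mxmap k x) y + hherm fL x (mxmap k y) = hherm fL x y.
  elim/gind: x => [|z w hz hw|a i]; first by rewrite k0 !H0l addr0.
    by rewrite kD !hherm_Dl addrACA hz hw.
  elim/gind: y => [|z w hz hw|b j]; first by rewrite k0 !H0r addr0.
    by rewrite kD !hherm_Dr addrACA hz hw.
  by rewrite !kZ !hherm_Zl !hherm_Zr -mulrDr -mulrDl h.
split=> // x; elim/gind: x => [|z w hz hw|a i].
- rewrite k0 !H0l sub0r /ftilde linear0 oppr0; exact: Lambda0.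
- exact: in_class_add.
exact: in_class_scale.
Qed.

End Conditions.
End Points.
End FormModel.

(** * Affine systems over [F], solved uniformly in the algebra *)

Section AffineConditions.
Variables (F : fieldType) (d : nat).
Local Notation "M %:L" := (map_mx (in_alg _) M) (at level 2, format "M %:L").

(** The coefficients are quantified before [L]: one formula over [F] serves all algebras. *)
Definition affine_fun (phi : forall L : comAlgType F, 'M[L]_d -> L) : Prop :=
  exists (Z : 'M[F]_d) (c : F), forall (L : comAlgType F) (k : 'M[L]_d),
    phi L k = \sum_i \sum_j k i j * (Z i j)%:A + c%:A.

Definition affine_cond (Q : forall L : comAlgType F, 'M[L]_d -> Prop) : Prop :=
  exists (T : finType) (phi : T -> forall L : comAlgType F, 'M[L]_d -> L),
    (forall t, affine_fun (phi t)) /\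
    forall (L : comAlgType F) (k : 'M[L]_d), Q L k <-> forall t, phi t L k = 0.

Lemma affine_entry i j (z : F) : affine_fun (fun L k => k i j * z%:A).
Proof.
exists (z *: delta_mx i j), 0 => L k; rewrite scale0r addr0.
rewrite (bigD1 i) //= (bigD1 j) //= !mxE !eqxx mulr1.
rewrite big1 => [|l lj]; last by rewrite !mxE (negPf lj) andbF mulr0 scale0r mulr0.
rewrite big1 ?addr0 // => l li; rewrite big1 // => m _.
by rewrite !mxE (negPf li) mulr0 scale0r mulr0.
Qed.

Lemma affine_const (c : F) : affine_fun (fun L k => c%:A).
Proof.
exists 0, c => L k; rewrite big1 ?add0r // => i _; rewrite big1 // => j _.
by rewrite mxE scale0r mulr0.
Qed.

Lemma affine_add phi psi : affine_fun phi -> affine_fun psi ->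
  affine_fun (fun L k => phi L k + psi L k).
Proof.
move=> [Z [c h]] [Z' [c' h']]; exists (Z + Z'), (c + c') => L k.
rewrite h h' addrACA -scalerDl -big_split; congr (_ + _).
apply: eq_bigr => i _; rewrite -big_split; apply: eq_bigr => j _.
by rewrite mxE scalerDl mulrDr.
Qed.

Lemma affine_opp phi : affine_fun phi -> affine_fun (fun L k => - phi L k).
Proof.
move=> [Z [c h]]; exists (- Z), (- c) => L k; rewrite h opprD -scaleNr -sumrN.
congr (_ + _); apply: eq_bigr => i _; rewrite -sumrN; apply: eq_bigr => j _.
by rewrite mxE scaleNr mulrN.
Qed.

Lemma affine_sum (I : finType) (phi : I -> forall L : comAlgType F, 'M[L]_d -> L) :
  (forall i, affine_fun (phi i)) -> affine_fun (fun L k => \sum_i phi i L k).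
Proof.
move=> h; suff: forall s : seq I, affine_fun (fun L k => \sum_(i <- s) phi i L k).
  by apply.
elim=> [|i s IH].
  have [Z [c e]] := affine_const 0; exists Z, c => L k.
  by rewrite big_nil -e scale0r.
have [Z [c e]] := affine_add (h i) IH; exists Z, c => L k.
by rewrite big_cons e.
Qed.

Lemma affine_and Q Q' : affine_cond Q -> affine_cond Q' ->
  affine_cond (fun L k => Q L k /\ Q' L k).
Proof.
move=> [T [phi [h e]]] [T' [phi' [h' e']]].
exists (T + T')%type, (fun t => match t with inl t => phi t | inr t => phi' t end).
split=> [[t|t]|L k]; [exact: h|exact: h'|rewrite e e'].
by split=> [[a b] [t|t]|a] //; split=> t; [exact: (a (inl t))|exact: (a (inr t))].
Qed.

Definition affine_point (k0 : 'M[F]_d) (Pi : 'M[F]_(d * d)) (L : comAlgType F)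
  (X : 'rV[L]_(d * d)) : 'M[L]_d := k0%:L + vec_mx (X *m Pi%:L).

Lemma affine_condP (Q : forall L : comAlgType F, 'M[L]_d -> Prop) (k0 : 'M[F]_d) :
  affine_cond Q -> Q (F^o : comAlgType F) k0 ->
  exists Pi : 'M[F]_(d * d), forall (L : comAlgType F) (k : 'M[L]_d),
    Q L k <-> exists X, k = affine_point k0 Pi X.
Proof.
move=> [T [phi [h e]]] /e q0; have [Z hZ] := choice h; have [c hc] := choice hZ.
pose Zm : 'M[F]_(d * d, #|T|) := \matrix_(i, t) mxvec (Z (enum_val t)) 0 i.
have ZmE (L : comAlgType F) (k : 'M[L]_d) t :
    \sum_i \sum_j k i j * (Z t i j)%:A = (mxvec k *m Zm%:L) 0 (enum_rank t).
  rewrite pair_big mxE (reindex _ (curry_mxvec_bij d d)) /=.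
  by apply: eq_bigr => -[i j] _ /=; rewrite !mxE enum_rankK !mxvecE.
have ZmE0 t : (mxvec k0 *m Zm) 0 t = - c (enum_val t).
  have := q0 (enum_val t); rewrite hc => /eqP; rewrite addr_eq0 => /eqP e1.
  apply: etrans (etrans e1 (congr1 -%R (mulr1 (c (enum_val t)))) : _ = _ :> F).
  rewrite mxE (reindex _ (curry_mxvec_bij d d)) pair_big /=.
  apply: eq_bigr => -[i j] _ /=; rewrite !mxE !mxvecE.
  by rewrite -[_%:A]/(_ * 1) mulr1.
pose Pi := 1%:M - Zm *m pinvmx Zm.
have PiZ : Pi *m Zm = 0 by rewrite mulmxBl mul1mx mulmxKpV // subrr.
have QE (L : comAlgType F) (k : 'M[L]_d) :
    Q L k <-> mxvec (k - k0%:L) *m Zm%:L = 0.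
  have E t : phi t L k = (mxvec (k - k0%:L) *m Zm%:L) 0 (enum_rank t).
    rewrite (hc t) ZmE linearB /= mulmxBl [in RHS]mxE; congr (_ + _).
    rewrite -map_mxvec -map_mxM [in RHS]mxE [in RHS]mxE ZmE0 enum_rankK.
    by rewrite rmorphN opprK.
  split=> [/e q|q]; last by apply/e => t; rewrite E q mxE.
  by apply/rowP => t; rewrite -(enum_valK t) -E q mxE.
exists Pi => L k; rewrite QE; split=> [q|[X ->]].
  exists (mxvec (k - k0%:L)); rewrite /affine_point /Pi map_mxB map_mx1 map_mxM.
  by rewrite mulmxBr mulmx1 mulmxA q mul0mx subr0 mxvecK addrC subrK.
by rewrite /affine_point addrC addKr vec_mxK -mulmxA -map_mxM PiZ map_mx0 mulmx0.
Qed.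

End AffineConditions.

Lemma lrmorphism_ext (F : nzRingType) (R L : lalgType F) (f g : {lrmorphism R -> L}) :
  f =1 g -> f = g.
Proof.
move: f g => [f [[fa] [fm] [fs]]] [g [[ga] [gm] [gs]]] /= /funext fg; subst g.
by rewrite (Prop_irrelevance fa ga) (Prop_irrelevance fm gm) (Prop_irrelevance fs gs).
Qed.
(** * The matrix model of the orthogonal group *)

(* An affine group scheme Spec R of d x d matrices, with universal matrix gmat,
   in which the elements g with 1 - g invertible are the 1 - k^-1 for k an
   invertible point of the affine space k0 + im Pi. *)
Record cayley_model (F : fieldType) (R : comAlgType F) := CayleyModel {
  deg : nat;
  gmat : 'M[R]_deg;
  kbase : 'M[F]_deg;
  kproj : 'M[F]_(deg * deg);
  gmat_inj : forall (L : comAlgType F) (phi psi : {lrmorphism R -> L}),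
    map_mx phi gmat = map_mx psi gmat -> phi = psi;
  gmat_mul : forall (L : comAlgType F) (phi psi : {lrmorphism R -> L}),
    exists chi : {lrmorphism R -> L},
      map_mx chi gmat = map_mx phi gmat *m map_mx psi gmat;
  gmat_inv : forall (L : comAlgType F) (phi : {lrmorphism R -> L}),
    exists psi : {lrmorphism R -> L}, map_mx psi gmat *m map_mx phi gmat = 1%:M;
  gmat_cayley : forall (L : comAlgType F) X (k : 'M[L]_deg),
    affine_point kbase kproj X *m k = 1%:M ->
    exists phi : {lrmorphism R -> L}, map_mx phi gmat = 1%:M - k;
  gmat_cayleyV : forall (L : comAlgType F) (phi : {lrmorphism R -> L}) k,
    (1%:M - map_mx phi gmat) *m k = 1%:M ->
    exists X, k = affine_point kbase kproj X;
  kproj_unit : inexhaustible F ->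
    exists X : 'rV[F^o : comAlgType F]_(deg * deg),
      (affine_point kbase kproj X : 'M[F]_deg) \in unitmx }.

Section Model.
Variables (F : fieldType) (A : algebra F) (U : unitary_algebra A).
Variables (P : lmodType A^c) (f : {linear P -> dual U P}).
Variables (cP : coordinates (resmod P)) (cA : coordinates (algmod A)).
Local Notation d := (rk cP).
Local Notation e := (bas cP).
Local Notation "M %:L" := (map_mx (in_alg _) M) (at level 2, format "M %:L").

Section Nu.
Hypothesis hLam : F_summand U.

Fact nu_exists : exists nu : {linear algmod A -> algmod A},
  (forall a, Lambda U a <-> nu a = 0) /\ (forall a, Lambda U (a - nu a)).
Proof.
have [N [N0 ND NZ hN]] := hLam.
have /choice[nu hnu] a : exists n, N n /\ Lambda U (a - n).
  have [[l n] [[/= hl hn ->] _]] := hN a.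
  by exists n; split=> //; rewrite addrK.
have nuE a n : N n -> Lambda U (a - n) -> nu a = n.
  move=> Nn ln; have [ln' [_ uniq]] := hN a; have [Nnu lnu] := hnu a.
  have e1 : ln' = (a - n, n) by apply: uniq; rewrite /= subrK.
  have : ln' = (a - nu a, nu a) by apply: uniq; rewrite /= subrK.
  by rewrite e1 => -[_ ->].
have nul : linear (nu : algmod A -> algmod A).
  move=> c a b; have [Na la] := hnu a; have [Nb lb] := hnu b.
  apply: nuE; first by apply: ND => //; exact: NZ.
  rewrite opprD addrACA; apply: Lambda_add => //.
  by have := Lambda_lin c la; rewrite mulrBr.
exists (mklinear nul); split=> [a|a] /=; last by have [] := hnu a.
split=> [la|a0]; first by apply: nuE; rewrite ?subr0.
by have [_] := hnu a; rewrite a0 subr0.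
Qed.

End Nu.

Variable nu : {linear algmod A -> algmod A}.
Hypothesis nuP : forall a, Lambda U a <-> nu a = 0.
Hypothesis nuB : forall a, Lambda U (a - nu a).

Definition class_cond (L : comAlgType F) (k : 'M[L]_d) : Prop :=
  A_linear cA k /\ cond_herm f cA k /\ cond_diag f cA k nu.

Lemma class_cond_affine : affine_cond class_cond.
Proof.
apply: affine_and; last apply: affine_and.
- exists ('I_(rk cA) * ('I_d * 'I_d))%type.
  exists (fun t L k => \sum_l k t.2.1 l * ((rho cP (bas cA t.1) l t.2.2)%:A) +
     - \sum_l k l t.2.2 * ((rho cP (bas cA t.1) t.2.1 l)%:A)).
  split=> [t|L k].
    apply: affine_add; last apply: affine_opp;
      by apply: affine_sum => l; exact: affine_entry.
  split=> [h [b [i j]] /=|h b].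
    have /matrixP/(_ i j)/eqP := h b; rewrite -subr_eq0 !mxE => /eqP h0.
    by rewrite -[RHS]h0; congr (_ - _); apply: eq_bigr => l _; rewrite !mxE // mulrC.
  apply/matrixP => i j; apply/eqP; rewrite -subr_eq0; apply/eqP.
  rewrite -[RHS](h (b, (i, j))) !mxE /=; congr (_ - _); apply: eq_bigr => l _; rewrite !mxE //.
  by rewrite mulrC.
- exists ('I_d * 'I_d * 'I_(rk cA))%type.
  exists (fun t L k =>
    \sum_l k t.1.1 l * (crd cA (hherm f (e l) (e t.1.2)) 0 t.2)%:A +
    \sum_l k t.1.2 l * (crd cA (hherm f (e t.1.1) (e l)) 0 t.2)%:A +
    - (crd cA (hherm f (e t.1.1) (e t.1.2)) 0 t.2)%:A).
  split=> [t|L k].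
    apply: affine_add; last by apply: affine_opp; exact: affine_const.
    by apply: affine_add; apply: affine_sum => l; exact: affine_entry.
  split=> [h [[i j] s] /=|h i j s]; first by rewrite h subrr.
  by apply/eqP; rewrite -subr_eq0; apply/eqP; exact: (h (i, j, s)).
- exists ('I_d * 'I_(rk cA))%type.
  exists (fun t L k =>
    \sum_l k t.1 l * (crd cA (nu (hherm f (e l) (e t.1))) 0 t.2)%:A +
    - (crd cA (nu (ftilde f (e t.1) (e t.1))) 0 t.2)%:A).
  split=> [t|L k].
    apply: affine_add; last by apply: affine_opp; exact: affine_const.
    by apply: affine_sum => l; exact: affine_entry.
  split=> [h [i s] /=|h i s]; first by rewrite h subrr.
  by apply/eqP; rewrite -subr_eq0; apply/eqP; exact: (h (i, s)).
Qed.

Lemma class_condP (L : comAlgType F) (k : 'M[L]_d) : A_linear cA k ->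
  class_cond k <-> in_class (ext_form L f) (mxmap k).
Proof.
move=> kA; rewrite -(in_classP f nuP nuB kA); split; first by case.
by [].
Qed.

(** For [L = F] the equations are read off from a map on [P] itself, without passing through
    [extmod P F]. *)
Lemma class_cond_map (g : {linear P -> P}) : in_class f g ->
  class_cond (\matrix_i crd cP (g (e i)) : 'M[F^o : comAlgType F]_d).
Proof.
have gZ (c : F) (x : resmod P) : g (c *: x) = c *: (g x : resmod P).
  by rewrite !resmodZ linearZ.
have gl : linear (g : resmod P -> resmod P).
  by move=> c x y; rewrite linearD gZ.
set k := \matrix_i _; have kE x : crd cP (g x) = crd cP x *m k.
  exact: (crd_map cP cP (mklinear gl)).
have ge i : g (e i) = \sum_l k i l *: e l :> resmod P.
  by rewrite {1}(crd_sum cP (g (e i))); apply: eq_bigr => l _; rewrite mxE.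
have oneA (c : F) : (c%:A : F^o) = c by exact: mulr1.
have sumL (B : P -> P -> A) : (forall x y z, B (x + y) z = B x z + B y z) ->
  (forall (c : F) x y, B (c *: (x : resmod P)) y = alg_map A c * B x y) ->
  forall (mu : {linear algmod A -> algmod A}) i y s,
  \sum_l k i l * (crd cA (mu (B (e l) y)) 0 s) = crd cA (mu (B (g (e i)) y)) 0 s.
  move=> BD BZ mu i y s; rewrite ge.
  have B0 z : B 0 z = 0 by apply: (addrI (B 0 z)); rewrite -BD !addr0.
  rewrite (big_morph (B ^~ y) (fun x z => BD x z y) (B0 y)) !linear_sum summxE.
  by apply: eq_bigr => l _; rewrite BZ -algmodZ !linearZ /=; exact: esym (mxE _ _ _ _).
have hZl c x y : hherm f (c *: (x : resmod P)) y = alg_map A c * hherm f x y.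
  by rewrite resmodZ hherm_Zl sigma_alg_map.
have hZr c x y : hherm f x (c *: (y : resmod P)) = alg_map A c * hherm f x y.
  by rewrite resmodZ hherm_Zr alg_mapC.
move=> [h l]; split; last split.
- move=> b; apply/row_matrixP => i; rewrite !row_mul.
  have mE (M : 'M[F]_d) : M%:L = M :> 'M[F^o]_d.
    by apply/matrixP => ? ?; rewrite mxE; exact: oneA.
  rewrite !mE !rowK; apply: etrans (esym (crdZ cP _ _) : _ = _ :> 'rV[F]_d) _.
  apply: etrans (_ : _ = crd cP (g _)) (kE _).
  by rewrite linearZ.
- move=> i j s; rewrite oneA -h linearD mxE; congr (_ + _).
    under eq_bigr do rewrite oneA.
    exact: (sumL (hherm f) (hherm_Dl f) hZl idfun).
  under eq_bigr do rewrite oneA.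
  exact: (sumL (fun x y => hherm f y x) (fun x y z => hherm_Dr f z x y)
    (fun c x y => hZr c y x) idfun).
move=> i s; rewrite oneA; under eq_bigr do rewrite oneA.
rewrite (sumL (hherm f) (hherm_Dl f) hZl nu).
congr (crd cA _ 0 s); apply/eqP; rewrite -subr_eq0 -linearB; apply/eqP/nuP.
exact: l.
Qed.

Hypothesis hf : unimodular f.

(* g = h_f^-1 f *)
Lemma in_class_exists : exists g : {linear P -> P},
  forall x y, hherm f (g x) y = ftilde f x y.
Proof.
case: hf => hV hK hVK; pose g x := hV (f x).
have gE x y : hherm f (g x) y = ftilde f x y by rewrite hhermE hVK.
have inj x x' : (forall y, hherm f x y = hherm f x' y) -> x = x'.
  by move=> h; apply: (can_inj hK); apply: dual_ext => y; exact: h.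
have gl : linear g.
  move=> a x x'; apply: inj => y.
  by rewrite hherm_Dl hherm_Zl !gE ftilde_Dl ftilde_Zl.
by exists (mklinear gl).
Qed.

(** For [g = h_f^-1 f] the form h(2 g x - x, y) equals [f(x, y) - f(y, x)^σ u], which lies in
    [LambdaP]; so [F]-multiples of [2 g - 1] may be added to [g]. The resulting line is where an
    invertible element is sought. *)
Lemma in_class_pencil (g : {linear P -> P}) (t : F) :
  (forall x y, hherm f (g x) y = ftilde f x y) ->
  in_class f (fun x => g x + ((alg_map A t : A) : A^c) *: (g x + g x - x)).
Proof.
move=> gE; pose D x y := ftilde f x y - (ftilde f y x)^σ[U] * uelt U.
have hE x y : hherm f (g x + ((alg_map A t : A) : A^c) *: (g x + g x - x)) y =
    ftilde f x y + alg_map A t * D x y.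
  rewrite hherm_Dl hherm_Zl sigma_alg_map !hherm_Dl hherm_Nl !gE.
  by congr (_ + _ * _); rewrite /D /hherm; zmod_cancel.
have D0 x y : D x y + (D y x)^σ[U] * uelt U = 0.
  by rewrite /D sigmaD sigmaN mulrDl mulNr sigma_ueltK; zmod_cancel.
split=> [x y|x].
  rewrite -[X in _ + X]hherm_sym !hE sigmaD sigma_lin mulrDl -mulrA.
  by rewrite addrACA -mulrDr D0 mulr0 addr0.
rewrite hE addrC addKr; apply: Lambda_lin; exact: Lambda_min.
Qed.

Lemma class_cond_base : exists2 k0 : 'M[F]_d,
  class_cond (k0 : 'M[F^o : comAlgType F]_d) &
  forall t : F, class_cond (k0 + t *: (k0 + k0 - 1%:M) : 'M[F^o : comAlgType F]_d).
Proof.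
have [g gE] := in_class_exists; exists (\matrix_i crd cP (g (e i))).
  apply: class_cond_map; have := in_class_pencil 0 gE.
  by rewrite rmorph0; under eq_fun do rewrite scale0r addr0.
move=> t.
have gl : linear (fun x : P => g x + ((alg_map A t : A) : A^c) *: (g x + g x - x)).
  move=> a x y; rewrite linearP.
  have -> : a *: g x + g y + (a *: g x + g y) - (a *: x + y) =
    a *: (g x + g x - x) + (g y + g y - y).
    by rewrite !scalerDr scalerN; zmod_cancel.
  set V := g x + g x - x; set W := g y + g y - y.
  rewrite scalerDr (scalerDr a (g x)) !scalerA.
  rewrite (_ : (alg_map A t : A^c) * a = a * (alg_map A t : A^c)).
    by zmod_cancel.
  exact/esym/alg_mapC.
have := @class_cond_map (mklinear gl) (in_class_pencil t gE).
congr class_cond; apply/row_matrixP => i; rewrite rowK.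
have rowE' (k : 'M[F]_d) : row i (k + t *: (k + k - 1%:M)) =
    row i k + t *: (row i k + row i k - delta_mx 0 i).
  by apply/rowP => j; rewrite !mxE eqxx /= [j == i]eq_sym.
rewrite rowE' rowK -[delta_mx 0 i](uncrdK cP) -/(e i).
rewrite -linearD -linearB -linearZ -linearD; exact: erefl.
Qed.

(** If 2 = 0, the line consists of the [k0 - t], and [t] is taken off the eigenvalues of [k0];
    otherwise [t = - 1/2] gives the scalar matrix 1/2. *)
Lemma class_cond_unit (k0 : 'M[F]_d) :
  inexhaustible F -> exists t : F, k0 + t *: (k0 + k0 - 1%:M) \in unitmx.
Proof.
move=> inf; have [two0|two0] := eqVneq (2%:R : F) 0.
  have k00 : k0 + k0 = 0 by rewrite -mulr2n -scaler_nat two0 scale0r.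
  have [t _ /(_ ord0)] := @avoid_roots F 1 (fun=> F) (fun=> idfun)
    (fun=> char_poly k0) [::] inf (fun=> monic_neq0 (char_poly_monic k0)).
  rewrite -[_ != 0]/(~~ root _ _) -eigenvalue_root_char negbK.
  rewrite /eigenvalue /eigenspace kermx_eq0 row_free_unit => ut.
  by exists t; rewrite k00 sub0r scalerN scalemx1.
exists (- 2%:R^-1); rewrite scalerBr -mulr2n -scaler_nat scalerA mulNr.
rewrite mulVf // scaleN1r addrA subrr sub0r scaleNr opprK scalemx1.
by rewrite unitmxE det_scalar unitfE expf_neq0 // invr_neq0.
Qed.

Section Isometries.
Variable L : comAlgType F.
Local Notation PL := (extmod P L).
Local Notation fL := (ext_form L f).

(* Invertibility of an isometry over an arbitrary L: if H is the matrix over F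
   of x |-> h_f(x, -), then H is right invertible, and h(g x, g y) = h(x, y)
   expresses H as the product of g and an explicit matrix. *)
Lemma isom_unit (g : 'M[L]_d) : is_isom fL (mxmap g) ->
  exists g' : 'M[L]_d, g *m g' = 1%:M.
Proof.
pose hrow x : 'rV[F]_(d * rk cA) := mxvec (\matrix_j crd cA (hherm f x (e j))).
pose H := \matrix_i hrow (e i).
have hl : linear (hrow : resmod P -> _).
  move=> c x y; rewrite /hrow -linearP; congr mxvec; apply/row_matrixP => j.
  rewrite linearP /= !rowK hherm_Dl resmodZ hherm_Zl sigma_alg_map.
  by rewrite -linearP.
have hE x : hrow x = crd cP x *m H.
  rewrite -[LHS]/(mklinear hl x) {1}(crd_sum cP x) linear_sum mulmx_sum_row.
  by apply: eq_bigr => i _; rewrite linearZ rowK.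
have /row_freeP[H' HH'] : row_free H.
  apply/row_freeP; apply/row_freeP.
  rewrite -kermx_eq0; apply/eqP/row_matrixP => i; rewrite row0.
  set v := row i _; have v0 : v *m H = 0 by rewrite /v -row_mul mulmx_ker row0.
  move: v0; rewrite -(uncrdK cP v) -hE; set x := uncrd cP v => x0.
  suff -> : x = 0 by rewrite linear0.
  have hx y : hherm f x y = 0.
    have hj j : hherm f x (e j) = 0.
      apply: (can_inj (crdK cA)); rewrite linear0.
      have /row_matrixP/(_ j) : \matrix_j crd cA (hherm f x (e j)) = 0.
        by apply: (can_inj mxvecK); rewrite linear0.
      by rewrite rowK row0.
    have h0 : hherm f x 0 = 0.
      by apply: (addrI (hherm f x 0)); rewrite -hherm_Dr !addr0.
    rewrite -[y](crdK cP) (row_sum_delta (crd cP y)) linear_sum.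
    rewrite (big_morph (hherm f x) (hherm_Dr f x) h0) big1 // => j _.
    by rewrite linearZ /= resmodZ hherm_Zr hj mul0r.
  case: hf => hV hK _; apply: (can_inj hK); apply: dual_ext => y.
  rewrite -!hhermE hx.
  by apply: (addrI (hherm f 0 y)); rewrite -hherm_Dl !addr0.
have hLE (x : PL) : mxvec (\matrix_j acrd cA (hherm fL x (gen L j))) =
    pcrd cP x *m H%:L.
  elim/extmod_ind: x => [|z w hz hw|x a].
  - rewrite pcrd0 mul0mx; apply/rowP => s; case/mxvec_indexP: s => i s.
    rewrite mxvecE !mxE (_ : hherm fL 0 _ = 0) ?acrd0 ?mxE //.
    by apply: (addrI (hherm fL 0 (gen L i))); rewrite -hherm_Dl !addr0.
  - rewrite pcrdD mulmxDl -hz -hw -linearD; congr mxvec; apply/row_matrixP => j.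
    by rewrite linearD /= !rowK hherm_Dl acrdD.
  rewrite pcrd_tens -scalemxAl -map_mxM -hE /hrow map_mxvec -linearZ; congr mxvec.
  apply/row_matrixP => j; rewrite linearZ /= rowK -map_row rowK.
  by rewrite hherm_ext acrd_tens mulr1.
move=> [hg _].
have gE (x : PL) :
    mxvec (g *m vec_mx (pcrd cP x *m g *m H%:L)) = pcrd cP x *m H%:L.
  rewrite -pcrd_mxmap -!hLE mxvecK; congr mxvec; apply/row_matrixP => j.
  rewrite row_mul [in RHS]rowK -hg mxmap_gen; set y := mxmap g x.
  have h0 : hherm fL y 0 = 0.
    by apply: (addrI (hherm fL y 0)); rewrite -hherm_Dr !addr0.
  rewrite (big_morph _ (hherm_Dr fL y) h0) (big_morph _ (@acrdD _ _ cA L) (@acrd0 _ _ cA L)).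
  rewrite mulmx_sum_row; apply: eq_bigr => l _; rewrite mxE rowK.
  have acrdZ (z : extalg A L) a : acrd cA (z * atens 1 a) = a *: acrd cA z.
    elim/extalg_ind: z => [|t v ht hv|b a']; first by rewrite mul0r acrd0 scaler0.
      by rewrite mulrDl !acrdD ht hv scalerDr.
    by rewrite atensM mulr1 !acrd_tens scalerA mulrC.
  have -> : ptens (e l) (g j l) = (atens 1 (g j l) : (extalg A L)^c) *: gen L l.
    by rewrite /gen ptensM scale1r mul1r.
  by rewrite hherm_Zr acrdZ.
(* By [gE], applying [T] to [x g] gives [x H H' = x], so the matrix of [T] is a right inverse of
   [g]. *)
pose T v : 'rV[L]_d := mxvec (g *m vec_mx (v *m H%:L)) *m H'%:L.
have Tl : linear T.
  move=> a v w; rewrite /T mulmxDl -scalemxAl linearP /= mulmxDr -scalemxAr.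
  by rewrite linearP /= mulmxDl scalemxAl.
exists (lin1_mx (mklinear Tl)); apply/row_matrixP => i.
rewrite row_mul mul_rV_lin1 /= /T.
have := gE (gen L i); rewrite pcrd_gen -rowE => ->.
by rewrite -mulmxA -map_mxM HH' map_mx1 mulmx1 row1.
Qed.

Definition iso_mx (g : Oisom f L) : 'M[L]_d := mxof cP (iso_map g).

Lemma iso_mx_inj : injective iso_mx.
Proof.
move=> [g gb gq] [g' gb' gq'] /= e; have gg' : g = g'.
  apply: linear_ext => z; have := mxofK cP g z; have := mxofK cP g' z.
  by rewrite -/(iso_mx (Isometry gb gq)) -/(iso_mx (Isometry gb' gq')) e => -> ->.
subst g'; by rewrite (Prop_irrelevance gb gb') (Prop_irrelevance gq gq').
Qed.

(** Because vectors are rows, the product of matrices is the isometry [g' \o g], in the reverse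
    order. *)
Lemma iso_mx_mul (g g' : Oisom f L) :
  exists h : Oisom f L, iso_mx h = iso_mx g *m iso_mx g'.
Proof.
have hq : qclass (pullback (iso_map g' \o iso_map g) (ext_form L f)) =
    qclass (ext_form L f).
  apply/qclass_is_isom; apply: is_isom_comp; apply/qclass_is_isom; exact: iso_qclass.
exists (Isometry (bij_comp (iso_bij g') (iso_bij g)) hq).
apply/row_matrixP => i; rewrite row_mul !rowK.
exact: (mxofE cP (iso_map g')).
Qed.

Lemma iso_mx_inv (g : Oisom f L) :
  exists h : Oisom f L, iso_mx h *m iso_mx g = 1%:M.
Proof.
have [g' gK g'K] := iso_bij g.
have gl : linear g' by apply: can2_linear g'K; exact: gK.
have hq : qclass (pullback (mklinear gl) (ext_form L f)) = qclass (ext_form L f).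
  apply/qclass_is_isom; apply: (is_isom_inv g'K); apply/qclass_is_isom.
  exact: iso_qclass.
have hb : bijective (mklinear gl) by exists (iso_map g).
exists (Isometry hb hq); apply/row_matrixP => i; rewrite row_mul rowK.
by rewrite -(mxofE cP (iso_map g)) /= g'K pcrd_gen row1.
Qed.

Lemma iso_mx_cayley (k k' : 'M[L]_d) : class_cond k -> k *m k' = 1%:M ->
  exists g : Oisom f L, iso_mx g = 1%:M - k'.
Proof.
move=> kc kk'; have k'k : k' *m k = 1%:M by exact: mulmx1C.
have [kA _] := kc; set g : 'M_d := 1%:M - k'.
have gA : A_linear cA g.
  move=> b; rewrite mulmxBl mulmxBr mul1mx mulmx1; congr (_ - _).
  set r := map_mx _ _; rewrite -[r in RHS]mul1mx -k'k -(mulmxA k') kA -/r.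
  by rewrite -!mulmxA kk' mulmx1.
have gi : is_isom (ext_form L f) (mxmap g).
  apply: (@Cayley_isom _ _ _ _ (mxmap k) _ (mxmap k')).
  - by move=> z; rewrite mxmap_comp k'k mxmap1.
  - move=> z; apply: (can_inj (pcrdK cP (L:=L))); rewrite mxmap_comp mulmxBr mulmx1.
    by rewrite kk' pcrdD !pcrd_mxmap mulmxBr mulmx1 /pcrd tcrdN.
  exact/class_condP.
have [g' gg'] := isom_unit gi.
have hb : bijective (mklinear (mxmap_linear gA)).
  exists (mxmap g') => z /=; rewrite mxmap_comp ?gg' ?(mulmx1C gg') mxmap1 //.
have hq : qclass (pullback (mklinear (mxmap_linear gA)) (ext_form L f)) =
  qclass (ext_form L f) by apply/qclass_is_isom.
exists (Isometry hb hq); apply/row_matrixP => i.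
by rewrite rowK /= pcrd_mxmap pcrd_gen rowE.
Qed.

Lemma iso_mx_cayleyV (g : Oisom f L) (k : 'M[L]_d) :
  (1%:M - iso_mx g) *m k = 1%:M -> class_cond k.
Proof.
move=> gk; have kg : k *m (1%:M - iso_mx g) = 1%:M by exact: mulmx1C.
have kA : A_linear cA k.
  move=> b; set r := map_mx _ _.
  have rg : (1%:M - iso_mx g) *m r = r *m (1%:M - iso_mx g).
    have h := @A_linear_mxof _ _ _ cP cA L (iso_map g) b.
    by rewrite mulmxBl mulmxBr mul1mx mulmx1 [iso_mx g *m r]h.
  by rewrite -[r in LHS]mulmx1 -gk (mulmxA r) -rg !mulmxA kg mul1mx.
apply/class_condP => //; apply: (isom_Cayley (g := iso_map g)).
  move=> z; apply: (can_inj (pcrdK cP (L:=L))); rewrite pcrdD /pcrd tcrdN -!/(pcrd cP _).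
  rewrite mxofE pcrd_mxmap -/(iso_mx g) -{1}[pcrd cP z *m k]mulmx1 -mulmxBr.
  by rewrite -mulmxA kg mulmx1.
apply/qclass_is_isom; exact: iso_qclass.
Qed.

End Isometries.

Lemma extmod_map_bal (L L' : comAlgType F) (h : {lrmorphism L -> L'}) :
  balanced (fun (x : resmod P) k => ptens x (h k) : extmod P L').
Proof.
split=> [x x' k|x k k'|c x k]; first exact: ptensDl.
  by rewrite rmorphD; exact: ptensDr.
by rewrite linearZ; exact: ptensZ.
Qed.

Lemma pcrd_extmod_map (L L' : comAlgType F) (h : {lrmorphism L -> L'}) z :
  pcrd cP (extmod_map h z) = map_mx h (pcrd cP z).
Proof.
have bal := extmod_map_bal h.
elim/extmod_ind: z => [|z w hz hw|x k].
- by rewrite /extmod_map (tlift0 bal) !pcrd0 map_mx0.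
- by rewrite /extmod_map (tliftD _ _ bal) !pcrdD hz hw map_mxD.
rewrite /extmod_map (tlift_tens _ _ bal) !pcrd_tens; apply/rowP => j.
by rewrite !mxE rmorphM /= linearZ /= rmorph1.
Qed.

Lemma extmod_map_gen (L L' : comAlgType F) (h : {lrmorphism L -> L'}) (i : 'I_d) :
  extmod_map h (gen L i) = gen L' i :> extmod P L'.
Proof.
rewrite /extmod_map (tlift_tens _ _ (extmod_map_bal h)).
by rewrite /gen rmorph1.
Qed.

Theorem represents_cayley_model (R : comAlgType F) (O : represents f R) :
  exists C : cayley_model R, forall eps : {lrmorphism R -> F^o},
    is_identity_point O eps -> map_mx eps (gmat C) = 1%:M.
Proof.
(* As in the Yoneda lemma, the universal matrix is that of the tautological point; naturality gives
   the matrix of every other point. *)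
pose G := iso_mx (rep O (idfun : {lrmorphism R -> R})).
have GE (L : comAlgType F) (phi : {lrmorphism R -> L}) :
    iso_mx (rep O phi) = map_mx phi G.
  apply/row_matrixP => i; rewrite rowK -map_row rowK -pcrd_extmod_map.
  congr (pcrd cP _); rewrite -rep_nat extmod_map_gen.
  congr (iso_map (rep O _) _); exact: lrmorphism_ext.
have GV (L : comAlgType F) (g : Oisom f L) :
    exists phi : {lrmorphism R -> L}, map_mx phi G = iso_mx g.
  have [r _ rK] := rep_bij O L.
  by exists (r g); rewrite -GE rK.
have [k0 ck0 ckt] := class_cond_base.
have [Pi hPi] := affine_condP class_cond_affine ck0.
have inj (L : comAlgType F) (phi psi : {lrmorphism R -> L}) :
    map_mx phi G = map_mx psi G :> 'M[L]_d -> phi = psi.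
  by rewrite -!GE => /iso_mx_inj /(bij_inj (rep_bij O L)).
unshelve eexists.
  apply: (@CayleyModel F R d G k0 Pi) => //.
  - move=> L phi psi; rewrite -!GE; have [h <-] := iso_mx_mul (rep O phi) (rep O psi).
    exact: GV.
  - move=> L phi; rewrite -GE; have [h <-] := iso_mx_inv (rep O phi).
    by have [psi <-] := GV L h; exists psi.
  - move=> L X k /iso_mx_cayley [|g <-]; last exact: GV.
    by apply/hPi; exists X.
  - by move=> L phi k; rewrite -GE => /iso_mx_cayleyV /hPi.
  move=> inf; have [t ut] := class_cond_unit k0 inf.
  by have /hPi[X eX] := ckt t; exists X; rewrite -eX.
move=> eps heps /=; rewrite -GE; apply/row_matrixP => i.
by rewrite rowK heps pcrd_gen row1.
Qed.

End Model.
(** * Words in Cayley transforms *)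

Section AlgebraPoints.
Variables (F : fieldType) (L : comAlgType F).

(** The structure map as an algebra morphism out of [F^o]; composition with it turns rational points
    into [L]-points. *)
Definition scalar (c : F^o) : L := c%:A.
Fact scalar_zmod : zmod_morphism scalar.
Proof. by move=> a b; rewrite /scalar scalerBl. Qed.
Fact scalar_monoid : monoid_morphism scalar.
Proof. by split=> [|a b]; rewrite /scalar ?scale1r // -[a%:A * _]scalerAl mul1r scalerA. Qed.
Fact scalar_scalable : scalable scalar.
Proof. by move=> a b; rewrite /scalar scalerA. Qed.
HB.instance Definition _ := GRing.isZmodMorphism.Build F^o L scalar scalar_zmod.
HB.instance Definition _ := GRing.isMonoidMorphism.Build F^o L scalar scalar_monoid.
HB.instance Definition _ := GRing.isScalable.Build F F^o L *:%R scalar scalar_scalable.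

Lemma scalarE (R : comAlgType F) (psi : {lrmorphism R -> F^o}) m n (M : 'M[R]_(m, n)) :
  map_mx (scalar \o psi) M = map_mx (in_alg L) (map_mx psi M).
Proof. by apply/matrixP => i j; rewrite !mxE. Qed.

Section Eval.
Variables (n : nat) (X : 'rV[L]_n).
Definition mev (p : mpoly n F) : L := mmap (in_alg L) (fun i => X 0 i) p.
Fact mev_zmod : zmod_morphism mev. Proof. exact: rmorphB. Qed.
Fact mev_monoid : monoid_morphism mev.
Proof. by split; [exact: rmorph1|exact: rmorphM]. Qed.
Fact mev_scalable : scalable mev.
Proof. by move=> c p; rewrite /mev mmapZ /= mulr_algl. Qed.
HB.instance Definition _ := GRing.isZmodMorphism.Build (mpoly n F) L mev mev_zmod.
HB.instance Definition _ := GRing.isMonoidMorphism.Build (mpoly n F) L mev mev_monoid.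
HB.instance Definition _ := GRing.isScalable.Build F (mpoly n F) L *:%R mev mev_scalable.

Lemma mevX i : mev (mpolyX F (mnm1 i)) = X 0 i.
Proof. by rewrite /mev mmapX mmap1U. Qed.
End Eval.

Lemma affine_point_map (L' : comAlgType F) (h : {lrmorphism L -> L'}) d
    (k0 : 'M[F]_d) Pi (X : 'rV[L]_(d * d)) :
  map_mx h (affine_point k0 Pi X) = affine_point k0 Pi (map_mx h X).
Proof.
have hA m n (M : 'M[F]_(m, n)) : map_mx h (map_mx (in_alg L) M) = map_mx (in_alg L') M.
  by apply/matrixP => i j; rewrite !mxE linearZ /= rmorph1.
by rewrite /affine_point map_mxD map_vec_mx map_mxM !hA.
Qed.

End AlgebraPoints.

Section Words.
Variables (F : fieldType) (R : comAlgType F) (C : cayley_model R).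
Hypothesis inf : inexhaustible F.
Variable eps : {lrmorphism R -> F^o}.
Hypothesis eps1 : map_mx eps (gmat C) = 1%:M.
Local Notation G := (gmat C).
Local Notation d := (deg C).
Local Notation kap := (affine_point (kbase C) (kproj C)).
Local Notation "M %:L" := (map_mx (in_alg _) M) (at level 2, format "M %:L").

Definition kapF (X : 'rV[F]_(d * d)) : 'M[F]_d := kap (X : 'rV[F^o : comAlgType F]_(d * d)).

Lemma kapFE (L : comAlgType F) X : (kapF X)%:L = kap (X%:L) :> 'M[L]_d.
Proof. exact: (affine_point_map (scalar L) (kbase C) (kproj C) X). Qed.

Definition good X := kapF X \in unitmx.
Definition cay X : 'M[F]_d := 1%:M - invmx (kapF X).

Definition wmat (xs : seq 'rV[F]_(d * d)) : 'M[F]_d :=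
  foldr (fun X M => cay X *m M) 1%:M xs.

Lemma wmat_cat xs ys : wmat (xs ++ ys) = wmat xs *m wmat ys.
Proof. by elim: xs => [|X xs IH] /=; rewrite ?mul1mx // IH mulmxA. Qed.

Lemma cay_point X : good X -> exists psi : {lrmorphism R -> F^o}, map_mx psi G = cay X.
Proof. move=> gX; exact: (@gmat_cayley _ _ C (F^o : comAlgType F) X _ (mulmxV gX)). Qed.

Lemma wmat_point xs : all good xs ->
  exists psi : {lrmorphism R -> F^o}, map_mx psi G = wmat xs.
Proof.
elim: xs => [_|X xs IH /= /andP[/cay_point[psi <-] /IH[psi' <-]]]; first by exists eps.
exact: gmat_mul.
Qed.

Local Notation Mp := (mpoly (d * d) F).
Definition genX : 'rV[Mp]_(d * d) := \row_i mpolyX F (mnm1 i).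
Definition genk : 'M[Mp]_d := affine_point (L := Mp) (kbase C) (kproj C) genX.
Definition gdet : Mp := \det genk.

Lemma mev_genX (L : comAlgType F) (X : 'rV[L]_(d * d)) : map_mx (mev X) genX = X.
Proof. by apply/rowP => i; rewrite !mxE mevX. Qed.

Lemma mev_genk (L : comAlgType F) (X : 'rV[L]_(d * d)) : map_mx (mev X) genk = kap X.
Proof. by rewrite /genk (affine_point_map (mev X)) mev_genX. Qed.

Lemma mev_gdet (L : comAlgType F) (X : 'rV[L]_(d * d)) : mev X gdet = \det (kap X).
Proof. by rewrite /gdet -det_map_mx mev_genk. Qed.

Lemma gdet_neq0 : gdet != 0.
Proof.
have [X uX] := kproj_unit C inf; apply/eqP => N0.
have := mev_gdet X; rewrite N0 rmorph0 => /esym d0.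
by move: uX; rewrite unitmxE d0 unitr0.
Qed.

Fact gdet_powM (x y : Mp) : (exists k, x = gdet ^+ k) -> (exists k, y = gdet ^+ k) ->
  exists k, x * y = gdet ^+ k.
Proof. by move=> [k ->] [l ->]; exists (k + l)%N; rewrite exprD. Qed.
Fact gdet_pow0 : ~ exists k, (0 : Mp) = gdet ^+ k.
Proof. by move=> [k /esym/eqP]; rewrite expf_eq0 (negPf gdet_neq0) andbF. Qed.

Definition gdet_pow : mulset Mp :=
  MulSet (ex_intro _ 0 (esym (expr0 gdet))) gdet_powM gdet_pow0.

(* The coordinate ring of { X | kap X invertible } *)
Definition cring : comAlgType F := loc (R := Mp) gdet_pow.

Lemma gdet_powP : gdet_pow gdet. Proof. by exists 1; rewrite expr1. Qed.

Lemma cring_ev (L : comAlgType F) (X : 'rV[L]_(d * d)) (k : 'M[L]_d) :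
  kap X *m k = 1%:M -> exists h : {lrmorphism cring -> L},
  forall p : Mp, h (to_loc gdet_pow p) = mev X p.
Proof.
move=> kk.
have hV s : exists t, gdet_pow s -> mev X s * t = 1.
  (* [s] is only known to be some power of [gdet]; any exponent that presents it so yields an
     inverse, and [xget] selects one. *)
  exists ((\det k) ^+ (xget 0 [set j | s = gdet ^+ j])) => -[j sj].
  have := @xgetPex _ 0 [set j | s = gdet ^+ j] (ex_intro _ j sj).
  set m := xget _ _ => ->; rewrite rmorphXn /= -exprMn mev_gdet -det_mulmx kk.
  by rewrite det1 expr1n.
have [inv hinv] := choice hV.
exists (loc_liftr (h := mev X) hinv) => p.
rewrite /= loc_liftE; last exact: mset1.
  by have := hinv 1 (mset1 _); rewrite rmorph1 mul1r => ->; rewrite mulr1.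
exact: hinv.
Qed.

(** [Spec cring] is a nonempty open part of an affine space, and [F] is infinite, so its rational
    points are Zariski dense. *)
Lemma cring_eq0 (u : cring) :
  (forall (X : 'rV[F]_(d * d)) (h : {lrmorphism cring -> F^o}), good X ->
     (forall p : Mp, h (to_loc gdet_pow p) = mev (X : 'rV[F^o : comAlgType F]_(d * d)) p) ->
     h u = 0) -> u = 0.
Proof.
move=> hu; have [p [s Ms uE]] := locP u.
suff p0 : p = 0 by rewrite uE p0 mkfrac0.
(* Nothing is known about [p] where [gdet] vanishes; the extra factor takes care of those points and
   is cancelled at the end. *)
have : p * gdet = 0.
  apply: mpoly_eq0_meval => // v.
  pose X : 'rV[F^o : comAlgType F]_(d * d) := \row_i v i.
  have mE q : mev X q = meval v q :> F.
    rewrite /mev /meval /mmap; apply: eq_bigr => m _; congr (_ * _).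
      exact: mulr1.
    by rewrite /mmap1; apply: eq_bigr => i _; rewrite mxE.
  rewrite mevalM -[meval v gdet]mE mev_gdet.
  have [d0|d0] := eqVneq (\det (kap X) : F) 0; first by rewrite d0 mulr0.
  have gX : good X by rewrite /good unitmxE unitfE.
  have [h hE] := @cring_ev (F^o : comAlgType F) X _ (mulmxV gX).
  have := hu X h gX hE; rewrite uE mkfracE // rmorphM /= hE => /eqP.
  rewrite mulf_eq0 => /orP[/eqP|/eqP h1]; first by rewrite mE => ->; rewrite mul0r.
  have := congr1 h (to_locV Ms); rewrite rmorphM /= h1 mulr0 rmorph1 => /eqP.
  by rewrite eq_sym oner_eq0.
by move/eqP; rewrite mulf_eq0 (negPf gdet_neq0) orbF => /eqP.
Qed.

(** [theta] is the morphism [X |-> y s_X z] from the parameter space to the group, described by its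
    effect on all points. *)
Lemma cring_map (y z : {lrmorphism R -> F^o}) :
  exists theta : {lrmorphism R -> cring},
  forall (L : comAlgType F) (X : 'rV[L]_(d * d)) (k : 'M[L]_d) (h : {lrmorphism cring -> L}),
    (forall p : Mp, h (to_loc gdet_pow p) = mev X p) -> kap X *m k = 1%:M ->
    map_mx (h \o theta) G = (map_mx y G)%:L *m (1%:M - k) *m (map_mx z G)%:L.
Proof.
pose XS := map_mx (to_loc gdet_pow) genX.
pose kS : 'M[cring]_d := kap XS.
have kSE : kS = map_mx (to_loc gdet_pow) genk.
  by rewrite /genk (affine_point_map (to_loc gdet_pow)).
(* The inverse of the generic [kap], as its adjugate divided by its determinant. *)
pose kV : 'M[cring]_d := (mkfrac gdet_pow 1 gdet : cring) *: \adj kS.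
have kSV : kS *m kV = 1%:M.
  rewrite /kV -scalemxAr mul_mx_adj {1}kSE det_map_mx -/gdet scale_scalar_mx mulrC.
  by rewrite to_locV //; exact: gdet_powP.
have [chi chiE] := gmat_cayley kSV.
have [th1 th1E] := gmat_mul C (scalar cring \o y : {lrmorphism R -> cring}) chi.
have [theta thetaE] := gmat_mul C th1 (scalar cring \o z : {lrmorphism R -> cring}).
exists theta => L X k h hE kk.
have hS m n (M : 'M[F]_(m, n)) : map_mx h (M%:L) = M%:L.
  by apply/matrixP => i j; rewrite !mxE linearZ /= rmorph1.
rewrite map_mx_comp thetaE th1E chiE !scalarE !map_mxM map_mxB map_mx1 !hS.
have hXS : map_mx h XS = X by apply/rowP => i; rewrite !mxE hE mevX.
suff -> : map_mx h kV = k by [].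
have : kap X *m map_mx h kV = 1%:M.
  by rewrite -hXS -(affine_point_map h) -map_mxM kSV map_mx1.
move/(congr1 (mulmx k)); rewrite mulmxA (mulmx1C kk) mul1mx mulmx1.
by [].
Qed.

End Words.
Arguments kapF {F R} C X.
Arguments good {F R} C X.
Arguments cay {F R} C X.
Arguments wmat {F R} C xs.

(** * From rational points of a closed set to its generic points *)

Lemma subspace_rowspace (F : fieldType) n (T : 'rV[F]_n -> Prop) :
  T 0 -> (forall a u v, T u -> T v -> T (a *: u + v)) ->
  exists Y : 'M[F]_n, forall v, T v <-> (v <= Y)%MS.
Proof.
move=> T0 TP.
pose ok r := `[< exists Y : 'M[F]_n, (forall v, (v <= Y)%MS -> T v) /\ \rank Y = r >].
have ex : exists r, ok r.
  by exists 0%N; apply/asboolP; exists 0; split=> [v|]; rewrite ?mxrank0 // submx0 => /eqP ->.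
have ub r : ok r -> (r <= n)%N by move=> /asboolP[Y [_ <-]]; exact: rank_leq_row.
(* A row space of maximal rank inside [T] is all of [T], since adding a further [v] would raise the
   rank. *)
case: (ex_maxnP ex ub) => r /asboolP[Y [YT rY]] rmax.
exists Y => v; split=> [Tv|]; last exact: YT.
have Z : forall w, (w <= Y + v)%MS -> T w.
  move=> w /sub_addsmxP[[a b] /= ->]; rewrite (mx11_scalar b) mul_scalar_mx addrC.
  by apply: TP => //; apply: YT; exact: submxMl.
have /rmax : ok (\rank (Y + v)%MS) by apply/asboolP; exists (Y + v)%MS.
rewrite -rY => le; apply: submx_trans (addsmxSr Y v) _.
by have [_] := mxrank_leqif_sup (addsmxSl Y v) ; rewrite eqn_leq le mxrankS ?addsmxSl.
Qed.

Section Separated.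
Variables (F : fieldType) (R : comAlgType F).

(* v arises from phi(y) = sum_j c_j (y b_j) on replacing the point y by the
   generic point: v = sum_j c_j b_j. *)
Definition separated (phi : {lrmorphism R -> F^o} -> R) (v : R) : Prop :=
  exists s : seq (R * R),
    (forall y, phi y = \sum_(c <- s) c.1 * scalar R (y c.2)) /\
    v = \sum_(c <- s) c.1 * c.2.

Lemma separated_const (c : R) : separated (fun=> c) c.
Proof.
exists [:: (c, 1)]; split=> [y|]; rewrite big_seq1 /= ?mulr1 //.
by rewrite !rmorph1 mulr1.
Qed.

Lemma separated_pt (b : R) : separated (fun y => scalar R (y b)) b.
Proof. by exists [:: (1, b)]; split=> [y|]; rewrite big_seq1 /= mul1r. Qed.

Lemma separated_add phi v psi w : separated phi v -> separated psi w ->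
  separated (fun y => phi y + psi y) (v + w).
Proof.
move=> [s [h ->]] [t [h' ->]]; exists (s ++ t); split=> [y|]; rewrite big_cat //=.
by rewrite h h'.
Qed.

Lemma separated_mul phi v psi w : separated phi v -> separated psi w ->
  separated (fun y => phi y * psi y) (v * w).
Proof.
move=> [s [h ->]] [t [h' ->]].
exists [seq (a.1 * b.1, a.2 * b.2) | a <- s, b <- t].
split=> [y|]; rewrite big_allpairs_dep ?h ?h' big_distrl /=;
  apply: eq_bigr => a _; rewrite big_distrr /=; apply: eq_bigr => b _.
  by rewrite !rmorphM mulrACA.
by rewrite mulrACA.
Qed.

Lemma separated_sum (I : Type) (r : seq I) (Q : pred I) phi v :
  (forall i, separated (phi i) (v i)) ->
  separated (fun y => \sum_(i <- r | Q i) phi i y) (\sum_(i <- r | Q i) v i).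
Proof.
move=> h; elim: r => [|i r IH].
  rewrite big_nil; have [s [e e']] := separated_const 0.
  by exists s; split=> // y; rewrite big_nil -e.
rewrite big_cons; case: ifP => Qi.
  have [s [e e']] := separated_add (h i) IH.
  by exists s; split=> // y; rewrite big_cons Qi -e.
by have [s [e e']] := IH; exists s; split=> // y; rewrite big_cons Qi -e.
Qed.

Lemma separated_prod (I : Type) (r : seq I) phi v :
  (forall i, separated (phi i) (v i)) ->
  separated (fun y => \prod_(i <- r) phi i y) (\prod_(i <- r) v i).
Proof.
move=> h; elim: r => [|i r IH].
  rewrite big_nil; have [s [e e']] := separated_const 1.
  by exists s; split=> // y; rewrite big_nil -e.
rewrite big_cons; have [s [e e']] := separated_mul (h i) IH.
by exists s; split=> // y; rewrite big_cons -e.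
Qed.

Lemma separated_det n (phi : {lrmorphism R -> F^o} -> 'M[R]_n) (M : 'M[R]_n) :
  (forall i j, separated (fun y => phi y i j) (M i j)) ->
  separated (fun y => \det (phi y)) (\det M).
Proof.
move=> h; apply: separated_sum => s; apply: separated_mul.
  exact: separated_const.
exact: separated_prod.
Qed.

(** The vectors [w] over [F] with [\sum_j c_j w_j] in [p] form the row space of some [Y], which
    contains [y(b)] for all [y] in [E]. Hence the entries of [b - b' Y], with [b'] from the
    pseudo-inverse of [Y], vanish on [E] and lie in [p]: modulo [p], [b] is an [R]-combination of
    the rows of [Y], each of which gives a sum in [p]. *)
Lemma separated_closure (p : set R) (E : set {lrmorphism R -> F^o}) phi v :
  prime_ideal p -> separated phi v ->
  (forall r, (forall y, E y -> y r = 0) -> p r) ->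
  (forall y, E y -> p (phi y)) -> p v.
Proof.
move=> [p0 pD pM _ _] [s [phiE ->]] hE hp.
pose n := size s; pose c (j : 'I_n) := (nth (0, 0) s j).1.
pose b : 'rV[R]_n := \row_j (nth (0, 0) s j).2.
have sumE (g : R * R -> R) : \sum_(a <- s) g a = \sum_(j < n) g (nth (0, 0) s j).
  by rewrite (big_nth (0, 0)) big_mkord.
have psum (I : finType) (g : I -> R) : (forall i, p (g i)) -> p (\sum_i g i).
  by move=> h; elim/big_ind: _.
pose T (w : 'rV[F]_n) := p (\sum_j c j * (w 0 j)%:A).
have [|a u w Tu Tw|Y hY] := @subspace_rowspace F n T.
- by rewrite /T big1 // => j _; rewrite mxE scale0r mulr0.
- rewrite /T; have -> : \sum_j c j * ((a *: u + w) 0 j)%:A =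
      a%:A * (\sum_j c j * (u 0 j)%:A) + \sum_j c j * (w 0 j)%:A.
    rewrite big_distrr -big_split; apply: eq_bigr => j _.
    by rewrite /= !mxE scalerDl mulrDr mulr_algl scalerAr scalerA.
  by apply: pD => //; exact: pM.
have TE y : E y -> T (map_mx y b).
  move=> Ey; have := hp y Ey; rewrite phiE sumE /T.
  by under [X in _ -> p X]eq_bigr => j _ do rewrite !mxE.
pose b' := b *m map_mx (in_alg R) (pinvmx Y).
have rE i : p ((b - b' *m map_mx (in_alg R) Y) 0 i).
  apply: hE => y Ey; have hR m k (M : 'M[F]_(m, k)) : map_mx y (map_mx (in_alg R) M) = M.
    by apply/matrixP => i' j'; rewrite !mxE linearZ /= rmorph1; exact: mulr1.
  have -> : y ((b - b' *m map_mx (in_alg R) Y) 0 i) =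
      (map_mx y (b - b' *m map_mx (in_alg R) Y)) 0 i by rewrite [RHS]mxE.
  rewrite map_mxB !map_mxM !hR.
  have := mulmxKpV ((hY _).1 (TE y Ey)) => ->.
  by rewrite subrr mxE.
have -> : \sum_(a <- s) a.1 * a.2 =
    \sum_i b' 0 i * (\sum_j c j * (Y i j)%:A) +
    \sum_j c j * (b - b' *m map_mx (in_alg R) Y) 0 j.
  have -> : \sum_i b' 0 i * (\sum_j c j * (Y i j)%:A) =
      \sum_j c j * (b' *m map_mx (in_alg R) Y) 0 j.
    under eq_bigr do rewrite big_distrr /=.
    rewrite exchange_big; apply: eq_bigr => j _; rewrite mxE big_distrr.
    apply: eq_bigr => i _; rewrite mulrCA; congr (_ * (_ * _)).
    exact: esym (mxE _ _ _ _).
  rewrite -big_split sumE; apply: eq_bigr => j _ /=.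
  rewrite -mulrDr; congr (_ * _); set B := b' *m _.
  have -> : (nth (0, 0) s j).2 = b 0 j by rewrite mxE.
  by rewrite -{1}[b](subrK B) addrC [LHS]mxE.
apply: pD; apply: psum => i; last by apply: pM.
apply: pM; have : T (row i Y) by apply/hY; exact: row_sub.
by rewrite /T; under eq_bigr do rewrite mxE.
Qed.

End Separated.

(** * The union of the odd translates is open and closed *)

Lemma map_regular (F : fieldType) m n (M : 'M[F]_(m, n)) :
  map_mx (in_alg F^o) M = M :> 'M[F^o]_(m, n).
Proof. by apply/matrixP => i j; rewrite mxE; exact: mulr1. Qed.

Section Clopen.
Variables (F : fieldType) (R : comAlgType F) (C : cayley_model R).
Hypothesis inf : inexhaustible F.
Variable eps : {lrmorphism R -> F^o}.
Hypothesis eps1 : map_mx eps (gmat C) = 1%:M.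
Local Notation G := (gmat C).
Local Notation d := (deg C).
Local Notation kap := (affine_point (kbase C) (kproj C)).
Local Notation "M %:L" := (map_mx (in_alg _) M) (at level 2, format "M %:L").

(** The union of the translates [o U]: at a prime [p], [o - g] is invertible over the residue field
    iff its determinant is outside [p]. *)
Definition odd_points : set (Spec R) :=
  zariski_basic [set r | exists xs, [/\ all (good C) xs, odd (size xs) &
                                     r = \det ((wmat C xs)%:L - G)]].

Definition even_word (psi : {lrmorphism R -> F^o}) : Prop :=
  exists xs, [/\ all (good C) xs, ~~ odd (size xs) & map_mx psi G = wmat C xs].

Definition even_ideal : set R := [set r | forall psi, even_word psi -> psi r = 0].

Fact compl_mul (p : Spec R) x y : ~ sval p x -> ~ sval p y -> ~ sval p (x * y).
Proof. by case: (svalP p) => _ _ _ _ pp px py /pp[]. Qed.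
Fact compl1 (p : Spec R) : ~ sval p 1.
Proof. by case: (svalP p). Qed.
Fact compl0 (p : Spec R) : ~ ~ sval p 0.
Proof. by case: (svalP p) => p0 _ _ _ _; apply. Qed.
Definition compl_mulset (p : Spec R) : mulset R :=
  MulSet (compl1 (p := p)) (@compl_mul p) (compl0 (p := p)).

(** With [w] the matrix of [psi], the parametrization is applied to [w^-1 g], for which
    [1 - w^-1 g = w^-1 (w - g)] is invertible; this matrix is the second witness, the inverse of
    [kap X]. *)
Lemma cayley_factor (L : comAlgType F) (phi : {lrmorphism R -> L})
    (psi : {lrmorphism R -> F^o}) (v : L) :
  \det ((map_mx psi G)%:L - map_mx phi G) * v = 1 ->
  exists X k, kap X *m k = 1%:M /\ map_mx phi G = (map_mx psi G)%:L *m (1%:M - k).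
Proof.
set w := map_mx psi G; set g := map_mx phi G => dv.
have [psi' psi'E] := gmat_inv C psi; rewrite -/w in psi'E.
have [chi chiE] := gmat_mul C (scalar L \o psi' : {lrmorphism R -> L}) phi.
set w' := map_mx psi' G in psi'E; rewrite scalarE -/w' -/g in chiE.
have w'w : w'%:L *m w%:L = 1%:M :> 'M[L]_d by rewrite -map_mxM psi'E map_mx1.
pose k : 'M[L]_d := v *: \adj (w%:L - g) *m w%:L.
have Dk : (w%:L - g) *m k = w%:L.
  rewrite /k -scalemxAl -scalemxAr mulmxA mul_mx_adj mul_scalar_mx scalerA.
  by rewrite mulrC dv scale1r.
have kk : (1%:M - map_mx chi G) *m k = 1%:M.
  by rewrite chiE -w'w -mulmxBr -mulmxA Dk.
have [X kX] := gmat_cayleyV kk.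
exists X, (1%:M - map_mx chi G); split; first by rewrite -kX; exact: mulmx1C.
by rewrite opprB addrC subrK chiE mulmxA (mulmx1C w'w) mul1mx.
Qed.

(* If o - g is invertible for an odd word o, then g = o s_X, and a function
   vanishing on the even words o s_X with X rational vanishes at all of them. *)
Lemma odd_points_even_ideal (p : Spec R) : odd_points p -> even_ideal `<=` sval p.
Proof.
move=> [_ [xs [gxs oxs ->]] pdet] r rE.
(* In the local ring at [p] the determinant becomes invertible, while elements that become zero
   there belong to [p]. *)
pose L : comAlgType F := loc (compl_mulset p).
pose tl : {lrmorphism R -> L} := to_loc (compl_mulset p).
have [psi psiE] := wmat_point eps1 gxs.
have [X [k [Xk gE]]] : exists X k, kap X *m k = 1%:M /\
    map_mx tl G = (map_mx psi G)%:L *m (1%:M - k).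
  have tlL m n (M : 'M[F]_(m, n)) : map_mx tl (M%:L) = M%:L.
    by apply/matrixP => i j; rewrite !mxE linearZ /= rmorph1.
  apply: (@cayley_factor _ _ _ (mkfrac (compl_mulset p) 1 (\det ((wmat C xs)%:L - G)))).
  by rewrite psiE -tlL -map_mxB det_map_mx; exact: to_locV.
have [h hE] := cring_ev inf Xk.
have [th thE] := cring_map C inf psi eps.
have {}thr : th r = 0.
  apply: cring_eq0 => // Y h' gY h'E.
  have := rE (h' \o th : {lrmorphism R -> F^o}); apply.
  exists (xs ++ [:: Y]); split; first by rewrite all_cat gxs /= gY.
    by rewrite size_cat addn1 /= oxs.
  rewrite (thE (F^o : comAlgType F) Y _ h' h'E (mulmxV gY)).
  by rewrite !map_regular eps1 mulmx1 wmat_cat /= mulmx1 psiE.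
have e : (h \o th : {lrmorphism R -> L}) = tl.
  by apply: (gmat_inj (c := C)); rewrite (thE L X _ h hE Xk) eps1 map_mx1 mulmx1.
have : tl r = 0 by rewrite -e /= thr rmorph0.
move=> /mkfrac_eq0[|m pm mr]; first exact: mset1.
have [p0 _ _ _ pp] := svalP p.
by have /pp[] : sval p (m * r) by rewrite mr.
Qed.

Lemma even_ideal_odd_points (p : Spec R) : even_ideal `<=` sval p -> odd_points p.
Proof.
move=> Ep; apply: contrapT => np.
have hp xs : all (good C) xs -> odd (size xs) -> sval p (\det ((wmat C xs)%:L - G)).
  move=> gxs oxs; apply: contrapT => h; apply: np.
  by exists (\det ((wmat C xs)%:L - G)) => //; exists xs.
have [X gX] := kproj_unit C inf.
pose s : 'M[R]_d := (cay C X)%:L.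
(* Each entry is a sum of products of values of [y] with constants of [R], and separatedness passes
   to determinants; this is what allows [y] to be replaced by [G]. *)
have sep : separated (fun y => \det (map_mx (scalar R \o y) G *m s - G))
    (\det (G *m s - G)).
  apply: separated_det => i j.
  have e1 := separated_add (phi := fun y => (map_mx (scalar R \o y) G *m s) i j)
     (v := (G *m s) i j) (psi := fun y => - G i j) (w := - G i j).
  have [t [tE tv]] : separated (fun y => (map_mx (scalar R \o y) G *m s) i j + - G i j)
     ((G *m s) i j + - G i j).
    apply: e1; last exact: separated_const.
    have [t [tE tv]] : separated
        (fun y => \sum_l scalar R (y (G i l)) * s l j) (\sum_l G i l * s l j).
      apply: separated_sum => l; apply: separated_mul; last exact: separated_const.
      exact: separated_pt.
    exists t; split=> [y|]; rewrite mxE // -tE; apply: eq_bigr => l _.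
    by rewrite mxE.
  by exists t; split=> [y|]; rewrite !mxE -?tE -?tv !mxE.
have : sval p (\det (G *m s - G)).
  apply: (separated_closure (svalP p) sep (E := even_word)) => // y [xs [gxs oxs yE]].
  have := hp (xs ++ [:: X]); rewrite all_cat gxs /= (gX : good C X) size_cat addn1 /= oxs.
  by rewrite wmat_cat /= mulmx1 map_mxM -yE -scalarE => /(_ isT isT).
have [p0 pD pM p1 _] := svalP p; move=> h; apply: p1.
(* [G s - G = - G k^-1] has the inverse [- k G^-1]. *)
have [v vE] : exists v, v * \det (G *m s - G) = 1.
  have [psi] := gmat_inv C (idfun : {lrmorphism R -> R}).
  rewrite [map_mx (idfun : {lrmorphism R -> R}) G]map_mx_id // => psiG.
  have kX : kapF C X *m invmx (kapF C X) = 1%:M by exact: mulmxV.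
  exists (\det (map_mx psi G) * \det (- (kapF C X)%:L)).
  rewrite [\det (map_mx _ _) * _]mulrC -mulrA -det_mulmx -det_mulmx mulmxBr mulmxA.
  rewrite psiG mul1mx -[RHS](det1 R d); congr (\det _).
  rewrite /s /cay map_mxB map_mx1 addrAC subrr sub0r mulmxN mulNmx opprK.
  by rewrite -map_mxM kX map_mx1.
by rewrite -vE; exact: pM.
Qed.

Lemma odd_pointsE : odd_points = ~` zariski_basic even_ideal.
Proof.
apply/seteqP; split=> p.
  by move=> /odd_points_even_ideal h [r /h].
move=> h; apply: even_ideal_odd_points => r rE; apply: contrapT => pr.
by apply: h; exists r.
Qed.

Lemma component_odd_points : component eps `<=` odd_points.
Proof.
have op : open odd_points by exists [set r | exists xs, [/\ all (good C) xs,
   odd (size xs) & r = \det ((wmat C xs)%:L - G)]].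
have cl : closed odd_points.
  by rewrite odd_pointsE; apply: open_closedC; exists even_ideal.
(* The empty word is even, so functions in the even ideal vanish at the identity. *)
have eo : odd_points (Spec_map eps (Spec_pt F)).
  apply: even_ideal_odd_points => r rE /=.
  by apply: rE; exists [::]; split=> //=.
move=> q [B [Beps _ cB] Bq].
have BV : B `&` odd_points = B.
  apply: cB; [exists (Spec_map eps (Spec_pt F))|exists odd_points|exists odd_points] => //.
have : (B `&` odd_points) q by rewrite BV.
by case.
Qed.

End Clopen.
(** * Connectedness and interpolation *)

Lemma Spec_eq (R : comPzRingType) (p q : Spec R) : sval p = sval q -> p = q.
Proof.
case: p q => [p hp] [q hq] /= e; subst q.
by rewrite (Prop_irrelevance hp hq).
Qed.

Section Connected.
Variables (F : fieldType) (R : comAlgType F) (C : cayley_model R).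
Hypothesis inf : inexhaustible F.
Variable eps : {lrmorphism R -> F^o}.
Hypothesis eps1 : map_mx eps (gmat C) = 1%:M.
Local Notation G := (gmat C).
Local Notation d := (deg C).
Local Notation kap := (affine_point (kbase C) (kproj C)).
Local Notation "M %:L" := (map_mx (in_alg _) M) (at level 2, format "M %:L").
Local Notation S := (cring C inf).

Fact cring_zero_prime : prime_ideal [set 0 : S].
Proof.
split=> /=.
- by [].
- by move=> x y -> ->; rewrite addr0.
- by move=> a x ->; rewrite mulr0.
- by apply/eqP; rewrite oner_eq0.
move=> x y; have [a [s Ms ->]] := locP x; have [b [t Mt ->]] := locP y.
rewrite mkfracM // => /mkfrac_eq0[|m [k ->] /eqP]; first exact: msetM.
rewrite mulf_eq0 expf_eq0 (negPf (gdet_neq0 C inf)) andbF /= mulf_eq0.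
by case/orP=> /eqP->; [left|right]; exact: mkfrac0.
Qed.

(** [S] is a domain, so the image of [Spec S] lies in the closure of the image of the generic point
    [eta], and the closure of a point is connected. *)
Lemma cring_connected (T : {lrmorphism R -> S}) (q0 q : Spec S) :
  component eps (Spec_map T q0) -> component eps (Spec_map T q).
Proof.
pose eta : Spec S := exist _ _ cring_zero_prime.
have inB x : closure [set Spec_map T eta] (Spec_map T x).
  move=> V; rewrite nbhsE => -[W [[E ->] [r Er xr]] WV].
  exists (Spec_map T eta); split=> //; apply: WV; exists r => //= r0.
  by apply: xr => /=; rewrite r0; case: (svalP x).
have cB : connected (closure [set Spec_map T eta]).
  by apply: connected_closure; exact: connected1.
move=> h; apply: connected_component_trans h _.
by apply: (connected_component_max (inB q0) _ cB) => //; exact: inB.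
Qed.

(** For [s = 1 - k^-1] the matrix [1 - s^-1 = - s^-1 k^-1] is invertible, so [s^-1] is again a
    Cayley transform. *)
Lemma cay_inv X : good C X -> exists2 Y, good C Y & cay C Y *m cay C X = 1%:M.
Proof.
move=> gX; have [psi psiE] := cay_point gX; have [psi' psi'E] := gmat_inv C psi.
set w := map_mx psi' G in psi'E; rewrite psiE in psi'E.
have kV : kapF C X *m invmx (kapF C X) = 1%:M by exact: mulmxV.
have kk : (1%:M - w) *m (- (cay C X *m kapF C X)) = 1%:M :> 'M[F]_d.
  rewrite mulmxN mulmxA mulmxBl mul1mx psi'E -mulNmx opprB.
  by rewrite /cay opprB addrC subrK mulVmx.
have [Y YE] := @gmat_cayleyV _ _ C (F^o : comAlgType F) psi' _ kk.
have kY : kapF C Y *m (1%:M - w) = 1%:M by rewrite /kapF -YE; exact: mulmx1C kk.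
have gY : good C Y by exact: (mulmx1_unit kY).1.
have VE : invmx (kapF C Y) = 1%:M - w.
  by rewrite -[LHS]mulmx1 -[X in _ *m X]kY mulmxA mulVmx // mul1mx.
by exists Y => //; rewrite {1}/cay VE opprB addrC subrK.
Qed.

(** The assumption on [theta] is the property provided by [cring_map]; the point [y s_X z] is then
    located as the image under [theta] of a point of the parameter space. *)
Lemma good_point (X : 'rV[F]_(d * d)) : good C X ->
  exists h : {lrmorphism S -> F^o},
    forall (theta : {lrmorphism R -> S}) (y z psi : {lrmorphism R -> F^o}),
    (forall (L : comAlgType F) (X : 'rV[L]_(d * d)) (k : 'M[L]_d)
        (h : {lrmorphism S -> L}),
      (forall p, h (to_loc (gdet_pow C inf) p) = mev X p) -> kap X *m k = 1%:M ->
      map_mx (h \o theta) G = (map_mx y G)%:L *m (1%:M - k) *m (map_mx z G)%:L) ->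
    map_mx psi G = map_mx y G *m cay C X *m map_mx z G ->
    Spec_map psi (Spec_pt F) = Spec_map theta (Spec_map h (Spec_pt F)).
Proof.
move=> gX; have [h hE] := @cring_ev _ _ C inf (F^o : comAlgType F) X _ (mulmxV gX).
exists h => theta y z psi thE psiE; apply: Spec_eq => /=.
have -> : psi = (h \o theta : {lrmorphism R -> F^o}) => //.
apply: (gmat_inj (c := C)).
rewrite (thE (F^o : comAlgType F) X _ h hE (mulmxV gX)) !map_regular.
exact: psiE.
Qed.

(** Induction by two letters: in [s_X s_Y w] the first letter moves, within an irreducible family,
    from [s_X] to [s_Y^-1], where the product becomes [w]. *)
Lemma even_word_component psi : even_word C psi ->
  component eps (Spec_map psi (Spec_pt F)).
Proof.
move=> [xs [gxs exs psiE]].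
have [m] := ubnP (size xs); elim: m => // m IH in xs gxs exs psi psiE *.
case: xs gxs exs psiE => [|X [|Y xs]] // gxs exs psiE szm.
  have -> : psi = eps by apply: (gmat_inj (c := C)); rewrite psiE eps1.
  exact: connected_component_refl.
have /and3P[gX gY gxs'] := gxs.
have [Y' gY' Y'Y] := cay_inv gY.
have [z zE] : exists z : {lrmorphism R -> F^o}, map_mx z G = wmat C (Y :: xs).
  by apply: wmat_point eps1 _ _; rewrite /= gY.
have [psi0 psi0E] := wmat_point eps1 gxs'.
have [th thE] := cring_map C inf eps z.
have [h hE] := good_point gX; have [h' h'E] := good_point gY'.
rewrite (hE th eps z) //; last by rewrite eps1 mul1mx zE.
apply: (cring_connected (q0 := Spec_map h' (Spec_pt F))).
rewrite -(h'E th eps z psi0 thE); last first.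
  by rewrite eps1 mul1mx zE psi0E /= mulmxA Y'Y mul1mx.
apply: (IH xs) => //; first by move: exs; rewrite /= negbK.
by move: szm; rewrite /= ltnS => /ltnW.
Qed.

(** A single rational member of the family [psi s_X] is an even word, hence in the component; the
    rest follows by irreducibility of the family. *)
Lemma odd_word_component xs (psi : {lrmorphism R -> F^o}) (th : {lrmorphism R -> S}) :
  all (good C) xs -> odd (size xs) -> map_mx psi G = wmat C xs ->
  (forall (L : comAlgType F) (X : 'rV[L]_(d * d)) (k : 'M[L]_d)
      (h : {lrmorphism S -> L}),
    (forall p, h (to_loc (gdet_pow C inf) p) = mev X p) -> kap X *m k = 1%:M ->
    map_mx (h \o th) G = (map_mx psi G)%:L *m (1%:M - k) *m (map_mx eps G)%:L) ->
  in_component eps th.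
Proof.
move=> gxs oxs psiE thE q; have [X gX] := kproj_unit C inf.
have gxX : all (good C) (xs ++ [:: X]) by rewrite all_cat gxs /= andbT.
have [psi' psi'E] := wmat_point eps1 gxX.
have [h hE] := good_point (gX : good C X).
apply: cring_connected (_ : component eps (Spec_map th (Spec_map h (Spec_pt F)))).
rewrite -(hE th psi eps psi' thE).
  apply: even_word_component; exists (xs ++ [:: X]); split=> //.
  by rewrite size_cat addn1 /= oxs.
by rewrite psi'E wmat_cat psiE eps1 mulmx1 /= mulmx1.
Qed.

End Connected.

(** * Interpolation between words *)

Section Interpolation.
Variables (F : fieldType) (R : comAlgType F) (C : cayley_model R).
Hypothesis inf : inexhaustible F.
Local Notation d := (deg C).
Local Notation at_ t := (map_mx (horner_eval t)).

Definition line (t : F) (xs ys : seq 'rV[F]_(d * d)) :=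
  [seq xy.1 + t *: (xy.2 - xy.1) | xy <- zip xs ys].

Lemma kapF_line X Y t : kapF C (X + t *: (Y - X)) = kapF C X + t *: (kapF C Y - kapF C X).
Proof.
pose g (Z : 'rV[F]_(d * d)) : 'M[F]_d := vec_mx (Z *m map_mx (in_alg F^o) (kproj C)).
have kE Z : kapF C Z = map_mx (in_alg F^o) (kbase C) + g Z by [].
have gE : g (X + t *: (Y - X)) = g X + t *: (g Y - g X) :> 'M[F]_d.
  by rewrite /g mulmxDl -scalemxAl mulmxBl linearD linearZ /= linearB.
rewrite !kE gE; set B : 'M[F]_d := map_mx _ _.
have -> : B + g Y - (B + g X) = g Y - g X.
  by rewrite opprD addrACA subrr add0r.
by rewrite addrA.
Qed.

(** Each letter is [1 - K^-1 = adj(K) (K - 1) / det K], with [K] affine in [t]. [D] is the product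
    of these denominators and [W] the word with denominators cleared. *)
Lemma wmat_line xs ys : size xs = size ys ->
  exists (D : {poly F}) (W : 'M[{poly F}]_d),
    forall t, (D.[t] != 0 <-> all (good C) (line t xs ys)) /\
      (D.[t] != 0 -> at_ t W = D.[t] *: wmat C (line t xs ys)).
Proof.
elim: xs ys => [|X xs IH] [|Y ys] //=.
  move=> _; exists 1, 1%:M => t; rewrite hornerC oner_eq0 /line /=; split=> // _.
  by rewrite map_mx1 scale1r.
move=> [/IH[D [W h]]].
pose K : 'M[{poly F}]_d := map_mx polyC (kapF C X) + 'X *: map_mx polyC (kapF C Y - kapF C X).
have KE t : at_ t K = kapF C (X + t *: (Y - X)).
  rewrite kapF_line /K; move: (kapF C X) (kapF C Y) => a b; apply/matrixP => i j.
  by rewrite !mxE /horner_eval /= !hornerE.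
exists (\det K * D), (\adj K *m (K - 1%:M) *m W) => t; have [hD hW] := h t.
have dK : (\det K).[t] = \det (kapF C (X + t *: (Y - X))).
  by rewrite -KE det_map_mx.
have gE : good C (X + t *: (Y - X)) = ((\det K).[t] != 0).
  by rewrite /good unitmxE unitfE dK.
rewrite hornerM mulf_eq0 negb_or; split.
  rewrite /line /= gE; split=> [/andP[-> /hD]|/andP[-> /hD ->]] //.
move=> /andP[K0 /hW WE]; rewrite !map_mxM map_mxB map_mx1 map_mx_adj KE WE.
rewrite -scalemxAr [_ * D.[t]]mulrC -scalerA /= dK; congr (_ *: _).
have uk : kapF C (X + t *: (Y - X)) \in unitmx by rewrite -/(good C _) gE.
have -> : \adj (kapF C (X + t *: (Y - X))) =
    \det (kapF C (X + t *: (Y - X))) *: invmx (kapF C (X + t *: (Y - X))).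
  by rewrite /invmx uk scalerA mulfV ?scale1r // -unitfE -unitmxE.
by rewrite /cay mulmxBr mulmx1 -!scalemxAl mulVmx // -scalerBr -scalemxAl.
Qed.

(** When [s_Y s_X = 1], the appended pairs leave the product unchanged, so words of equal parity can
    be brought to a common length. *)
Definition pad (X Y : 'rV[F]_(d * d)) n xs := xs ++ flatten (nseq n [:: Y; X]).

Lemma padP X Y n xs : good C X -> good C Y -> cay C Y *m cay C X = 1%:M ->
  [/\ all (good C) (pad X Y n xs) = all (good C) xs,
     size (pad X Y n xs) = (size xs + n.*2)%N & wmat C (pad X Y n xs) = wmat C xs].
Proof.
move=> gX gY YX; rewrite /pad all_cat size_cat wmat_cat.
have [-> -> ->] : [/\ all (good C) (flatten (nseq n [:: Y; X])),
    size (flatten (nseq n [:: Y; X])) = n.*2 &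
    wmat C (flatten (nseq n [:: Y; X])) = 1%:M].
  elim: n => [|n [a b c]] //=; split; rewrite ?gX ?gY // ?b ?doubleS //.
  by rewrite c mulmx1.
by rewrite andbT mulmx1.
Qed.

Lemma line0 xs ys : size xs = size ys -> line 0 xs ys = xs.
Proof.
elim: xs ys => [|X xs IH] [|Y ys] //= [/IH e]; rewrite /line /= -/(line _ _ _) e.
by rewrite scale0r addr0.
Qed.

Lemma line1 xs ys : size xs = size ys -> line 1 xs ys = ys.
Proof.
elim: xs ys => [|X xs IH] [|Y ys] //= [/IH e]; rewrite /line /= -/(line _ _ _) e.
by rewrite scale1r addrC subrK.
Qed.

Lemma size_line t xs ys : size xs = size ys -> size (line t xs ys) = size xs.
Proof. by move=> e; rewrite size_map size_zip e minnn. Qed.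

(* Two words of the same length are joined by a rational curve of words, along
   which each det(o - M_i) vanishes only finitely often. *)
Lemma common_odd_word (n : nat) (k : 'I_n -> fieldType)
    (j : forall i, {rmorphism F -> k i}) (M : forall i, 'M[k i]_d) :
  (forall i, exists xs, [/\ all (good C) xs, odd (size xs) &
     \det (map_mx (j i) (wmat C xs) - M i) != 0]) ->
  exists xs, [/\ all (good C) xs, odd (size xs) &
     forall i, \det (map_mx (j i) (wmat C xs) - M i) != 0].
Proof.
move=> hi; pose ok i xs := \det (map_mx (j i) (wmat C xs) - M i) != 0.
suff: forall m, (m <= n)%N -> exists xs, [/\ all (good C) xs, odd (size xs) &
     forall i : 'I_n, (i < m)%N -> ok i xs].
  by move=> /(_ n (leqnn n))[xs [gxs oxs h]]; exists xs; split=> // i; exact: h.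
have [X0 gX0] := kproj_unit C inf; have [Y0 gY0 YX0] := cay_inv (gX0 : good C X0).
elim=> [_|m IH mn]; first by exists [:: X0]; rewrite /= andbT.
have [xs0 [gxs0 oxs0 h0]] := IH (ltnW mn).
pose im := Ordinal mn; have [ys0 [gys0 oys0 hm]] := hi im.
(* Both lengths a and b are odd, so each padded word has length a + b - 1. *)
pose xs := pad X0 Y0 (size ys0)./2 xs0; pose ys := pad X0 Y0 (size xs0)./2 ys0.
have [gx sx wx] := padP (size ys0)./2 xs0 gX0 gY0 YX0.
have [gy sy wy] := padP (size xs0)./2 ys0 gX0 gY0 YX0.
have sxy : size xs = size ys.
  rewrite sx sy -{1}(odd_double_half (size xs0)) -{2}(odd_double_half (size ys0)).
  by rewrite oxs0 oys0 addnAC.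
rewrite -/xs gxs0 in gx; rewrite -/ys gys0 in gy.
have [D [W DW]] := wmat_line sxy.
(* [H i] is [D^d] times the determinant to be kept nonzero, hence a polynomial in [t]. *)
pose H i : {poly k i} := \det (map_mx (map_poly (j i)) W -
   map_poly (j i) D *: map_mx polyC (M i)).
have HE i t : (H i).[j i t] = \det (map_mx (j i) (at_ t W) - j i D.[t] *: M i).
  rewrite -[LHS]/(horner_eval (j i t) (H i)) -det_map_mx; congr (\det _).
  apply/matrixP => a b; rewrite !mxE [LHS]horner_evalE.
  by rewrite hornerD hornerN hornerM hornerC !horner_map.
have HE' i t : D.[t] != 0 -> (H i).[j i t] =
    j i D.[t] ^+ d * \det (map_mx (j i) (wmat C (line t xs ys)) - M i).
  move=> D0; rewrite HE ((DW t).2 D0) map_mxZ /= -scalerBr detZ //.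
have D00 : D.[0] != 0 by apply/(DW 0).1; rewrite line0.
have D01 : D.[1] != 0 by apply/(DW 1).1; rewrite line1.
(* [H i] is nonzero by its value at t = 0 for [i < m] and at t = 1 for [i = m]; for larger indices
   only the goodness of the letters is kept. *)
pose Q i : {poly k i} := if (i < m.+1)%N then map_poly (j i) D * H i else map_poly (j i) D.
have jD i : map_poly (j i) D != 0.
  by rewrite map_poly_eq0; apply: contraNneq D00 => ->; rewrite horner0.
have Q0 i : Q i != 0.
  rewrite /Q; case: ifP => [im1|_]; last exact: jD.
  rewrite mulf_neq0 ?jD //.
  have [lim|] := ltnP i m.
    apply: contraTneq (h0 i lim) => H0; have := HE' i 0 D00.
    rewrite H0 horner0 line0 // wx => /esym/eqP.
    by rewrite mulf_eq0 expf_eq0 fmorph_eq0 (negPf D00) andbF /= /ok => /eqP ->; rewrite eqxx.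
  move=> mi; have ei : i = im by apply: val_inj; apply/eqP; rewrite eqn_leq mi -ltnS im1.
  rewrite ei; apply: contraTneq hm => H0; have := HE' im 1 D01.
  rewrite H0 horner0 line1 // wy => /esym/eqP.
  by rewrite mulf_eq0 expf_eq0 fmorph_eq0 (negPf D01) andbF /= => /eqP ->; rewrite eqxx.
have [t _ hQ] := avoid_roots j [::] inf Q0.
have Dt : D.[t] != 0.
  have := hQ im; rewrite /Q ltnSn hornerM mulf_eq0 negb_or => /andP[].
  by rewrite horner_map fmorph_eq0.
exists (line t xs ys); split; first exact/(DW t).1.
  by rewrite size_line // sx oddD oxs0 odd_double.
move=> i im1; have := hQ i; rewrite /Q im1 hornerM mulf_eq0 negb_or => /andP[_].
by rewrite HE' // mulf_eq0 negb_or => /andP[].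
Qed.

End Interpolation.
(** * Density *)

Section TopologicalAlgebra.
Variables (F : fieldType) (K : topComUnitAlgType F).

Definition cont_at (T : topologicalType) (x : T) (f : T -> K) : Prop := f @ x --> f x.

Section Continuity.
Variables (T : topologicalType) (x : T).

Lemma cont_cst (c : K) : cont_at x (fun _ : T => c).
Proof. exact: cvg_cst. Qed.

Lemma cont_add (f g : T -> K) : cont_at x f -> cont_at x g ->
  cont_at x (fun y => f y + g y).
Proof.
move=> cf cg; apply: (@continuous2_cvg _ _ _ _ _ _ f g (fun a b : K => a + b)) cf cg.
exact: (topring_add_continuous (f x, g x)).
Qed.

Lemma cont_mul (f g : T -> K) : cont_at x f -> cont_at x g ->
  cont_at x (fun y => f y * g y).
Proof.
move=> cf cg; apply: (@continuous2_cvg _ _ _ _ _ _ f g (fun a b : K => a * b)) cf cg.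
exact: (topring_mul_continuous (f x, g x)).
Qed.

Lemma cont_sum (I : Type) (r : seq I) (f : I -> T -> K) :
  (forall i, cont_at x (f i)) ->
  cont_at x (fun y => \sum_(i <- r) f i y).
Proof.
move=> cf; elim: r => [|i r IH].
  by rewrite (_ : (fun y => _) = fun=> 0); [exact: cont_cst|apply/funext => y; rewrite big_nil].
rewrite (_ : (fun y => _) = fun y => f i y + \sum_(i <- r) f i y).
  exact: cont_add.
by apply/funext => y; rewrite big_cons.
Qed.

Lemma cont_prod (I : Type) (r : seq I) (f : I -> T -> K) :
  (forall i, cont_at x (f i)) ->
  cont_at x (fun y => \prod_(i <- r) f i y).
Proof.
move=> cf; elim: r => [|i r IH].
  by rewrite (_ : (fun y => _) = fun=> 1); [exact: cont_cst|apply/funext => y; rewrite big_nil].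
rewrite (_ : (fun y => _) = fun y => f i y * \prod_(i <- r) f i y).
  exact: cont_mul.
by apply/funext => y; rewrite big_cons.
Qed.

Lemma cont_exp (f : T -> K) n : cont_at x f ->
  cont_at x (fun y => f y ^+ n).
Proof.
move=> cf; elim: n => [|n IH].
  exact: cont_cst.
rewrite (_ : (fun y => _) = fun y => f y * f y ^+ n).
  exact: cont_mul.
by apply/funext => y; rewrite exprS.
Qed.

End Continuity.

Lemma cont_coord n (X : 'rV[K]_n) i : cont_at X (fun Y : 'rV[K]_n => Y 0 i).
Proof.
move=> V VX; exists (fun _ j => if j == i then V else setT).
  by move=> a j; rewrite (ord1 a); case: eqP => [->|_] //; exact: filterT.
by move=> Y /(_ 0 i); rewrite eqxx.
Qed.

Lemma cont_mev n (X : 'rV[K]_n) (p : mpoly n F) :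
  cont_at X (fun Y : 'rV[K]_n => mev Y p).
Proof.
apply: cont_sum => m; apply: cont_mul; first exact: cont_cst.
by apply: cont_prod => i; apply: cont_exp; exact: cont_coord.
Qed.

Hypothesis h1_open : open [set a : K | a \is a GRing.unit].
Hypothesis h1_inv : {within [set a : K | a \is a GRing.unit],
  continuous (fun a : K => a^-1)}.

Lemma cont_inv (T : topologicalType) (x : T) (f : T -> K) :
  f x \is a GRing.unit -> cont_at x f ->
  cont_at x (fun y => (f y)^-1).
Proof.
move=> ux cf; apply: (continuous_comp (g := fun a : K => a^-1)) cf _.
move: h1_inv; rewrite continuous_open_subspace // => /(_ (f x)); apply.
by rewrite inE.
Qed.

Hypothesis h2_dense : dense (range (fun c : F => c%:A : K)).

Lemma rational_approximation n (X : 'rV[K]_n) (W : set 'rV[K]_n) : nbhs X W ->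
  exists Y : 'rV[F]_n, W (map_mx (in_alg K) Y).
Proof.
move=> [P PX PW].
have /choice[y hy] j : exists c : F, P 0 j (c%:A : K).
  have := PX 0 j; rewrite nbhsE => -[V [oV VX] VP].
  have [c' [Vc [c _ cE]]] := h2_dense (ex_intro _ _ VX) oV.
  by exists c; apply: VP; rewrite cE.
exists (\row_j y j); apply: PW => a j; rewrite (ord1 a) !mxE.
exact: hy.
Qed.

Lemma finite_field_dense : hausdorff_space K -> ~ inexhaustible F ->
  forall a : K, exists c : F, a = c%:A.
Proof.
move=> hK /existsNP[s hs] a.
have cl : closed (range (fun c : F => c%:A : K)).
  have /accessible_finite_set_closed := hausdorff_accessible hK; apply.
  have -> : range (fun c : F => c%:A : K) = [set` [seq (c%:A : K) | c <- s]].
    apply/seteqP; split=> [_ [c _ <-]|_ /= /mapP[c _ ->]]; last by exists c.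
    apply/mapP; exists c => //; apply: contrapT => cs; apply: hs.
    by exists c; apply/negP.
  exact: finite_seq.
apply: contrapT => na.
have [|x [/= nx [c _ cx]]] := h2_dense (O := ~` range (fun c : F => c%:A : K)) _ (closed_openC cl).
  by exists a => -[c _ ca]; apply: na; exists c.
by apply: nx; exists c.
Qed.

End TopologicalAlgebra.

(** The inverses in the factors assemble to an element [v], and uniqueness of components identifies
    [u v] with 1. *)
Lemma product_unit (K : comUnitRingType) (n : nat) (k : 'I_n -> fieldType)
    (pr : forall i, {rmorphism K -> k i}) (u : K) :
  (forall x : forall i, k i, exists! a : K, forall i, pr i a = x i) ->
  (forall i, pr i u != 0) -> u \is a GRing.unit.
Proof.
move=> hpr hu; have [v [hv _]] := hpr (fun i => (pr i u)^-1).
have [w [_ uniq]] := hpr (fun=> 1).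
have w1 : w = 1 by apply: uniq => i; exact: rmorph1.
have wuv : w = u * v by apply: uniq => i; rewrite rmorphM hv mulfV ?hu.
by apply/unitrPr; exists v; rewrite -wuv.
Qed.

Section PointCoordinates.
Variables (F : fieldType) (K : topComUnitAlgType F) (R : comAlgType F).

Lemma point_ext_sum (phi : points K R) (s : seq (R * K)) :
  point_ext phi (\sum_(p <- s) @tens F (algmod (algebra_of R)) K p.1 p.2) =
  \sum_(p <- s) (phi : {lrmorphism R -> K}) p.1 * p.2.
Proof.
have bal : balanced (fun (r : algmod (algebra_of R)) (k : K) =>
    (phi : {lrmorphism R -> K}) r * k).
  split=> [x y k|x k l|c x k]; first by rewrite rmorphD mulrDl.
    by rewrite mulrDr.
  rewrite algmodZ /= mulr_algl linearZ /= -scalerAl scalerAr //.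
rewrite /point_ext; elim: s => [|p s IH].
  by rewrite !big_nil (tlift0 bal).
by rewrite !big_cons (tliftD _ _ bal) IH (tlift_tens _ _ bal).
Qed.

End PointCoordinates.

Section Density.
Variables (F : fieldType) (K : topComUnitAlgType F).
Hypothesis h1_open : open [set a : K | a \is a GRing.unit].
Hypothesis h1_inv : {within [set a : K | a \is a GRing.unit],
  continuous (fun a : K => a^-1)}.
Hypothesis h2_dense : dense (range (fun c : F => c%:A : K)).
Hypothesis inf : inexhaustible F.
Variables (R : comAlgType F) (C : cayley_model R).
Local Notation G := (gmat C).
Local Notation d := (deg C).
Local Notation kap := (affine_point (kbase C) (kproj C)).
Local Notation "M %:L" := (map_mx (in_alg _) M) (at level 2, format "M %:L").
Local Notation S := (cring C inf).

(** An explicit quotient, to make continuity in [X] provable: the denominator is a power of [gdet],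
    hence a unit wherever [kap X] is invertible. *)
Definition cval (u : S) (X : 'rV[K]_(d * d)) : K :=
  mev X (numer u) * (mev X (denom u))^-1.

Lemma cvalE (h : {lrmorphism S -> K}) (X : 'rV[K]_(d * d)) (u : S) :
  (forall p, h (to_loc (gdet_pow C inf) p) = mev X p) -> h u = cval u X.
Proof.
move=> hE; have Mu := denomP u.
have uV : mev X (denom u) * h (mkfrac (gdet_pow C inf) 1 (denom u)) = 1.
  by rewrite -hE -rmorphM to_locV // rmorph1.
have ud : mev X (denom u) \is a GRing.unit by apply/unitrPr; eexists; exact: uV.
rewrite -{1}(fracK u) mkfracE // rmorphM /= hE /cval; congr (_ * _).
by apply: (mulrI ud); rewrite uV mulrV.
Qed.

Lemma cont_cval (u : S) (X : 'rV[K]_(d * d)) :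
  \det (kap X) \is a GRing.unit -> cont_at X (cval u).
Proof.
move=> ud; apply: cont_mul; first exact: cont_mev.
apply: cont_inv => //; last exact: cont_mev.
have [k ->] := denomP u; rewrite rmorphXn /= mev_gdet; exact: unitrX.
Qed.

(** Along the family [theta0] the coordinates of a point are a function [Phi] of [X], continuous at
    [X0]; so approximating the parameter, whose entries are free, approximates the point. *)
Lemma rational_points_approx (R0 : comAlgType F) (n : nat)
    (i : closed_immersion K R0 n) (theta0 : {lrmorphism R0 -> S})
    (X0 : 'rV[K]_(d * d)) (h0 : {lrmorphism S -> K}) (B : set 'rV[K]_n) :
  (forall p, h0 (to_loc (gdet_pow C inf) p) = mev X0 p) ->
  \det (kap X0) \is a GRing.unit -> open B ->
  B (coords i (h0 \o theta0 : {lrmorphism R0 -> K})) ->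
  exists phi : points K R0, rational_points K R0 phi /\ B (coords i phi).
Proof.
move=> h0E u0 oB Bh0.
have /choice[s sE] j : exists s : seq (R0 * K),
    coord_map i (mpolyX K (mnm1 j)) =
    \sum_(p <- s) @tens F (algmod (algebra_of R0)) K p.1 p.2.
  have [s hs] := @tensor_sum F (algmod (algebra_of R0)) K
    (coord_map i (mpolyX K (mnm1 j))).
  by exists s; exact: hs.
pose Phi X := \row_j \sum_(p <- s j) cval (theta0 p.1) X * p.2.
have PhiE (h : {lrmorphism S -> K}) X :
    (forall p, h (to_loc (gdet_pow C inf) p) = mev X p) ->
    coords i (h \o theta0 : {lrmorphism R0 -> K}) = Phi X.
  move=> hE; apply/rowP => j; rewrite !mxE sE.
  rewrite (point_ext_sum (h \o theta0 : {lrmorphism R0 -> K})).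
  by apply: eq_bigr => p _ /=; rewrite (cvalE _ hE).
rewrite (PhiE h0 X0 h0E) in Bh0.
have cPhi : nbhs X0 (Phi @^-1` B).
  have /= [P PB PsB] := open_nbhs_nbhs (conj oB Bh0 : open_nbhs (Phi X0) B).
  have : nbhs X0 [set X | forall j, P 0 j (Phi X 0 j)].
    refine (@filter_forall _ _ (fun j => [set X | P 0 j (Phi X 0 j)]) _ (nbhs_filter X0) _) => j.
    suff : cont_at X0 (fun X => Phi X 0 j) by apply; exact: PB.
    rewrite (_ : (fun X => _) = fun X => \sum_(p <- s j) cval (theta0 p.1) X * p.2).
      by apply: cont_sum => p; apply: cont_mul (cont_cval u0) (@cont_cst _ _ _ _ _).
    by apply/funext => X; rewrite mxE.
  by apply: filterS => X hX; apply: PsB => a j; rewrite (ord1 a).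
(* The approximation must also remain in the parameter space, an open condition because the units of
   [K] are open. *)
have cdet : nbhs X0 [set X | \det (kap X) \is a GRing.unit].
  have cd : cont_at X0 (fun X => \det (kap X)).
    rewrite (_ : (fun X => _) = fun X => mev X (gdet C)); first exact: cont_mev.
    by apply/funext => X; rewrite mev_gdet.
  exact: cd (open_nbhs_nbhs (conj h1_open u0)).
have [Y [BY uY]] := rational_approximation h2_dense (filterI cPhi cdet).
rewrite /= -kapFE det_map_mx in uY.
(* The image of the determinant is a unit of [K], so the determinant is a nonzero element of the
   field [F]. *)
have gY : good C Y.
  rewrite /good unitmxE unitfE; apply: contraTneq uY => ->.
  by rewrite rmorph0 unitr0.
have [h hE] := @cring_ev _ _ C inf (F^o : comAlgType F) Y _ (mulmxV gY).
pose hK : {lrmorphism S -> K} := scalar K \o h.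
have hKE p : hK (to_loc (gdet_pow C inf) p) = mev (map_mx (in_alg K) Y) p.
  rewrite /= hE /mev /mmap rmorph_sum; apply: eq_bigr => m _ /=.
  rewrite rmorphM /=; congr (_ * _); first by congr (_ *: _); exact: mulr1.
  rewrite /mmap1 rmorph_prod; apply: eq_bigr => l _.
  by rewrite rmorphXn /= !mxE.
exists (hK \o theta0 : {lrmorphism R0 -> K}); split.
  by exists (h \o theta0 : {lrmorphism R0 -> F^o}).
by rewrite (PhiE hK _ hKE).
Qed.

End Density.
Lemma rational_points_dense (F : fieldType) (K : topComUnitAlgType F)
  (hK_product : finite_product_of_fields K)
  (h1_open : open [set a : K | a \is a GRing.unit])
  (h1_inv : {within [set a : K | a \is a GRing.unit],
               continuous (fun a : K => a^-1)})
  (h2_dense : dense (range (fun c : F => c%:A : K)))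
  (inf : inexhaustible F) (R : comAlgType F) (C : cayley_model R)
  (eps : {lrmorphism R -> F^o}) (eps1 : map_mx eps (gmat C) = 1%:M)
  (R0 : comAlgType F) (O0 : identity_component eps R0)
  (n : nat) (i : closed_immersion K R0 n) :
  dense (rational_points K R0 : set (initial_topology (coords i))).
Proof.
move=> V [phi0 Vphi0] [B oB BE]; rewrite -BE in Vphi0 *.
pose phi : {lrmorphism R -> K} := (phi0 : {lrmorphism R0 -> K}) \o incl O0.
have phi_in : in_component eps phi by exact: incl_in.
have [m [k [pr hpr]]] := hK_product.
pose j l : {rmorphism F -> k l} := pr l \o in_alg K.
have [xs [gxs oxs hxs]] : exists xs, [/\ all (good C) xs, odd (size xs) &
    forall l, \det (map_mx (j l) (wmat C xs) - map_mx (pr l) (map_mx phi (gmat C))) != 0].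
  apply: common_odd_word => // l.
  (* The kernel of [pr l] is a point of [Spec K]; its image lies in the component, which provides an
     odd word for the factor [k l]. *)
  have := component_odd_points inf eps1 (phi_in (Spec_map (pr l) (Spec_pt (k l)))).
  move=> [_ [xs [gxs oxs ->]] h]; exists xs; split=> //; apply: contra_notN h => /eqP h.
  apply: etrans h; rewrite -[LHS]/(pr l (phi _)) -!det_map_mx; congr (\det _).
  apply/matrixP => a b; rewrite !mxE !rmorphB /=; congr (pr l _ - _).
  exact: (rmorph_alg phi).
have [psi psiE] := wmat_point eps1 gxs.
set D := map_mx (in_alg K) (map_mx psi (gmat C)) - map_mx phi (gmat C).
have uD : \det D \is a GRing.unit.
  apply: product_unit hpr _ => l; rewrite -det_map_mx map_mxB psiE -map_mx_comp.
  exact: hxs.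
have [X0 [k0 [X0k phiE]]] := cayley_factor (mulrV uD).
have [th thE] := cring_map C inf psi eps.
have th_in := odd_word_component eps1 gxs oxs psiE thE.
(* The whole family [o s_X] lies in the component, so it factors through [R0] and its rational
   members are rational points of the component. *)
have [th0 [th0E _]] := incl_lift O0 th_in.
have [h0 h0E] := cring_ev inf X0k.
(* Both sides restrict to [phi] along [incl], and such a lift is unique. *)
have h0phi : (h0 \o th0 : {lrmorphism R0 -> K}) = phi0.
  have [chi [_ uniq]] := incl_lift O0 phi_in.
  have <- : chi = phi0 by apply: uniq.
  have e : (h0 \o th : {lrmorphism R -> K}) = phi.
    apply: (gmat_inj (c := C)).
    by rewrite (thE K X0 k0 h0 h0E X0k) eps1 map_mx1 mulmx1 -phiE.
  apply/esym/uniq => r; rewrite -e /=; congr (h0 _); exact: th0E.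
have u0 : \det (affine_point (kbase C) (kproj C) X0) \is a GRing.unit.
  by apply/unitrPr; exists (\det k0); rewrite -det_mulmx X0k det1.
have Bh0 : B (coords i (h0 \o th0 : {lrmorphism R0 -> K})) by rewrite h0phi.
have [psi' [psi'_rat Bpsi']] :=
  rational_points_approx h1_open h1_inv h2_dense h0E u0 oB Bh0.
by exists psi'.
Qed.

Theorem corollary3p7
  (F : fieldType) (K : topComUnitAlgType F)
  (hK_hausdorff : hausdorff_space K)
  (hK_product : finite_product_of_fields K)
  (A : algebra F) (U : unitary_algebra A)
  (P : lmodType A^c) (hP : fg_projective P)
  (f : {linear P -> dual U P}) (hf : unimodular f)
  (h0 : ~ exists phi : {rmorphism K -> 'F_2}, forall y, exists x, phi x = y)
  (h1_open : open [set a : K | a \is a GRing.unit])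
  (h1_inv : {within [set a : K | a \is a GRing.unit],
               continuous (fun a : K => a^-1)})
  (h2_dense : dense (range (fun c : F => c%:A : K)))
  (h2_units : forall c : F,
     ((c%:A : K) \is a GRing.unit) = (c \is a GRing.unit))
  (h3_A : fg_projective (algmod A))
  (h3_Lambda : F_summand U)
  (R : comAlgType F) (O : represents f R)
  (eps : {lrmorphism R -> F^o}) (heps : is_identity_point O eps)
  (R0 : comAlgType F) (O0 : identity_component eps R0)
  (n : nat) (i : closed_immersion K R0 n) :
  dense (rational_points K R0 : set (initial_topology (coords i))).
Proof.
have [cA] := fg_projective_coordinates h3_A.
have [cP] := fg_projective_coordinates (resmod_fg_projective h3_A hP).
have [nu [nuP nuB]] := nu_exists h3_Lambda.
have [C hC] := represents_cayley_model cP cA nuP nuB hf O.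
have [inf|fin] := pselect (inexhaustible F).
  exact: (rational_points_dense hK_product h1_open h1_inv h2_dense inf (hC _ heps)).
have surj := finite_field_dense h2_dense hK_hausdorff fin.
have [c cE] := choice surj.
have cK (x y : F) : (x%:A : K) = y%:A -> x = y.
  exact: (fmorph_inj (in_alg K)).
(* Here every element of [K] is a scalar, so the given point is itself rational; [psi] is [phi0]
   with values read in [F]. *)
move=> V [phi0 Vphi0] oV; exists phi0; split=> //.
pose phi : {lrmorphism R0 -> K} := phi0; pose psi r : F^o := c (phi r).
have cV r : (psi r : F)%:A = phi r :> K by rewrite [RHS]cE.
have psi_zmod : zmod_morphism psi.
  by move=> x y; apply: cK; rewrite scalerBl !cV rmorphB.
have psi_monoid : monoid_morphism psi.
  split=> [|x y]; apply: cK; rewrite cV ?rmorph1 ?scale1r //.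
  by rewrite rmorphM -scalerA cV -[phi y in RHS]mul1r scalerAl cV.
have psi_scalable : scalable psi.
  by move=> a x; apply: cK; rewrite cV linearZ /= -scalerA cV.
pose psiL : {lrmorphism R0 -> F^o} := HB.pack psi
  (GRing.isZmodMorphism.Build _ _ psi psi_zmod)
  (GRing.isMonoidMorphism.Build _ _ psi psi_monoid)
  (GRing.isScalable.Build _ _ _ _ psi psi_scalable).
by exists psiL => r; exact: cE.
Qed.
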